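(* For each $\nu>-1$ the radius of starlikeness $r^\star(h_\nu)$ satisfies $r^\star(h_\nu)<16(\nu+1)_3$. Moreover, if $\nu>-1$, then $$8(\nu+1)_3<r^\star(h_\nu)<\frac{32(\nu+1)_5}{\nu^2+24\nu+71},$$ $$16\sqrt{\frac{(\nu+1)_3(\nu+1)_5}{\nu^2+24\nu+71}}<r^\star(h_\nu)<\frac{16(\nu+1)_3(\nu+6)(\nu+7)(\nu^2+24\nu+71)}{\nu_5}$$ and $$16\sqrt[3]{\frac{((\nu+1)_3)^2(\nu+1)_7}{\nu_5}}<r^\star(h_\nu)<\frac{16(\nu+1)_5(\nu+8)(\nu+9)\nu_5}{\nu_6},$$ where $$\nu_5=\nu^4+37\nu^3+593\nu^2+3275\nu+5598$$ and $$\nu_6=\nu^8+68\nu^7+2062\nu^6+36519\nu^5+388627\nu^4+2477862\nu^3+9218508\nu^2+18391471\nu+15167442.$$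
   Context: For $\nu>-1$, with $J_\nu,I_\nu$ the Bessel and modified Bessel functions of the first kind, $$\mathbf{\Phi}_\nu(z)=J_\nu(z)I_\nu'(z)-J_\nu'(z)I_\nu(z)=2\sum_{n\ge0}\frac{(-1)^n(z/2)^{2\nu+4n+1}}{n!\,\Gamma(\nu+n+1)\Gamma(\nu+2n+2)},$$ $$h_\nu(z)=2^{2\nu}z^{-\frac{\nu}{2}+\frac34}\Gamma(\nu+1)\Gamma(\nu+2)\mathbf{\Phi}_\nu(\sqrt[4]{z})=\sum_{n\ge0}\frac{(-1)^n z^{n+1}}{2^{4n}n!\,(\nu+1)_n(\nu+2)_{2n}}.$$ The radius of starlikeness is $r^\star(f)=\sup\{r>0:\operatorname{Re}(zf'(z)/f(z))>0\text{ for all }|z|<r\}$. Pochhammer symbol: $(a)_0=1$, $(a)_n=a(a+1)\cdots(a+n-1)$. *)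

(* Defs.v *)
From Stdlib Require Import Reals Factorial.
From Coquelicot Require Import Coquelicot.
Open Scope R_scope.

(* (a)_n = a (a+1) ... (a+n-1) *)
Fixpoint pochhammer (a : R) (n : nat) : R :=
  match n with
  | O => 1
  | S k => pochhammer a k * (a + INR k)
  end.

(* Euler's integral of the second kind; it is only meaningful for 0 < x, and
   only positive arguments occur below. *)
Definition Gamma (x : R) : R :=
  RInt_gen (fun t => Rpower t (x - 1) * exp (- t))
    (at_right 0) (Rbar_locally p_infty).

(* Principal argument, in (-PI, PI]; the value at 0 is irrelevant. *)
Definition Carg (z : C) : R :=
  if Rle_dec 0 (Im z) then acos (Re z / Cmod z) else - acos (Re z / Cmod z).

(* Principal branch of z^a for a real exponent a and z <> 0. *)
Definition Cpower (z : C) (a : R) : C :=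
  (RtoC (Rpower (Cmod z) a) * (cos (a * Carg z), sin (a * Carg z)))%C.

Definition CSeries (u : nat -> C) : C :=
  (Series (fun n => Re (u n)), Series (fun n => Im (u n))).

Definition BesselJ (nu : R) (z : C) : C :=
  CSeries (fun n =>
    (RtoC ((-1) ^ n / (INR (fact n) * Gamma (nu + INR n + 1)))
     * Cpower (z / RtoC 2) (2 * INR n + nu))%C).

Definition BesselI (nu : R) (z : C) : C :=
  CSeries (fun n =>
    (RtoC (1 / (INR (fact n) * Gamma (nu + INR n + 1)))
     * Cpower (z / RtoC 2) (2 * INR n + nu))%C).

Definition Phi (nu : R) (z : C) : C :=
  (BesselJ nu z * C_derive (BesselI nu) z
   - C_derive (BesselJ nu) z * BesselI nu z)%C.

(* With principal branches throughout, the fractional powers cancel (on the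
   negative axis as well), so that for z <> 0 this is the sum of
     (-1)^n z^(n+1) / (2^(4n) n! (nu+1)_n (nu+2)_(2n)),
   an entire function whose value at 0 is 0. *)
Definition h (nu : R) (z : C) : C :=
  if Req_EM_T (Cmod z) 0 then RtoC 0
  else (RtoC (Rpower 2 (2 * nu)) * Cpower z (- nu / 2 + 3 / 4)
        * RtoC (Gamma (nu + 1) * Gamma (nu + 2))
        * Phi nu (Cpower z (1 / 4)))%C.

(* The supremum is taken in the extended reals.  For f(z) = z + O(z^2) the
   function z f'(z) / f(z) has a removable singularity at 0, with value 1, so
   the point 0 imposes no condition; any other zero of f is a pole, where the
   condition fails.  [C_derive] is the complex derivative at every point where
   f is complex differentiable. *)
Definition starlike_radius (f : C -> C) : Rbar :=
  Lub_Rbar (fun r : R =>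
    0 < r /\
    forall z : C, z <> RtoC 0 -> Cmod z < r ->
      f z <> RtoC 0 /\ 0 < Re (z * C_derive f z / f z)%C).

Definition nu5 (nu : R) : R :=
  nu ^ 4 + 37 * nu ^ 3 + 593 * nu ^ 2 + 3275 * nu + 5598.

Definition nu6 (nu : R) : R :=
  nu ^ 8 + 68 * nu ^ 7 + 2062 * nu ^ 6 + 36519 * nu ^ 5 + 388627 * nu ^ 4
  + 2477862 * nu ^ 3 + 9218508 * nu ^ 2 + 18391471 * nu + 15167442.

(* Main.v *)
Require Import Defs.
From Stdlib Require Import Reals Factorial Lra Lia List Classical.
From Coquelicot Require Import Coquelicot.
(** Write [h_nu (z) = z g (z)] with [g (z) = sum_k a_k z^k].

    The coefficients of [g] come from those of [exp (- z / 64)] by dividing by the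
    Pochhammer symbols [(y)_k] of [y = nu + 1, (nu + 2) / 2, (nu + 3) / 2].  Since
    [(y + n)_k / (y)_k = prod_(j < n) (1 + k / (y + j))], such a division is a limit of
    operators [p |-> p + X p' / x] with [x > 0].  Each of these sends a polynomial
    [prod (1 - b X)] with all [b >= 0] to one of the same form
    ([RealRooted.factored_coef_euler]).  Starting from [(1 - X / n)^n] one sees that [g] is a
    locally uniform limit of polynomials [prod (1 - b X)] with [b >= 0]
    ([hcoef_laguerre_polya]), and so is [h_nu' = g + z g'], as [x = 1] is allowed.

    Let [x0] be the first positive zero of [h_nu'].  For such a product and [|z|] below its
    first zero, [z p' / p = - sum b z / (1 - b z)] has real part at least the value at [|z|].
    The inequality passes to [g], so [z h_nu' / h_nu = 1 + z g' / g] has positive real part for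
    [|z| < x0], while it vanishes at [x0]: the radius of starlikeness is [x0]
    ([starlike_radius_eq]).

    The bounds are Euler-Rayleigh inequalities.  Let [s_k] be the sum of the [k]-th
    powers of the reciprocal zeros of [h_nu'], which Newton's identities express through its
    Taylor coefficients.  All reciprocal zeros lie between [0] and [1 / x0], hence
    [1 <= x0^k s_k] and [x0 s_(k+1) <= s_k].  In the limit only these weak forms survive,
    together with the Cauchy-Schwarz inequality for the differences [s_k - x0 s_(k+1)]; strictness is
    recovered from the explicit inequality [s_3^2 < s_2 s_4], a polynomial inequality in
    [nu + 1] with nonnegative coefficients ([strict_euler_rayleigh], [sigma_strict]).  The bound
    [x0 < 16 (nu+1)_3] comes in the same way from [- x0 g' (x0) = g (x0)] and
    [b x / (1 - b x) >= b x + (b x)^2].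

    It remains to identify [h_nu] with its power series ([h_eq_CPSeries]).  The Gamma
    functional equation turns the Bessel series into [P (w) j (w^2/4)] and [P (w) i (w^2/4)]
    with [P] a principal power and [j], [i] entire.  The derivative of [P] cancels in
    the Wronskian, and the coefficients of [j theta i - i theta j], with [theta = u d/du], satisfy a
    two-step recurrence that follows from the Bessel equations of [j] and [i]. *)

Open Scope R_scope.

(** * Polynomials with positive zeros *)

(** The coefficients of the product of the [1 - b X].  Listing the reciprocals [b] of the
    zeros lets [b = 0] stand for an absent zero, so no degree has to be tracked. *)
Fixpoint factored_coef (s : list R) (k : nat) : R :=
  match s with
  | nil => match k with O => 1 | S _ => 0 end
  | b :: t => factored_coef t k - b * match k with O => 0 | S j => factored_coef t j end
  end.

Definition nonneg_list (s : list R) : Prop := List.Forall (fun b => 0 <= b) s.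

Module RealRooted.
From mathcomp Require Import all_boot all_order all_algebra complex Rstruct ring.
Import Order.TTheory GRing.Theory Num.Theory.
Local Open Scope ring_scope.
Set Implicit Arguments.
Unset Strict Implicit.
Unset Printing Implicit Defensive.

Definition fprod (K : fieldType) (s : seq K) : {poly K} :=
  \prod_(b <- s) (1 - b *: 'X).

Lemma fprod0 (K : fieldType) (s : seq K) : (fprod s).[0] = 1.
Proof.
rewrite /fprod horner_prod big1 // => b _.
by rewrite !hornerE ?mulr0 ?subr0.
Qed.

(** [b / (1 - b z) = (b - b^2 z^* ) / |1 - b z|^2], and expressions [alpha - beta z^*] with
    nonnegative [alpha], [beta] are closed under sums. *)
Lemma fprod_logderiv (K : numClosedFieldType) (s : seq K) (z : K) :
  {in s, forall b, 0 <= b} -> (fprod s).[z] != 0 ->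
  exists alpha beta : K, [/\ 0 <= alpha, 0 <= beta &
    (fprod s)^`().[z] = - (alpha - beta * z^*) * (fprod s).[z]].
Proof.
rewrite /fprod; elim: s => [|b s IH] Hs.
  by exists 0, 0; rewrite !big_nil derivC !hornerE; split=> //; rewrite ?mul0r ?subr0 ?oppr0 ?mul0r ?mulr1.
rewrite !big_cons hornerM mulf_eq0 negb_or => /andP[Hb /[dup] Hp].
case/IH => [c cs|al [be [Hal Hbe E]]]; first by apply: Hs; rewrite inE cs orbT.
have b0 : 0 <= b by apply: Hs; rewrite inE eqxx.
set d := (1 - b *: 'X).[z] in Hb.
have dE : d = 1 - b * z by rewrite /d !hornerE.
exists (al + b / `|d| ^+ 2), (be + b ^+ 2 / `|d| ^+ 2).
have D0 : 0 <= `|d| ^+ 2 by rewrite exprn_ge0.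
split; first by rewrite addr_ge0 // divr_ge0.
  by rewrite addr_ge0 // divr_ge0 // exprn_ge0.
rewrite derivM hornerD !hornerM E -/d.
have -> : (1 - b *: 'X)^`().[z] = - b by rewrite derivB derivC derivZ derivX sub0r hornerN hornerZ hornerC mulr1.
have bR : b^* = b by apply/CrealP; apply: ger0_real.
have cE : d^* = 1 - b * z^* by rewrite dE rmorphB rmorph1 rmorphM /= bR.
rewrite normCK.
have Hc : d^* != 0 by rewrite conjC_eq0.
move: (\prod_(b0 <- s) _).[z] => P.
have -> : al + b / (d * d^*) - (be + b ^+ 2 / (d * d^*)) * z^* = al - be * z^* + b / d.
  by move: Hc; rewrite cE; move: z^* => w Hw; field; rewrite Hw Hb.
by field.
Qed.

(** At a zero of [p + X p' / x] that is no zero of [p], the logarithmic derivative gives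
    [x = z (alpha - beta z^* )], that is [z^* (x + beta |z|^2) = alpha |z|^2]. *)
Lemma euler_root_ge0 (K : numClosedFieldType) (s : seq K) (x z : K) :
  {in s, forall b, 0 <= b} -> 0 < x ->
  (fprod s + x^-1 *: ('X * (fprod s)^`())).[z] = 0 -> 0 <= z.
Proof.
move=> Hs x0; rewrite hornerD hornerZ hornerM hornerX.
have [p0 _|p0] := eqVneq (fprod s).[z] 0.
  move/eqP: p0; rewrite /fprod horner_prod prodf_seq_eq0 => /hasP[b bs] /=.
  rewrite !hornerE subr_eq0 => /eqP bz.
  have b0 := Hs _ bs.
  have bn : b != 0 by apply: contra_eq_neq bz => ->; rewrite mul0r oner_neq0.
  have -> : z = b^-1 by apply: (mulfI bn); rewrite -bz divff.
  by rewrite invr_ge0.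
have [al [be [Hal Hbe ->]]] := fprod_logderiv Hs p0.
move: p0; set p := (fprod s).[z] => p0 H.
have xn : x != 0 by rewrite gt_eqF.
have {}H : x = z * (al - be * z^*).
  apply: (mulIf p0).
  have -> : z * (al - be * z^*) * p =
      x * p - x * (p + x^-1 * (z * (- (al - be * z^*) * p))).
    by field.
  by rewrite H mulr0 subr0.
have zn : z != 0 by apply: contra_eq_neq H => ->; rewrite mul0r.
have E : z^* * (x + be * `|z| ^+ 2) = al * `|z| ^+ 2.
  by rewrite {1}H normCK; ring.
have N0 : 0 < x + be * `|z| ^+ 2 by rewrite ltr_wpDr // mulr_ge0 // exprn_ge0.
have Ez : z^* = al * `|z| ^+ 2 / (x + be * `|z| ^+ 2).
  by rewrite -E mulfK // gt_eqF.
rewrite -conjC_ge0 Ez divr_ge0 ?(ltW N0) // mulr_ge0 // exprn_ge0 //.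
Qed.

(** The polynomial splits over an algebraically closed field, and its value [1] at [0]
    fixes the leading coefficient. *)
Lemma euler_factor (K : numClosedFieldType) (s : seq K) (x : K) :
  {in s, forall b, 0 <= b} -> 0 < x ->
  exists s' : seq K, {in s', forall b, 0 <= b} /\
    fprod s + x^-1 *: ('X * (fprod s)^`()) = fprod s'.
Proof.
move=> Hs x0; set q := (_ + _).
have q0 : q.[0] = 1 by rewrite /q hornerD hornerZ hornerM hornerX mul0r mulr0 addr0 fprod0.
have [r rE] := closed_field_poly_normal q.
have Hr z : z \in r -> 0 < z.
  move=> zr; have qz : q.[z] = 0.
    apply/eqP; rewrite rE hornerZ mulf_eq0 horner_prod prodf_seq_eq0.
    by apply/orP; right; apply/hasP; exists z => //=; rewrite !hornerE subrr.
  rewrite lt0r (euler_root_ge0 Hs x0 qz) andbT.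
  by apply: contra_eq_neq qz => ->; rewrite q0 oner_neq0.
exists [seq z^-1 | z <- r]; split.
  by move=> b /mapP[z zr ->]; rewrite invr_ge0 ltW ?Hr.
have E : fprod [seq z^-1 | z <- r] = (\prod_(z <- r) (- z^-1)) *: \prod_(z <- r) ('X - z%:P).
  rewrite /fprod big_map; elim: r Hr {rE} => [|z r IH] Hr.
    by rewrite !big_nil scale1r.
  rewrite !big_cons IH => [|y yr]; last by apply: Hr; rewrite inE yr orbT.
  have zn : z != 0 by rewrite gt_eqF // Hr // inE eqxx.
  have -> : 1 - z^-1 *: 'X = - z^-1 *: ('X - z%:P).
    by rewrite scalerBr !scaleNr opprK addrC -[z^-1 *: z%:P]mul_polyC -polyCM mulVf.
  by rewrite -scalerAl -scalerAr scalerA.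
have := fprod0 [seq z^-1 | z <- r]; rewrite E hornerZ; move: q0; rewrite {1}rE hornerZ.
move: (_.[0]) => P E1 E2.
have Pn : P != 0 by apply: contra_eq_neq E1 => ->; rewrite mulr0 eq_sym oner_neq0.
rewrite rE; congr (_ *: _).
by apply: (mulIf Pn); rewrite E1 E2.
Qed.

Lemma fprod_map (K L : fieldType) (f : {rmorphism K -> L}) (s : seq K) :
  fprod [seq f b | b <- s] = map_poly f (fprod s).
Proof.
rewrite /fprod big_map rmorph_prod; apply: eq_bigr => b _.
by rewrite rmorphB rmorph1 /= map_polyZ map_polyX.
Qed.

Lemma euler_factor_real (K : rcfType) (s : seq K) (x : K) :
  {in s, forall b, 0 <= b} -> 0 < x ->
  exists s' : seq K, {in s', forall b, 0 <= b} /\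
    fprod s + x^-1 *: ('X * (fprod s)^`()) = fprod s'.
Proof.
move=> Hs x0; pose f := real_complex K.
have fpos b : (0 <= f b) = (0 <= b) by rewrite /f ler0c.
have [| |t [Ht E]] := @euler_factor K[i] [seq f b | b <- s] (f x) _ _.
- by move=> b /mapP[c cs ->]; rewrite fpos Hs.
- by rewrite /f ltcR.
have tE : t = [seq f b | b <- [seq complex.Re b | b <- t]].
  rewrite -map_comp -[LHS]map_id; apply/eq_in_map => b bt /=.
  have := Ht _ bt; case: b {bt} => u v; rewrite lecE /= => /andP[/eqP -> _].
  by [].
exists [seq complex.Re b | b <- t]; split.
  by move=> b bt; rewrite -fpos; apply: Ht; rewrite tE; apply: map_f.
apply: (map_poly_inj f); rewrite -fprod_map -tE -E fprod_map.
by rewrite rmorphD /= map_polyZ rmorphM /= map_polyX deriv_map fmorphV.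
Qed.

Lemma coef_fprod (s : seq R) (k : nat) : (fprod s)`_k = factored_coef s k.
Proof.
rewrite /fprod; elim: s k => [|b s IH] k; first by rewrite big_nil coef1; case: k.
rewrite big_cons mulrBl mul1r coefB IH -scalerAl coefZ coefXM.
by case: k => [|k] //=; rewrite IH.
Qed.

(** On coefficients [p + X p' / x] multiplies the [k]-th one by [1 + k / x]. *)
Lemma factored_coef_euler (s : list R) (x : R) : nonneg_list s -> Rlt (IZR 0) x ->
  exists s', nonneg_list s' /\
    forall k, factored_coef s' k = Rmult (Rplus (IZR 1) (Rdiv (INR k) x)) (factored_coef s k).
Proof.
move=> /List.Forall_forall Hs /RltP x0.
have In_mem (t : seq R) (b : R) : In b t <-> b \in t.
  elim: t => //= c t IH; rewrite inE; split.
    by case=> [->|/IH ->]; rewrite ?eqxx ?orbT.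
  by case/orP=> [/eqP->|/IH]; [left|right].
have [||t [Ht E]] := @euler_factor_real R s x.
- by move=> b /In_mem /Hs /RleP.
- exact: x0.
exists t; split; first by apply/List.Forall_forall => b /In_mem /Ht /RleP.
move=> k; rewrite -!coef_fprod -E coefD coefZ coefXM.
rewrite RmultE RplusE RdivE INRE mulrDl mul1r; congr (_ + _).
case: k => [|k]; first by rewrite /= mulr0 !mul0r.
by rewrite coef_deriv /=; ring.
Qed.
End RealRooted.

(** * Entire power series *)

(** Convergence is taken componentwise because [CSeries] is. *)
Definition is_cseries (u : nat -> C) (l : C) : Prop :=
  is_series (fun n => Re (u n)) (Re l) /\ is_series (fun n => Im (u n)) (Im l).

Lemma is_cseries_unique (u : nat -> C) (l : C) : is_cseries u l -> CSeries u = l.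
Proof.
  intros [H1 H2]. unfold CSeries.
  rewrite (is_series_unique _ _ H1), (is_series_unique _ _ H2).
  now destruct l.
Qed.

Lemma im_le_Cmod (c : C) : Rabs (Im c) <= Cmod c.
Proof. apply (Rle_trans _ _ _ (Rmax_r _ _) (Rmax_Cmod c)). Qed.

Lemma is_cseries_abs (u : nat -> C) (m : nat -> R) :
  (forall n, Cmod (u n) <= m n) -> ex_series m -> is_cseries u (CSeries u).
Proof.
  intros Hu Hm. split; apply Series_correct; apply ex_series_Rabs;
    apply (@ex_series_le R_AbsRing R_CompleteNormedModule _ m); try assumption; intros n.
  - change (Rabs (Rabs (Re (u n))) <= m n). rewrite Rabs_Rabsolu.
    apply (Rle_trans _ _ _ (re_le_Cmod _) (Hu n)).
  - change (Rabs (Rabs (Im (u n))) <= m n). rewrite Rabs_Rabsolu.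
    apply (Rle_trans _ _ _ (im_le_Cmod _) (Hu n)).
Qed.

Lemma is_cseries_ext (u v : nat -> C) (l : C) :
  (forall n, u n = v n) -> is_cseries u l -> is_cseries v l.
Proof.
  intros E [H1 H2]; split;
    [apply (is_series_ext _ _ _ (fun n => f_equal Re (E n)) H1)
    |apply (is_series_ext _ _ _ (fun n => f_equal Im (E n)) H2)].
Qed.

Lemma is_cseries_plus (u v : nat -> C) (k l : C) :
  is_cseries u k -> is_cseries v l -> is_cseries (fun n => (u n + v n)%C) (k + l)%C.
Proof.
  intros [H1 H2] [H3 H4]; split.
  - exact (is_series_plus _ _ _ _ H1 H3).
  - exact (is_series_plus _ _ _ _ H2 H4).
Qed.

Lemma is_cseries_scal (c : C) (u : nat -> C) (l : C) :
  is_cseries u l -> is_cseries (fun n => (c * u n)%C) (c * l)%C.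
Proof.
  intros [H1 H2]; split.
  - apply (is_series_minus _ _ _ _ (is_series_scal (Re c) _ _ H1)
             (is_series_scal (Im c) _ _ H2)).
  - apply (is_series_plus _ _ _ _ (is_series_scal (Re c) _ _ H2)
             (is_series_scal (Im c) _ _ H1)).
Qed.

Lemma is_cseries_decr_1 (u : nat -> C) (l : C) :
  is_cseries (fun n => u (S n)) (l - u O)%C -> is_cseries u l.
Proof.
  intros [H1 H2]; split; apply is_series_decr_1; assumption.
Qed.

Lemma Series_nonneg (m : nat -> R) : ex_series m -> (forall n, 0 <= m n) -> 0 <= Series m.
Proof.
  intros Hm H. rewrite <- (Rmult_0_l (Series m)), <- Series_scal_l.
  apply Series_le; [|assumption]. intros n; rewrite Rmult_0_l.
  split; [apply Rle_refl|apply H].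
Qed.

(** The triangle inequality is reduced to real series by pairing the sum with
    its own conjugate. *)
Lemma is_cseries_Cmod_le (u : nat -> C) (l : C) (m : nat -> R) :
  is_cseries u l -> (forall n, Cmod (u n) <= m n) -> ex_series m ->
  Cmod l <= Series m.
Proof.
  intros Hl Hu Hm.
  assert (Hm0 : forall n, 0 <= m n).
  { intros n; apply (Rle_trans _ _ _ (Cmod_ge_0 (u n)) (Hu n)). }
  assert (HS := Series_nonneg m Hm Hm0).
  destruct (is_cseries_scal (Cconj l) _ _ Hl) as [H _].
  assert (E : Re (Cconj l * l)%C = Cmod l * Cmod l).
  { replace (Cmod l * Cmod l) with (Cmod l ^ 2) by ring.
    rewrite Cmod2_alt. destruct l; simpl; ring. }
  rewrite E in H.
  assert (HB : Cmod l * Cmod l <= Cmod l * Series m).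
  { rewrite <- (is_series_unique _ _ H), <- Series_scal_l.
    eapply Rle_trans; [apply Rle_abs|].
    assert (Hex : ex_series (fun n => Cmod l * m n)).
    { apply (ex_series_scal_l (Cmod l) m Hm). }
    assert (Hb : forall n, Rabs (Re (Cconj l * u n)%C) <= Cmod l * m n).
    { intros n. eapply Rle_trans; [apply re_le_Cmod|].
      rewrite Cmod_mult, Cmod_conj.
      apply Rmult_le_compat_l; [apply Cmod_ge_0|apply Hu]. }
    eapply Rle_trans; [apply Series_Rabs|].
    - apply (@ex_series_le R_AbsRing R_CompleteNormedModule _ (fun n => Cmod l * m n));
        [|assumption].
      intros n. change (Rabs (Rabs (Re (Cconj l * u n)%C)) <= Cmod l * m n).
      rewrite Rabs_Rabsolu. apply Hb.
    - apply Series_le; [|assumption]. intros n; split; [apply Rabs_pos|apply Hb]. }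
  destruct (Rle_lt_or_eq_dec 0 (Cmod l) (Cmod_ge_0 l)) as [Hp|He].
  - apply Rmult_le_reg_l with (Cmod l); assumption.
  - rewrite <- He; assumption.
Qed.

Lemma ex_series_ext_R (a b : nat -> R) :
  (forall n, a n = b n) -> ex_series a -> ex_series b.
Proof. exact (ex_series_ext a b). Qed.

Lemma ex_series_scal_R (c : R) (a : nat -> R) :
  ex_series a -> ex_series (fun n => c * a n).
Proof. exact (ex_series_scal_l c a). Qed.

Definition entire (a : nat -> R) : Prop :=
  forall r, 0 <= r -> ex_series (fun n => Rabs (a n) * r ^ n).

Lemma ex_series_le_R (a m : nat -> R) :
  (forall n, 0 <= a n <= m n) -> ex_series m -> ex_series a.
Proof.
  intros H; apply (@ex_series_le R_AbsRing R_CompleteNormedModule a m).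
  intros n; change (Rabs (a n) <= m n); rewrite Rabs_pos_eq; apply H.
Qed.

Lemma entire_le (a m : nat -> R) :
  (forall n, Rabs (a n) <= m n) -> entire m -> entire a.
Proof.
  intros H Hm r Hr. apply (ex_series_le_R _ (fun n => Rabs (m n) * r ^ n)); [|auto].
  intros n. split; [apply Rmult_le_pos; [apply Rabs_pos|now apply pow_le]|].
  apply Rmult_le_compat_r; [now apply pow_le|].
  apply (Rle_trans _ _ _ (H n) (Rle_abs _)).
Qed.

Lemma entire_ext (a b : nat -> R) : (forall n, a n = b n) -> entire a -> entire b.
Proof.
  intros E Ha r Hr. apply (ex_series_ext_R (fun n => Rabs (a n) * r ^ n)); [|auto].
  intros n; now rewrite E.
Qed.

Lemma entire_scal (c : R) (a : nat -> R) : entire a -> entire (fun n => c * a n).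
Proof.
  intros Ha r Hr.
  apply (ex_series_ext_R (fun n => Rabs c * (Rabs (a n) * r ^ n))).
  { intros n; rewrite Rabs_mult; ring. }
  apply ex_series_scal_R, Ha, Hr.
Qed.

Lemma entire_plus (a b : nat -> R) : entire a -> entire b -> entire (fun n => a n + b n).
Proof.
  intros Ha Hb r Hr.
  apply (ex_series_le_R _ (fun n => Rabs (a n) * r ^ n + Rabs (b n) * r ^ n)).
  - intros n. assert (P : 0 <= r ^ n) by now apply pow_le.
    split; [apply Rmult_le_pos; [apply Rabs_pos|assumption]|].
    rewrite <- Rmult_plus_distr_r. apply Rmult_le_compat_r; [assumption|apply Rabs_triang].
  - apply (ex_series_plus (K := R_AbsRing) (V := R_NormedModule)); auto.
Qed.

(** The operator [z d/dz]. *)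
Definition euler (a : nat -> R) (n : nat) : R := INR n * a n.

Lemma INR_le_pow2 (n : nat) : INR n <= 2 ^ n.
Proof.
  induction n as [|n IH]; [simpl; lra|].
  rewrite S_INR. simpl. assert (1 <= 2 ^ n) by (apply pow_R1_Rle; lra). lra.
Qed.

Lemma entire_euler (a : nat -> R) : entire a -> entire (euler a).
Proof.
  intros Ha r Hr. apply (ex_series_le_R _ (fun n => Rabs (a n) * (2 * r) ^ n)).
  - intros n. unfold euler. rewrite Rabs_mult, (Rabs_pos_eq (INR n)) by apply pos_INR.
    assert (P : 0 <= r ^ n) by now apply pow_le.
    assert (Q := Rabs_pos (a n)). assert (T := pos_INR n).
    split; [apply Rmult_le_pos; [apply Rmult_le_pos|]; assumption|].
    rewrite Rpow_mult_distr.
    replace (Rabs (a n) * (2 ^ n * r ^ n)) with (2 ^ n * Rabs (a n) * r ^ n) by ring.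
    apply Rmult_le_compat_r; [assumption|].
    apply Rmult_le_compat_r; [assumption|apply INR_le_pow2].
  - apply Ha; lra.
Qed.

Definition shift (a : nat -> R) (n : nat) : R :=
  match n with O => 0 | S m => a m end.

Lemma entire_shift (a : nat -> R) : entire a -> entire (shift a).
Proof.
  intros Ha r Hr. apply ex_series_incr_1. simpl.
  apply (ex_series_ext_R (fun n => r * (Rabs (a n) * r ^ n))).
  { intros n; simpl; ring. }
  apply ex_series_scal_R, Ha, Hr.
Qed.

Definition CPSeries (a : nat -> R) (z : C) : C := CSeries (fun n => (RtoC (a n) * z ^ n)%C).

Lemma Cmod_term (c : R) (z : C) (n : nat) : Cmod (RtoC c * z ^ n)%C = Rabs c * Cmod z ^ n.
Proof. now rewrite Cmod_mult, Cmod_R, Cmod_pow. Qed.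

Lemma CPSeries_correct (a : nat -> R) (z : C) :
  entire a -> is_cseries (fun n => (RtoC (a n) * z ^ n)%C) (CPSeries a z).
Proof.
  intros Ha. apply is_cseries_abs with (fun n => Rabs (a n) * Cmod z ^ n).
  - intros n; rewrite Cmod_term; apply Rle_refl.
  - apply Ha, Cmod_ge_0.
Qed.

Lemma CPSeries_ext (a b : nat -> R) (z : C) : (forall n, a n = b n) -> CPSeries a z = CPSeries b z.
Proof.
  intros E. unfold CPSeries, CSeries. f_equal; apply Series_ext; intros n; now rewrite E.
Qed.

Lemma CPSeries_plus (a b : nat -> R) (z : C) : entire a -> entire b ->
  CPSeries (fun n => a n + b n) z = (CPSeries a z + CPSeries b z)%C.
Proof.
  intros Ha Hb. apply is_cseries_unique.
  eapply is_cseries_ext; [|apply is_cseries_plus; apply CPSeries_correct; eassumption].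
  intros n; simpl. rewrite RtoC_plus; ring.
Qed.

Lemma CPSeries_scal (c : R) (a : nat -> R) (z : C) : entire a ->
  CPSeries (fun n => c * a n) z = (RtoC c * CPSeries a z)%C.
Proof.
  intros Ha. apply is_cseries_unique.
  eapply is_cseries_ext; [|apply is_cseries_scal; apply CPSeries_correct; eassumption].
  intros n; simpl. rewrite RtoC_mult; ring.
Qed.

Lemma CPSeries_shift (a : nat -> R) (z : C) : entire a -> CPSeries (shift a) z = (z * CPSeries a z)%C.
Proof.
  intros Ha. apply is_cseries_unique, is_cseries_decr_1.
  replace (z * CPSeries a z - RtoC (shift a 0) * z ^ 0)%C with (z * CPSeries a z)%C by (simpl; ring).
  eapply is_cseries_ext; [|apply is_cseries_scal; apply CPSeries_correct; eassumption].
  intros n; simpl; ring.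
Qed.

Lemma CPSeries_real (a : nat -> R) (x : R) : CPSeries a (RtoC x) = RtoC (PSeries a x).
Proof.
  unfold CPSeries, CSeries, RtoC, PSeries. f_equal.
  - apply Series_ext; intros n.
    change (x, 0) with (RtoC x); rewrite <- RtoC_pow; simpl; ring.
  - transitivity (Series (fun n => 0 * 0)).
    + apply Series_ext; intros n.
      change (x, 0) with (RtoC x); rewrite <- RtoC_pow; simpl; ring.
    + rewrite Series_scal_l; ring.
Qed.

Lemma entire_radius (a : nat -> R) (x : R) : entire a -> Rbar_lt (Rabs x) (CV_radius a).
Proof.
  intros Ha. apply Rbar_lt_le_trans with (Finite (Rabs x + 1)); [simpl; lra|].
  destruct (CV_radius_bounded a) as [H _]. apply H.
  assert (P := Rabs_pos x).
  destruct (Ha (Rabs x + 1)) as [l Hl]; [lra|].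
  exists (Series (fun n => Rabs (a n) * (Rabs x + 1) ^ n)). intros n.
  assert (Hp : forall m, 0 <= Rabs (a m) * (Rabs x + 1) ^ m).
  { intros m; apply Rmult_le_pos; [apply Rabs_pos|apply pow_le; lra]. }
  rewrite Rabs_mult, (Rabs_pos_eq (_ ^ n)) by (apply pow_le; lra).
  rewrite (is_series_unique _ _ Hl).
  apply Rle_trans with (sum_n (fun m => Rabs (a m) * (Rabs x + 1) ^ m) n).
  - rewrite sum_n_Reals. destruct n; [simpl; lra|].
    rewrite tech5. assert (0 <= sum_f_R0 (fun m => Rabs (a m) * (Rabs x + 1) ^ m) n).
    { apply cond_pos_sum, Hp. } lra.
  - apply (is_lim_seq_incr_compare _ l Hl). intros m.
    rewrite sum_Sn. unfold plus; simpl. specialize (Hp (S m)); simpl in Hp. lra.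
Qed.

(** Dominated convergence: the majorant controls the tails uniformly, and finitely many
    terms tend to zero one by one. *)
Lemma tannery (d : nat -> nat -> R) (m : nat -> R) :
  (forall N k, 0 <= d N k <= m k) -> ex_series m ->
  (forall k, is_lim_seq (fun N => d N k) 0) ->
  is_lim_seq (fun N => Series (d N)) 0.
Proof.
  intros Hd Hm Hl. apply is_lim_seq_spec. intros eps.
  assert (Hex : forall N, ex_series (d N)).
  { intros N; apply (ex_series_le_R _ m); auto. }
  assert (Hfin : forall K, is_lim_seq (fun N => sum_f_R0 (d N) K) 0).
  { induction K as [|K IH]; [apply Hl|]. simpl.
    replace (Finite 0) with (Finite (0 + 0)) by (f_equal; ring).
    apply is_lim_seq_plus'; [assumption|apply Hl]. }
  assert (Ht : is_lim_seq (sum_n m) (Series m)) by exact (Series_correct _ Hm).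
  apply is_lim_seq_spec in Ht. destruct (Ht (pos_div_2 eps)) as [K HK].
  specialize (HK K (Nat.le_refl K)). rewrite sum_n_Reals in HK. simpl in HK.
  assert (F := Hfin K). apply is_lim_seq_spec in F.
  destruct (F (pos_div_2 eps)) as [N0 HN]. exists N0. intros N HN0.
  specialize (HN N HN0). simpl in HN. rewrite Rminus_0_r in *.
  rewrite (Series_incr_n (d N) (S K)) by (lia || auto). simpl Nat.pred.
  rewrite (Series_incr_n m (S K)) in HK by (lia || auto). simpl Nat.pred in HK.
  assert (T : Series (fun k => d N (S K + k)%nat) <= Series (fun k => m (S K + k)%nat)).
  { apply Series_le; [intros n; apply Hd|]. now apply (ex_series_incr_n m). }
  assert (T0 : 0 <= Series (fun k => d N (S K + k)%nat)).
  { apply Series_nonneg; [now apply (ex_series_incr_n (d N))|intros n; apply Hd]. }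
  assert (T1 : 0 <= sum_f_R0 (d N) K) by (apply cond_pos_sum; intros n; apply Hd).
  rewrite Rabs_pos_eq in * by lra.
  set (A := sum_f_R0 m K) in *. set (B := Series (fun k => m (S K + k)%nat)) in *.
  replace (A - (A + B)) with (- B) in HK by ring.
  rewrite Rabs_Ropp, Rabs_pos_eq in HK by lra. lra.
Qed.

(** * Products of linear factors *)

Fixpoint cprod (s : list R) (z : C) : C :=
  match s with nil => RtoC 1 | b :: t => ((1 - RtoC b * z) * cprod t z)%C end.

Fixpoint rprod (s : list R) (x : R) : R :=
  match s with nil => 1 | b :: t => (1 - b * x) * rprod t x end.

(** [z] times the logarithmic derivative of [cprod]; likewise [rlog] for [rprod]. *)
Fixpoint clog (s : list R) (z : C) : C :=
  match s with
  | nil => RtoC 0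
  | b :: t => (clog t z - RtoC b * z / (1 - RtoC b * z))%C
  end.

Fixpoint rlog (s : list R) (x : R) : R :=
  match s with nil => 0 | b :: t => rlog t x - b * x / (1 - b * x) end.

Fixpoint psum (k : nat) (s : list R) : R :=
  match s with nil => 0 | b :: t => b ^ k + psum k t end.

Lemma factored_coef_cons (b : R) (s : list R) (k : nat) :
  factored_coef (b :: s) k = factored_coef s k + - b * shift (factored_coef s) k.
Proof. destruct k; simpl; ring. Qed.

Lemma euler_factored_coef_cons (b : R) (s : list R) (k : nat) :
  euler (factored_coef (b :: s)) k
  = euler (factored_coef s) k + - b * shift (fun j => factored_coef s j + euler (factored_coef s) j) k.
Proof.
  unfold euler. rewrite factored_coef_cons. destruct k as [|k]; [simpl; ring|].
  unfold shift. rewrite S_INR; ring.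
Qed.

Lemma entire_factored_coef (s : list R) : entire (factored_coef s).
Proof.
  induction s as [|b s IH].
  - intros r Hr. apply (ex_series_le_R _ (fun n => (1 / 2) ^ n)).
    + intros [|n]; simpl; [rewrite Rabs_R1; lra|].
      rewrite Rabs_R0. assert (0 < (1 / 2) ^ n) by (apply pow_lt; lra). lra.
    + apply ex_series_geom. rewrite Rabs_pos_eq; lra.
  - apply (entire_ext (fun k => factored_coef s k + - b * shift (factored_coef s) k)).
    + intros n; symmetry; apply factored_coef_cons.
    + apply entire_plus; [assumption|]. apply entire_scal, entire_shift, IH.
Qed.

Lemma CPSeries_factored_coef (s : list R) (z : C) : CPSeries (factored_coef s) z = cprod s z.
Proof.
  induction s as [|b s IH].
  - apply is_cseries_unique, is_cseries_decr_1. simpl.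
    replace (1 - RtoC 1 * RtoC 1)%C with (RtoC 0 * CPSeries (factored_coef nil) z)%C by ring.
    eapply is_cseries_ext; [|apply is_cseries_scal, CPSeries_correct, entire_factored_coef].
    intros n; simpl; ring.
  - rewrite (CPSeries_ext _ _ z (factored_coef_cons b s)).
    rewrite CPSeries_plus, CPSeries_scal, CPSeries_shift, IH; auto using entire_factored_coef, entire_shift, entire_scal.
    simpl. rewrite RtoC_opp. ring.
Qed.

Lemma cprod_real (s : list R) (x : R) : cprod s (RtoC x) = RtoC (rprod s x).
Proof.
  induction s as [|b s IH]; [reflexivity|].
  simpl. rewrite IH, RtoC_mult, RtoC_minus, RtoC_mult. reflexivity.
Qed.

Lemma PSeries_factored_coef (s : list R) (x : R) : PSeries (factored_coef s) x = rprod s x.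
Proof. apply RtoC_inj. now rewrite <- CPSeries_real, CPSeries_factored_coef, cprod_real. Qed.

Lemma CPSeries_euler_factored_coef (s : list R) (z : C) :
  List.Forall (fun b => 1 - RtoC b * z <> 0)%C s ->
  CPSeries (euler (factored_coef s)) z = (cprod s z * clog s z)%C.
Proof.
  induction s as [|b s IH]; intros H.
  - simpl. replace (RtoC 1 * RtoC 0)%C with (RtoC 0 * CPSeries (factored_coef nil) z)%C by (rewrite CPSeries_factored_coef; ring).
    rewrite <- CPSeries_scal by apply entire_factored_coef. apply CPSeries_ext.
    intros [|n]; unfold euler; simpl; ring.
  - inversion H as [|? ? Hb Hs]; subst.
    assert (E := entire_factored_coef s). assert (E' := entire_euler _ E).
    rewrite (CPSeries_ext _ _ z (euler_factored_coef_cons b s)).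
    rewrite CPSeries_plus, CPSeries_scal, CPSeries_shift, CPSeries_plus, IH, CPSeries_factored_coef;
      auto using entire_shift, entire_scal, entire_plus.
    simpl. rewrite RtoC_opp. field. exact Hb.
Qed.

Lemma RtoC_factor (b x : R) : (1 - RtoC b * RtoC x)%C = RtoC (1 - b * x).
Proof. now rewrite RtoC_minus, RtoC_mult. Qed.

Lemma clog_real (s : list R) (x : R) :
  List.Forall (fun b => 1 - b * x <> 0) s -> clog s (RtoC x) = RtoC (rlog s x).
Proof.
  induction s as [|b s IH]; intros H; [reflexivity|].
  inversion H as [|? ? Hb Hs]; subst. simpl.
  rewrite IH, RtoC_minus, RtoC_factor by assumption.
  unfold Rdiv. rewrite RtoC_mult, RtoC_mult, RtoC_inv by assumption. reflexivity.
Qed.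

Lemma PSeries_euler_factored_coef (s : list R) (x : R) :
  List.Forall (fun b => 1 - b * x <> 0) s ->
  PSeries (euler (factored_coef s)) x = rprod s x * rlog s x.
Proof.
  intros H. apply RtoC_inj.
  rewrite <- CPSeries_real, CPSeries_euler_factored_coef, cprod_real, clog_real, RtoC_mult; auto.
  revert H; apply Forall_impl. intros b Hb E. rewrite RtoC_factor in E.
  apply Hb, RtoC_inj, E.
Qed.

(** * Inequalities for products with nonnegative [b] *)

(** All zeros [1 / b] lie to the right of [x]. *)
Definition zero_free_upto (x : R) (s : list R) : Prop := List.Forall (fun b => 0 <= b /\ b * x < 1) s.

Lemma zero_free_upto_ne (x : R) (s : list R) : zero_free_upto x s -> List.Forall (fun b => 1 - b * x <> 0) s.
Proof. apply Forall_impl. intros b [_ H]; lra. Qed.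

Lemma rprod_pos (x : R) (s : list R) : zero_free_upto x s -> 0 < rprod s x.
Proof.
  induction 1 as [|b s [Hb Hx] Hs IH]; simpl; [lra|].
  apply Rmult_lt_0_compat; lra.
Qed.

Lemma Cmod_factor (b : R) (z : C) : 0 <= b -> 1 - b * Cmod z <= Cmod (1 - RtoC b * z).
Proof.
  intros Hb.
  assert (H := Cmod_triangle (1 - RtoC b * z) (RtoC b * z)).
  replace (1 - RtoC b * z + RtoC b * z)%C with (RtoC 1) in H by ring.
  rewrite Cmod_1, Cmod_mult, Cmod_R, (Rabs_pos_eq b) in H by assumption. lra.
Qed.

Lemma cprod_Cmod_ge (z : C) (s : list R) : zero_free_upto (Cmod z) s ->
  rprod s (Cmod z) <= Cmod (cprod s z).
Proof.
  induction 1 as [|b s [Hb Hx] Hs IH]; simpl; [rewrite Cmod_1; lra|].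
  rewrite Cmod_mult. apply Rmult_le_compat; try assumption.
  - lra.
  - apply Rlt_le, rprod_pos, Hs.
  - now apply Cmod_factor.
Qed.

Lemma factor_ne (z : C) (s : list R) : zero_free_upto (Cmod z) s ->
  List.Forall (fun b => 1 - RtoC b * z <> 0)%C s.
Proof.
  apply Forall_impl. intros b [Hb Hx] E.
  assert (H := Cmod_factor b z Hb). rewrite E, Cmod_0 in H. lra.
Qed.

(** [- u / (1 - u) = 1 - 1 / (1 - u)] and [|1 - u| >= 1 - |u|]. *)
Lemma clog_Re_ge (z : C) (s : list R) : zero_free_upto (Cmod z) s ->
  rlog s (Cmod z) <= Re (clog s z).
Proof.
  intros Hs. assert (Hne := factor_ne z s Hs).
  induction Hs as [|b s [Hb Hx] Hs IH]; [simpl; lra|].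
  inversion Hne as [|? ? Hn Hns]; subst. specialize (IH Hns).
  cbn [rlog clog].
  set (w := (1 - RtoC b * z)%C) in *.
  assert (E : (RtoC b * z / w)%C = (/ w - 1)%C) by (unfold w in *; field; assumption).
  rewrite E.
  replace (b * Cmod z / (1 - b * Cmod z)) with (/ (1 - b * Cmod z) - 1) by (field; lra).
  assert (H : Re (/ w) <= / (1 - b * Cmod z)).
  { apply Rle_trans with (Cmod (/ w)).
    - eapply Rle_trans; [apply Rle_abs|apply re_le_Cmod].
    - rewrite Cmod_inv by assumption. apply Rinv_le_contravar; [lra|].
      now apply Cmod_factor. }
  change (rlog s (Cmod z) - (/ (1 - b * Cmod z) - 1)
          <= Re (clog s z) + - (Re (/ w) + - 1)). lra.
Qed.

(** [u / (1 - u) >= u + u^2] for [0 <= u < 1]; the quadratic term is what makes the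
    bound on the first zero strict. *)
Lemma rlog_le (x : R) (s : list R) : 0 <= x -> zero_free_upto x s ->
  x * psum 1 s + x ^ 2 * psum 2 s <= - rlog s x.
Proof.
  intros Hx. induction 1 as [|b s [Hb Hbx] Hs IH]; simpl in *; [lra|].
  assert (H : b * x + (b * x) ^ 2 <= b * x / (1 - b * x)).
  { apply Rmult_le_reg_r with (1 - b * x); [lra|].
    unfold Rdiv; rewrite Rmult_assoc, Rinv_l by lra.
    assert (0 <= b * x) by now apply Rmult_le_pos.
    assert (0 <= (b * x) ^ 3) by now apply pow_le. nra. }
  nra.
Qed.

Lemma psum_nonneg (k : nat) (s : list R) : nonneg_list s -> 0 <= psum k s.
Proof.
  induction 1 as [|b s Hb Hs IH]; simpl; [lra|].
  assert (0 <= b ^ k) by now apply pow_le. lra.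
Qed.

Lemma psum_mono (k : nat) (x : R) (s : list R) : zero_free_upto x s ->
  0 <= psum k s - x * psum (S k) s.
Proof.
  induction 1 as [|b s [Hb Hbx] Hs IH]; simpl in *; [lra|].
  assert (0 <= b ^ k) by now apply pow_le.
  assert (0 <= b ^ k * (1 - b * x)) by (apply Rmult_le_pos; lra). nra.
Qed.

(** The left-hand side is the integral of the square of [1 - t b] against the
    positive weights [b (1 - b x)]. *)
Lemma psum_quadratic (x t : R) (s : list R) : zero_free_upto x s ->
  0 <= (psum 1 s - x * psum 2 s) - 2 * t * (psum 2 s - x * psum 3 s)
       + t ^ 2 * (psum 3 s - x * psum 4 s).
Proof.
  induction 1 as [|b s [Hb Hbx] Hs IH]; [simpl; lra|].
  assert (H : 0 <= b * (1 - b * x) * (1 - t * b) ^ 2).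
  { apply Rmult_le_pos; [apply Rmult_le_pos; lra|apply pow2_ge_0]. }
  cbn [psum]. nra.
Qed.

Lemma psum_member (k : nat) (s : list R) : nonneg_list s ->
  List.Forall (fun b => b ^ k <= psum k s) s.
Proof.
  induction 1 as [|b s Hb Hs IH]; constructor; simpl.
  - assert (H := psum_nonneg k s Hs). lra.
  - revert IH. apply Forall_impl. intros c Hc.
    assert (0 <= b ^ k) by now apply pow_le. lra.
Qed.

(** [1 - u >= exp (- u / delta)] as long as [0 <= u <= 1 - delta]. *)
Lemma rprod_exp_ge (x delta : R) (s : list R) : 0 < delta -> 0 <= x ->
  List.Forall (fun b => 0 <= b /\ b * x <= 1 - delta) s ->
  1 <= rprod s x * exp (x * psum 1 s / delta).
Proof.
  intros Hd Hx. induction 1 as [|b s [Hb Hbx] Hs IH]; simpl.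
  - rewrite Rmult_0_r. unfold Rdiv; rewrite Rmult_0_l, exp_0; lra.
  - replace (x * (b * 1 + psum 1 s) / delta)
      with (b * x / delta + x * psum 1 s / delta) by (field; lra).
    rewrite exp_plus.
    assert (Hu : 0 <= b * x) by now apply Rmult_le_pos.
    assert (H1 : 1 <= (1 - b * x) * exp (b * x / delta)).
    { apply Rle_trans with ((1 - b * x) * (1 + b * x / delta)).
      - replace ((1 - b * x) * (1 + b * x / delta))
          with (1 + b * x * (1 - delta - b * x) * / delta) by (field; lra).
        assert (0 <= b * x * (1 - delta - b * x) * / delta).
        { apply Rmult_le_pos; [apply Rmult_le_pos; lra|].
          apply Rlt_le, Rinv_0_lt_compat, Hd. } lra.
      - apply Rmult_le_compat_l; [lra|]. apply exp_ineq1_le. }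
    replace ((1 - b * x) * rprod s x * (exp (b * x / delta) * exp (x * psum 1 s / delta)))
      with (((1 - b * x) * exp (b * x / delta)) * (rprod s x * exp (x * psum 1 s / delta)))
      by ring.
    nra.
Qed.

(** * Newton's identities *)

(** The coefficients [a k] of the product of the [1 - b X] are [(-1)^k] times the
    elementary symmetric functions of the [b], which explains the signs.  Only
    [k = 1, 2, 3, 4] is meaningful. *)
Definition newton (k : nat) (a : nat -> R) : R :=
  match k with
  | 1%nat => - a 1%nat
  | 2%nat => a 1%nat ^ 2 - 2 * a 2%nat
  | 3%nat => - a 1%nat ^ 3 + 3 * a 1%nat * a 2%nat - 3 * a 3%nat
  | _ => a 1%nat ^ 4 - 4 * a 1%nat ^ 2 * a 2%nat + 2 * a 2%nat ^ 2
         + 4 * a 1%nat * a 3%nat - 4 * a 4%nat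
  end.

Lemma psum_newton (k : nat) (s : list R) : (1 <= k <= 4)%nat ->
  psum k s = newton k (factored_coef s).
Proof.
  intros Hk.
  assert (H0 : forall t, factored_coef t 0 = 1).
  { induction t as [|b t IH]; simpl; [|rewrite IH]; ring. }
  assert (C : (k = 1 \/ k = 2 \/ k = 3 \/ k = 4)%nat) by lia.
  induction s as [|b s IH].
  - destruct C as [->|[->|[->| ->]]]; simpl; ring.
  - change (psum k (b :: s)) with (b ^ k + psum k s). rewrite IH.
    assert (H0s := H0 s).
    destruct C as [->|[->|[->| ->]]]; unfold newton; simpl; rewrite ?H0s; ring.
Qed.

Lemma newton_lim (k : nat) (p : nat -> nat -> R) (a : nat -> R) :
  (forall j, is_lim_seq (fun N => p N j) (a j)) ->
  is_lim_seq (fun N => newton k (p N)) (newton k a).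
Proof.
  intros H.
  assert (Hc : forall c : R, is_lim_seq (fun _ => c) c) by (intros; apply is_lim_seq_const).
  assert (Ho : forall u (l : R), is_lim_seq u l -> is_lim_seq (fun N => - u N) (- l)).
  { intros u l Hu. exact (proj1 (is_lim_seq_opp u l) Hu). }
  assert (H2 := fun u v k l => is_lim_seq_mult' u v k l).
  assert (Hp : forall u (l : R) m, is_lim_seq u l -> is_lim_seq (fun N => u N ^ m) (l ^ m)).
  { intros u l m Hu. induction m as [|m IH]; simpl; [apply Hc|now apply H2]. }
  destruct k as [|[|[|[|k]]]]; unfold newton, Rminus;
  repeat match goal with
  | |- is_lim_seq (fun N => _ + _) _ => apply is_lim_seq_plus'
  | |- is_lim_seq (fun N => _ * _) _ => apply is_lim_seq_mult'
  | |- is_lim_seq (fun N => - _) _ => apply Ho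
  | |- is_lim_seq (fun N => _ ^ _) _ => apply Hp
  | |- is_lim_seq (fun N => p N _) _ => apply H
  | |- is_lim_seq (fun N => IZR _) _ => apply Hc
  end.
Qed.

(** * Locally uniform limits *)

(** An entire majorant makes coefficientwise convergence locally uniform, and stays one
    when [z d/dz] is applied. *)
Definition dominated (p : nat -> nat -> R) (M a : nat -> R) : Prop :=
  entire M /\ (forall N k, Rabs (p N k) <= M k) /\
  (forall k, is_lim_seq (fun N => p N k) (a k)).

Lemma dominated_limit_le (p : nat -> nat -> R) (M a : nat -> R) (k : nat) :
  dominated p M a -> Rabs (a k) <= M k.
Proof.
  intros (_ & Hb & Hl).
  apply (is_lim_seq_le (fun N => Rabs (p N k)) (fun _ => M k) (Rabs (a k)) (M k)).
  - intros N; apply Hb.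
  - exact (is_lim_seq_abs _ _ (Hl k)).
  - apply is_lim_seq_const.
Qed.

Lemma dominated_entire (p : nat -> nat -> R) (M a : nat -> R) :
  dominated p M a -> entire a.
Proof.
  intros H. apply (entire_le a M); [|apply H].
  intros k; now apply (dominated_limit_le p M a).
Qed.

Lemma dominated_entire_seq (p : nat -> nat -> R) (M a : nat -> R) (N : nat) :
  dominated p M a -> entire (p N).
Proof. intros (HM & Hb & _). now apply (entire_le _ M). Qed.

Lemma dominated_euler (p : nat -> nat -> R) (M a : nat -> R) :
  dominated p M a -> dominated (fun N => euler (p N)) (euler M) (euler a).
Proof.
  intros (HM & Hb & Hl). split; [now apply entire_euler|split].
  - intros N k. unfold euler. rewrite Rabs_mult, (Rabs_pos_eq (INR k)) by apply pos_INR.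
    apply Rmult_le_compat_l; [apply pos_INR|apply Hb].
  - intros k. unfold euler. apply is_lim_seq_mult'; [apply is_lim_seq_const|apply Hl].
Qed.

Lemma dominated_uniform (p : nat -> nat -> R) (M a : nat -> R) (r eps : R) :
  dominated p M a -> 0 <= r -> 0 < eps ->
  exists N0, forall N z, (N0 <= N)%nat -> Cmod z <= r ->
    Cmod (CPSeries (p N) z - CPSeries a z) < eps.
Proof.
  intros HD Hr He. assert (Hd := HD). destruct Hd as (HM & Hb & Hl).
  pose (d := fun N k => Rabs (p N k - a k) * r ^ k).
  assert (Hrk : forall k, 0 <= r ^ k) by (intros; now apply pow_le).
  assert (Hdm : forall N k, 0 <= d N k <= 2 * (Rabs (M k) * r ^ k)).
  { intros N k. unfold d. split; [apply Rmult_le_pos; [apply Rabs_pos|apply Hrk]|].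
    rewrite <- Rmult_assoc. apply Rmult_le_compat_r; [apply Hrk|].
    eapply Rle_trans; [apply Rabs_triang|]. rewrite Rabs_Ropp.
    assert (H1 := Hb N k). assert (H2 := dominated_limit_le p M a k HD).
    assert (H3 := Rle_abs (M k)). lra. }
  assert (Hex : ex_series (fun k => 2 * (Rabs (M k) * r ^ k))).
  { apply ex_series_scal_R, HM, Hr. }
  assert (Ht : is_lim_seq (fun N => Series (d N)) 0).
  { apply (tannery d _ Hdm Hex). intros k. unfold d.
    replace (Finite 0) with (Finite (Rabs (a k - a k) * r ^ k))
      by (f_equal; rewrite Rminus_eq_0, Rabs_R0; ring).
    apply is_lim_seq_mult'; [|apply is_lim_seq_const].
    apply (is_lim_seq_abs _ (Finite (a k - a k))).
    apply is_lim_seq_minus'; [apply Hl|apply is_lim_seq_const]. }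
  apply is_lim_seq_spec in Ht. destruct (Ht (mkposreal eps He)) as [N0 HN0].
  exists N0. intros N z HN Hz. specialize (HN0 N HN). simpl in HN0.
  rewrite Rminus_0_r in HN0.
  apply Rle_lt_trans with (Series (d N)); [|apply (Rle_lt_trans _ _ _ (Rle_abs _) HN0)].
  apply is_cseries_Cmod_le with (u := fun k => (RtoC (p N k) * z ^ k + RtoC (- (1)) * (RtoC (a k) * z ^ k))%C).
  - replace (CPSeries (p N) z - CPSeries a z)%C with (CPSeries (p N) z + RtoC (- (1)) * CPSeries a z)%C
      by (rewrite RtoC_opp; ring).
    apply is_cseries_plus; [apply CPSeries_correct; now apply (dominated_entire_seq p M a)|].
    apply is_cseries_scal, CPSeries_correct; now apply (dominated_entire p M a).
  - intros k. unfold d.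
    replace (RtoC (p N k) * z ^ k + RtoC (- (1)) * (RtoC (a k) * z ^ k))%C
      with (RtoC (p N k - a k) * z ^ k)%C by (rewrite RtoC_minus, RtoC_opp; ring).
    rewrite Cmod_term. apply Rmult_le_compat_l; [apply Rabs_pos|].
    apply pow_incr. split; [apply Cmod_ge_0|assumption].
  - apply (ex_series_le_R _ _ (Hdm N) Hex).
Qed.

Section Limits.
Context (p : nat -> nat -> R) (M a : nat -> R) (HD : dominated p M a).

Lemma dominated_close (z : C) (f : C -> R) :
  (forall u v, Rabs (f u - f v) <= Cmod (u - v)) ->
  is_lim_seq (fun N => f (CPSeries (p N) z)) (f (CPSeries a z)).
Proof.
  intros Hf. apply is_lim_seq_spec. intros eps.
  destruct (dominated_uniform p M a (Cmod z) eps HD (Cmod_ge_0 z) (cond_pos eps)) as [N0 H].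
  exists N0. intros N HN. eapply Rle_lt_trans; [apply Hf|]. apply H; [assumption|lra].
Qed.

Lemma dominated_Re (z : C) : is_lim_seq (fun N => Re (CPSeries (p N) z)) (Re (CPSeries a z)).
Proof. apply (dominated_close z Re). intros u v. exact (re_le_Cmod (u - v)). Qed.

Lemma dominated_Im (z : C) : is_lim_seq (fun N => Im (CPSeries (p N) z)) (Im (CPSeries a z)).
Proof. apply (dominated_close z Im). intros u v. exact (im_le_Cmod (u - v)). Qed.

Lemma dominated_Cmod (z : C) : is_lim_seq (fun N => Cmod (CPSeries (p N) z)) (Cmod (CPSeries a z)).
Proof.
  apply (dominated_close z Cmod). intros u v. apply Rabs_le. split.
  - assert (H := Cmod_triangle u (v - u)).
    replace (u + (v - u))%C with v in H by ring.
    replace (v - u)%C with (- (u - v))%C in H by ring. rewrite Cmod_opp in H. lra.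
  - assert (H := Cmod_triangle v (u - v)).
    replace (v + (u - v))%C with u in H by ring. lra.
Qed.

Lemma dominated_PSeries (x : R) : is_lim_seq (fun N => PSeries (p N) x) (PSeries a x).
Proof.
  assert (H := dominated_Re (RtoC x)). rewrite CPSeries_real in H.
  apply (is_lim_seq_ext _ _ _ (fun N => f_equal Re (CPSeries_real (p N) x)) H).
Qed.
End Limits.

(** * Limits of polynomials with positive zeros *)

(** The entire functions of Laguerre-Polya class with positive zeros and value [1] at [0]. *)
Definition laguerre_polya (a : nat -> R) : Prop :=
  exists p M, dominated p M a /\
    forall N, exists s, nonneg_list s /\ forall k, p N k = factored_coef s k.

Lemma laguerre_polya_entire (a : nat -> R) : laguerre_polya a -> entire a.
Proof. intros (p & M & HD & _). now apply (dominated_entire p M a). Qed.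

Lemma laguerre_polya_multiplier (a : nat -> R) (x : R) : laguerre_polya a -> 0 < x ->
  laguerre_polya (fun k => (1 + INR k / x) * a k).
Proof.
  intros (p & M & (HM & Hb & Hl) & Hs) Hx.
  assert (Hc : forall k, 0 <= 1 + INR k / x).
  { intros k. assert (0 <= INR k / x); [|lra].
    apply Rmult_le_pos; [apply pos_INR|now apply Rlt_le, Rinv_0_lt_compat]. }
  exists (fun N k => (1 + INR k / x) * p N k), (fun k => (1 + INR k / x) * M k).
  split; [split; [|split]|].
  - apply (entire_ext (fun k => M k + / x * euler M k)).
    + intros k; unfold euler; field; lra.
    + apply entire_plus; [assumption|]. now apply entire_scal, entire_euler.
  - intros N k. rewrite Rabs_mult, (Rabs_pos_eq _ (Hc k)).
    apply Rmult_le_compat_l; [apply Hc|apply Hb].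
  - intros k. apply is_lim_seq_mult'; [apply is_lim_seq_const|apply Hl].
  - intros N. destruct (Hs N) as (s & Hn & E).
    destruct (RealRooted.factored_coef_euler Hn Hx) as (t & Ht & Et).
    exists t. split; [assumption|]. intros k. now rewrite Et, E.
Qed.

Lemma continuity_PSeries (a : nat -> R) (x : R) : entire a -> continuity_pt (PSeries a) x.
Proof. intros Ha. apply PSeries_continuity. now apply entire_radius. Qed.

Lemma rprod_root (b x : R) (s : list R) : In b s -> 1 - b * x = 0 -> rprod s x = 0.
Proof.
  induction s as [|c s IH]; intros Hin H; [destruct Hin|].
  destruct Hin as [->|Hin]; simpl; [rewrite H|rewrite IH by assumption]; ring.
Qed.

Definition positive_upto (a : nat -> R) (X : R) : Prop :=
  forall x, 0 <= x <= X -> 0 < PSeries a x.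

(** Hurwitz: a zero-free interval of the limit is zero-free for the
    approximating polynomials. *)
Lemma eventually_zero_free_upto (p : nat -> nat -> R) (M a : nat -> R) (X : R) :
  dominated p M a -> 0 <= X -> positive_upto a X ->
  exists N0, forall N s, (N0 <= N)%nat -> nonneg_list s -> (forall k, p N k = factored_coef s k) ->
    zero_free_upto X s.
Proof.
  intros HD HX Hpos. assert (Ha := dominated_entire p M a HD).
  destruct (continuity_ab_min (PSeries a) 0 X HX) as [m [Hm Hm0]].
  { intros c _. now apply continuity_PSeries. }
  assert (Hmp := Hpos m Hm0).
  destruct (dominated_uniform p M a X (PSeries a m) HD HX Hmp) as [N0 HN].
  exists N0. intros N s HNs Hs E. apply List.Forall_forall. intros b Hb.
  assert (Hb0 : 0 <= b).
  { unfold nonneg_list in Hs. rewrite List.Forall_forall in Hs. now apply Hs. }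
  split; [assumption|]. apply Rnot_le_lt. intros HbX.
  assert (Hbp : 0 < b).
  { destruct Hb0 as [H| <-]; [assumption|]. rewrite Rmult_0_l in HbX; lra. }
  assert (Hi : 0 < / b) by now apply Rinv_0_lt_compat.
  assert (HiX : / b <= X).
  { apply Rmult_le_reg_l with b; [assumption|]. rewrite Rinv_r by lra. assumption. }
  specialize (HN N (RtoC (/ b)) HNs). rewrite Cmod_R, Rabs_pos_eq in HN by lra.
  specialize (HN HiX). rewrite !CPSeries_real, <- RtoC_minus, Cmod_R in HN.
  rewrite (PSeries_ext _ _ (/ b) E), PSeries_factored_coef in HN.
  rewrite (rprod_root b) in HN; [|assumption|rewrite Rinv_r; lra].
  assert (H1 := Hm (/ b) (conj (Rlt_le _ _ Hi) HiX)).
  rewrite Rminus_0_l, Rabs_Ropp, Rabs_pos_eq in HN; lra.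
Qed.

Lemma lim_nonneg (u : nat -> R) (l : R) :
  (exists N0, forall N, (N0 <= N)%nat -> 0 <= u N) -> is_lim_seq u l -> 0 <= l.
Proof.
  intros H Hl.
  apply (is_lim_seq_le_loc (fun _ => 0) u 0 l); [exact H|apply is_lim_seq_const|exact Hl].
Qed.

(** The difference is the sum of the nonnegative weights [b^k (1 - b X)]. *)
Lemma newton_mono (a : nat -> R) (X : R) (k : nat) : laguerre_polya a -> 0 <= X ->
  positive_upto a X -> (1 <= k <= 3)%nat -> 0 <= newton k a - X * newton (S k) a.
Proof.
  intros (p & M & HD & Hs) HX Hpos Hk.
  destruct (eventually_zero_free_upto p M a X HD HX Hpos) as [N0 HN].
  apply (lim_nonneg (fun N => newton k (p N) - X * newton (S k) (p N))).
  - exists N0. intros N HN0. destruct (Hs N) as (s & Hn & E).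
    assert (En : forall j, newton j (p N) = newton j (factored_coef s)).
    { intros j; unfold newton; now rewrite !E. }
    rewrite !En, <- !psum_newton by lia. apply psum_mono. now apply (HN N).
  - assert (Hl : forall j, is_lim_seq (fun N => newton j (p N)) (newton j a)).
    { intros j. apply newton_lim, HD. }
    apply is_lim_seq_minus'; [apply Hl|].
    apply is_lim_seq_mult'; [apply is_lim_seq_const|apply Hl].
Qed.

Lemma newton_quadratic (a : nat -> R) (X t : R) : laguerre_polya a -> 0 <= X ->
  positive_upto a X ->
  0 <= (newton 1 a - X * newton 2 a) - 2 * t * (newton 2 a - X * newton 3 a)
       + t ^ 2 * (newton 3 a - X * newton 4 a).
Proof.
  intros (p & M & HD & Hs) HX Hpos.
  destruct (eventually_zero_free_upto p M a X HD HX Hpos) as [N0 HN].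
  apply (lim_nonneg (fun N => (newton 1 (p N) - X * newton 2 (p N))
     - 2 * t * (newton 2 (p N) - X * newton 3 (p N))
     + t ^ 2 * (newton 3 (p N) - X * newton 4 (p N)))).
  - exists N0. intros N HN0. destruct (Hs N) as (s & Hn & E).
    assert (En : forall j, newton j (p N) = newton j (factored_coef s)).
    { intros j; unfold newton; now rewrite !E. }
    rewrite !En, <- !psum_newton by lia. apply psum_quadratic. now apply (HN N).
  - assert (Hl : forall j, is_lim_seq (fun N => newton j (p N)) (newton j a)).
    { intros j. apply newton_lim, HD. }
    assert (Hd : forall i j, is_lim_seq (fun N => newton i (p N) - X * newton j (p N))
                   (newton i a - X * newton j a)).
    { intros i j. apply is_lim_seq_minus'; [apply Hl|].
      apply is_lim_seq_mult'; [apply is_lim_seq_const|apply Hl]. }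
    apply is_lim_seq_plus'; [apply is_lim_seq_minus'; [apply Hd|]|];
      (apply is_lim_seq_mult'; [apply is_lim_seq_const|apply Hd]).
Qed.

Lemma newton_nonneg (a : nat -> R) (k : nat) : laguerre_polya a -> (1 <= k <= 4)%nat ->
  0 <= newton k a.
Proof.
  intros (p & M & HD & Hs) Hk. apply (lim_nonneg (fun N => newton k (p N))).
  - exists O. intros N _. destruct (Hs N) as (s & Hn & E).
    replace (newton k (p N)) with (newton k (factored_coef s)) by (unfold newton; now rewrite !E).
    rewrite <- psum_newton by lia. now apply psum_nonneg.
  - apply newton_lim, HD.
Qed.

Lemma one_minus_pow_le (k : nat) (u : R) : 0 <= u <= 1 -> 1 - u ^ k <= INR k * (1 - u).
Proof.
  intros Hu. induction k as [|k IH]; [simpl; lra|].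
  rewrite S_INR. simpl. assert (0 <= u ^ k) by (apply pow_le; lra).
  assert (u ^ k <= 1) by (rewrite <- (pow1 k); apply pow_incr; lra).
  nra.
Qed.

(** The reciprocal zeros [b] satisfy [(b x)^k <= x^k sigma_k], so they stay away
    from [1 / x]; a product of factors bounded away from zero whose defects
    have a bounded sum cannot tend to zero. *)
Lemma positive_below_newton (a : nat -> R) (x : R) (k : nat) : laguerre_polya a ->
  (1 <= k <= 4)%nat -> 0 <= x -> x ^ k * newton k a < 1 -> 0 < PSeries a x.
Proof.
  intros (p & M & HD & Hs) Hk Hx Hlt.
  assert (Hl : forall j, is_lim_seq (fun N => newton j (p N)) (newton j a)).
  { intros j. apply newton_lim, HD. }
  (* a margin: eventually [x^k] times the power sum is at most [q < 1] *)
  set (q := (1 + x ^ k * newton k a) / 2).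
  assert (Hq : x ^ k * newton k a < q < 1) by (unfold q; lra).
  assert (HkR : 1 <= INR k) by (apply (le_INR 1); lia).
  set (delta := (1 - q) / INR k).
  assert (Hdelta : 0 < delta) by (apply Rdiv_lt_0_compat; lra).
  set (S1 := newton 1 a + 1).
  assert (Hm : is_lim_seq (fun N => x ^ k * newton k (p N)) (x ^ k * newton k a)).
  { apply is_lim_seq_mult'; [apply is_lim_seq_const|apply Hl]. }
  apply is_lim_seq_spec in Hm.
  assert (Hqp : 0 < q - x ^ k * newton k a) by lra.
  destruct (Hm (mkposreal _ Hqp)) as [N1 HN1]. cbn [pos] in HN1.
  assert (Hm1 := Hl 1%nat). apply is_lim_seq_spec in Hm1.
  destruct (Hm1 (mkposreal 1 Rlt_0_1)) as [N2 HN2]. cbn [pos] in HN2.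
  apply Rlt_le_trans with (exp (- (x * S1 / delta))); [apply exp_pos|].
  apply (is_lim_seq_le_loc (fun _ => exp (- (x * S1 / delta))) (fun N => PSeries (p N) x)
           (exp (- (x * S1 / delta))) (PSeries a x));
    [|apply is_lim_seq_const|now apply (dominated_PSeries p M a)].
  exists (max N1 N2). intros N HN.
  specialize (HN1 N ltac:(lia)). specialize (HN2 N ltac:(lia)).
  apply Rabs_def2 in HN1. apply Rabs_def2 in HN2.
  destruct (Hs N) as (s & Hn & E).
  assert (En : forall j, newton j (p N) = newton j (factored_coef s)).
  { intros j; unfold newton; now rewrite !E. }
  rewrite (PSeries_ext _ _ x E), PSeries_factored_coef.
  rewrite En in HN1, HN2. rewrite <- psum_newton in HN1, HN2 by lia.
  assert (Hsm : List.Forall (fun b => 0 <= b /\ b * x <= 1 - delta) s).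
  { assert (Hmem := psum_member k s Hn). unfold nonneg_list in Hn.
    rewrite List.Forall_forall in *. intros b Hb. specialize (Hmem b Hb). specialize (Hn b Hb).
    split; [assumption|].
    assert (Hbx : 0 <= b * x) by now apply Rmult_le_pos.
    assert (Hpk : (b * x) ^ k <= q).
    { rewrite Rpow_mult_distr. assert (0 <= x ^ k) by now apply pow_le.
      apply Rle_trans with (psum k s * x ^ k); [now apply Rmult_le_compat_r|lra]. }
    assert (Hb1 : b * x <= 1).
    { apply Rnot_lt_le. intros H1.
      assert (1 <= (b * x) ^ k) by (apply pow_R1_Rle; lra). lra. }
    assert (H := one_minus_pow_le k (b * x) (conj Hbx Hb1)).
    assert (delta <= 1 - b * x); [|lra]. unfold delta.
    apply Rmult_le_reg_l with (INR k); [lra|].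
    replace (INR k * ((1 - q) / INR k)) with (1 - q) by (field; lra). lra. }
  assert (H := rprod_exp_ge x delta s Hdelta Hx Hsm).
  assert (Hps : x * psum 1 s / delta <= x * S1 / delta).
  { apply Rmult_le_compat_r; [now apply Rlt_le, Rinv_0_lt_compat|].
    apply Rmult_le_compat_l; [assumption|]. unfold S1. lra. }
  apply Rle_trans with (exp (- (x * psum 1 s / delta))).
  - destruct Hps as [Hps| ->]; [|apply Rle_refl].
    left; apply exp_increasing; lra.
  - rewrite exp_Ropp. assert (He := exp_pos (x * psum 1 s / delta)).
    apply Rmult_le_reg_r with (exp (x * psum 1 s / delta)); [assumption|].
    rewrite Rinv_l by lra. assumption.
Qed.

(** The limit form of [- X p'/p >= X s_1 + X^2 s_2]. *)
Lemma log_derivative_bound (a : nat -> R) (X : R) : laguerre_polya a -> 0 <= X ->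
  positive_upto a X ->
  0 <= - PSeries (euler a) X - (X * newton 1 a + X ^ 2 * newton 2 a) * PSeries a X.
Proof.
  intros (p & M & HD & Hs) HX Hpos.
  destruct (eventually_zero_free_upto p M a X HD HX Hpos) as [N0 HN].
  apply (lim_nonneg (fun N => - PSeries (euler (p N)) X
    - (X * newton 1 (p N) + X ^ 2 * newton 2 (p N)) * PSeries (p N) X)).
  - exists N0. intros N HN0. destruct (Hs N) as (s & Hn & E).
    assert (En : forall j, newton j (p N) = newton j (factored_coef s)).
    { intros j; unfold newton; now rewrite !E. }
    assert (Hsm := HN N s HN0 Hn E).
    rewrite !En, <- !psum_newton by lia.
    rewrite (PSeries_ext _ _ X E), PSeries_factored_coef.
    rewrite (PSeries_ext _ (euler (factored_coef s)) X) by (intros k; unfold euler; now rewrite E).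
    rewrite PSeries_euler_factored_coef by now apply zero_free_upto_ne.
    assert (H := rlog_le X s HX Hsm). assert (Hp := rprod_pos X s Hsm). nra.
  - assert (Hl : forall j, is_lim_seq (fun N => newton j (p N)) (newton j a)).
    { intros j. apply newton_lim, HD. }
    assert (Hp := dominated_PSeries p M a HD X).
    assert (He := dominated_PSeries _ _ _ (dominated_euler p M a HD) X).
    apply is_lim_seq_minus'; [exact (proj1 (is_lim_seq_opp _ _) He)|].
    apply is_lim_seq_mult'; [|exact Hp].
    apply is_lim_seq_plus'; (apply is_lim_seq_mult'; [apply is_lim_seq_const|apply Hl]).
Qed.

(** The second inequality is [Re (z g'/g) >= |z| g'(|z|) / g(|z|)] with denominators
    cleared, the form that passes to the limit. *)
Lemma complex_bounds (a : nat -> R) (z : C) : laguerre_polya a ->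
  positive_upto a (Cmod z) ->
  PSeries a (Cmod z) <= Cmod (CPSeries a z) /\
  PSeries (euler a) (Cmod z) * Cmod (CPSeries a z) ^ 2
    <= Re (CPSeries (euler a) z * Cconj (CPSeries a z))%C * PSeries a (Cmod z).
Proof.
  intros (p & M & HD & Hs) Hpos. set (r := Cmod z) in *.
  assert (Hr : 0 <= r) by apply Cmod_ge_0.
  destruct (eventually_zero_free_upto p M a r HD Hr Hpos) as [N0 HN].
  assert (HE := dominated_euler p M a HD).
  assert (Hp := dominated_PSeries p M a HD r).
  assert (He := dominated_PSeries _ _ _ HE r).
  assert (Hc := dominated_Cmod p M a HD z).
  split.
  - apply Rminus_le_0.
    apply (lim_nonneg (fun N => Cmod (CPSeries (p N) z) - PSeries (p N) r));
      [|now apply is_lim_seq_minus'].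
    exists N0. intros N HN0. destruct (Hs N) as (s & Hn & E).
    rewrite (CPSeries_ext _ _ z E), (PSeries_ext _ _ r E), CPSeries_factored_coef, PSeries_factored_coef.
    assert (H := cprod_Cmod_ge z s (HN N s HN0 Hn E)). fold r in H. lra.
  - apply Rminus_le_0.
    apply (lim_nonneg (fun N => Re (CPSeries (euler (p N)) z * Cconj (CPSeries (p N) z))%C
        * PSeries (p N) r - PSeries (euler (p N)) r * Cmod (CPSeries (p N) z) ^ 2)).
    + exists N0. intros N HN0. destruct (Hs N) as (s & Hn & E).
      assert (Hsm := HN N s HN0 Hn E).
      assert (E' : forall k, euler (p N) k = euler (factored_coef s) k) by (intros k; unfold euler; now rewrite E).
      rewrite (CPSeries_ext _ _ z E), (PSeries_ext _ _ r E), CPSeries_factored_coef, PSeries_factored_coef.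
      rewrite (CPSeries_ext _ _ z E'), (PSeries_ext _ _ r E').
      rewrite CPSeries_euler_factored_coef by now apply factor_ne.
      rewrite PSeries_euler_factored_coef by now apply zero_free_upto_ne.
      assert (H := clog_Re_ge z s Hsm). fold r in H.
      assert (Hpr := rprod_pos r s Hsm).
      replace (cprod s z * clog s z * Cconj (cprod s z))%C
        with (RtoC (Cmod (cprod s z) ^ 2) * clog s z)%C.
      2:{ rewrite Cmod2_conj. ring. }
      replace (Re (RtoC (Cmod (cprod s z) ^ 2) * clog s z))
        with (Cmod (cprod s z) ^ 2 * Re (clog s z))
        by (generalize (Cmod (cprod s z) ^ 2) (clog s z); intros t [u v]; simpl; ring).
      assert (Hq : 0 <= Cmod (cprod s z) ^ 2 * rprod s r).
      { apply Rmult_le_pos; [apply pow2_ge_0|lra]. }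
      replace (Cmod (cprod s z) ^ 2 * Re (clog s z) * rprod s r
        - rprod s r * rlog s r * Cmod (cprod s z) ^ 2)
        with (Cmod (cprod s z) ^ 2 * rprod s r * (Re (clog s z) - rlog s r)) by ring.
      apply Rmult_le_pos; [assumption|lra].
    + apply is_lim_seq_minus'.
      * apply is_lim_seq_mult'; [|assumption].
        assert (H : forall u v : C, Re (u * Cconj v)%C = Re u * Re v + Im u * Im v).
        { intros [u1 u2] [v1 v2]; simpl; ring. }
        rewrite H.
        apply (is_lim_seq_ext (fun N => Re (CPSeries (euler (p N)) z) * Re (CPSeries (p N) z)
           + Im (CPSeries (euler (p N)) z) * Im (CPSeries (p N) z))).
        { intros N; now rewrite H. }
        apply is_lim_seq_plus'; apply is_lim_seq_mult'.
        -- exact (dominated_Re _ _ _ HE z).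
        -- exact (dominated_Re _ _ _ HD z).
        -- exact (dominated_Im _ _ _ HE z).
        -- exact (dominated_Im _ _ _ HD z).
      * apply is_lim_seq_mult'; [assumption|].
        simpl. apply is_lim_seq_mult'; [assumption|].
        apply is_lim_seq_mult'; [assumption|apply is_lim_seq_const].
Qed.

(** * Pochhammer symbols and the coefficient sequence *)

Lemma pochhammer_pos (x : R) (k : nat) : 0 < x -> 0 < pochhammer x k.
Proof.
  intros Hx. induction k as [|k IH]; simpl; [lra|].
  apply Rmult_lt_0_compat; [assumption|]. assert (H := pos_INR k). lra.
Qed.

Lemma pochhammer_succ_arg (x : R) (k : nat) :
  pochhammer (x + 1) k * x = pochhammer x k * (x + INR k).
Proof.
  induction k as [|k IH]; [simpl; ring|].
  cbn [pochhammer]. rewrite S_INR.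
  replace (pochhammer (x + 1) k * (x + 1 + INR k) * x)
    with (pochhammer (x + 1) k * x * (x + 1 + INR k)) by ring.
  rewrite IH. ring.
Qed.

Lemma pochhammer_double (x : R) (k : nat) :
  pochhammer x (2 * k) = 4 ^ k * pochhammer (x / 2) k * pochhammer ((x + 1) / 2) k.
Proof.
  induction k as [|k IH]; [simpl; ring|].
  replace (2 * S k)%nat with (S (S (2 * k))) by lia. cbn [pochhammer pow].
  rewrite IH, S_INR, mult_INR. simpl (INR 2). field.
Qed.

Lemma inv_pochhammer_le (x : R) (k : nat) : 0 < x -> / pochhammer x k <= 1 + / x.
Proof.
  intros Hx. assert (Hi := Rinv_0_lt_compat x Hx).
  destruct k as [|k]; [simpl; rewrite Rinv_1; lra|].
  assert (H : x <= pochhammer x (S k)).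
  { induction k as [|k IH]; [simpl; lra|].
    cbn [pochhammer] in *. rewrite S_INR. assert (Hk := pos_INR k).
    assert (Hp := pochhammer_pos x k Hx).
    assert (0 <= pochhammer x k * (x + INR k) * (x + INR k)).
    { apply Rmult_le_pos; [apply Rmult_le_pos|]; lra. }
    nra. }
  apply Rle_trans with (/ x); [apply Rinv_le_contravar; assumption|lra].
Qed.

Lemma factored_coef_pochhammer (s : list R) (x : R) (n : nat) : nonneg_list s -> 0 < x ->
  exists t, nonneg_list t /\
    forall k, factored_coef t k = pochhammer (x + INR n) k / pochhammer x k * factored_coef s k.
Proof.
  intros Hs Hx. induction n as [|n (t & Ht & E)].
  - exists s. split; [assumption|]. intros k. simpl. rewrite Rplus_0_r.
    assert (H := pochhammer_pos x k Hx). field; lra.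
  - assert (Hn := pos_INR n). assert (Hxn : 0 < x + INR n) by lra.
    destruct (RealRooted.factored_coef_euler Ht Hxn) as (u & Hu & Eu).
    exists u. split; [assumption|]. intros k. rewrite Eu, E, S_INR.
    assert (H := pochhammer_succ_arg (x + INR n) k).
    assert (Hp := pochhammer_pos x k Hx).
    replace (x + (INR n + 1)) with (x + INR n + 1) by ring.
    replace (pochhammer (x + INR n + 1) k)
      with (pochhammer (x + INR n) k * (x + INR n + INR k) / (x + INR n))
      by (rewrite <- H; field; lra).
    field; lra.
Qed.

Fixpoint falling (y : R) (k : nat) : R :=
  match k with O => 1 | S j => falling y j * (y - INR j) end.

Lemma falling_succ (y : R) (k : nat) : falling (y + 1) (S k) = (y + 1) * falling y k.
Proof.
  induction k as [|k IH]; [simpl; ring|].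
  change (falling (y + 1) (S (S k))) with (falling (y + 1) (S k) * (y + 1 - INR (S k))).
  rewrite IH, S_INR. simpl. ring.
Qed.

Lemma factored_coef_repeat (b : R) (n k : nat) :
  factored_coef (repeat b n) k = (- b) ^ k / INR (fact k) * falling (INR n) k.
Proof.
  revert k. induction n as [|n IH]; intros k.
  - destruct k as [|k]; [simpl; field|].
    replace (falling (INR 0) (S k)) with 0; [simpl; ring|].
    induction k as [|k IHk]; [simpl; ring|].
    change (0 = falling (INR 0) (S k) * (INR 0 - INR (S k))). rewrite <- IHk; ring.
  - destruct k as [|k].
    { change (factored_coef (repeat b (S n)) 0) with (factored_coef (repeat b n) 0 - b * 0). rewrite IH. simpl; field. }
    change (factored_coef (repeat b (S n)) (S k)) with (factored_coef (repeat b n) (S k) - b * factored_coef (repeat b n) k).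
    rewrite !IH, (S_INR n), falling_succ, fact_simpl, mult_INR, S_INR. simpl.
    assert (H := INR_fact_neq_0 k). assert (Hk := pos_INR k). field. split; [assumption|lra].
Qed.

(** The coefficients of [h_nu (z) / z]. *)
Definition hcoef (nu : R) (k : nat) : R :=
  (-1) ^ k / (16 ^ k * INR (fact k) * pochhammer (nu + 1) k * pochhammer (nu + 2) (2 * k)).

Section Approximation.
Context (nu : R) (Hnu : -1 < nu).
Let x := nu + 1.
Let y := (nu + 2) / 2.
Let z := (nu + 3) / 2.

(** [prod_(i<k) correction n i] is the quotient of the [k]-th coefficients of the
    polynomial built from [(1 - X/n)^n] and of the limit.  The factor [1 - i/n] vanishes at
    [i = n] and so truncates the series. *)
Definition correction (n i : nat) : R :=
  (1 - INR i / INR n) * (1 + INR i / (x + INR n))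
  * (1 + INR i / (y + INR n)) * (1 + INR i / (z + INR n)).

Fixpoint corrections (n k : nat) : R :=
  match k with O => 1 | S j => corrections n j * correction n j end.

Lemma hcoef_split (k : nat) :
  hcoef nu k = (-1 / 64) ^ k
    / (INR (fact k) * pochhammer x k * pochhammer y k * pochhammer z k).
Proof.
  unfold hcoef. rewrite pochhammer_double. fold x y.
  replace ((nu + 2 + 1) / 2) with z by (unfold z; field).
  unfold Rdiv. rewrite Rpow_mult_distr, pow_inv.
  replace 64 with (16 * 4) by ring. rewrite Rpow_mult_distr.
  assert (H := INR_fact_neq_0 k).
  assert (H1 : 16 ^ k <> 0) by (apply pow_nonzero; lra).
  assert (H2 : 4 ^ k <> 0) by (apply pow_nonzero; lra).
  assert (H3 : 0 < pochhammer x k) by (apply pochhammer_pos; unfold x; lra).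
  assert (H4 : 0 < pochhammer y k) by (apply pochhammer_pos; unfold y; lra).
  assert (H5 : 0 < pochhammer z k) by (apply pochhammer_pos; unfold z; lra).
  field. repeat split; lra.
Qed.

(** [prod_(i<k) (1 - i/n)] comes from the binomial coefficients of
    [(1 - X/n)^n], the other three factors from the shifted Pochhammer symbols. *)
Lemma approximation_real_rooted (n : nat) : exists s, nonneg_list s /\
  forall k, hcoef nu k * corrections (S n) k = factored_coef s k.
Proof.
  set (N := INR (S n)).
  assert (HN : 0 < N) by (apply (lt_INR 0); lia).
  assert (Hx : 0 < x) by (unfold x; lra).
  assert (Hy : 0 < y) by (unfold y; lra).
  assert (Hz : 0 < z) by (unfold z; lra).
  set (b := / (64 * N * (x + N) * (y + N) * (z + N))).
  assert (Hb : 0 <= b).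
  { left. apply Rinv_0_lt_compat. repeat apply Rmult_lt_0_compat; lra. }
  assert (Hr : nonneg_list (repeat b (S n))).
  { apply List.Forall_forall. intros c Hc. apply repeat_spec in Hc. now subst. }
  destruct (factored_coef_pochhammer _ x (S n) Hr Hx) as (s1 & H1 & E1).
  destruct (factored_coef_pochhammer _ y (S n) H1 Hy) as (s2 & H2 & E2).
  destruct (factored_coef_pochhammer _ z (S n) H2 Hz) as (s3 & H3 & E3).
  exists s3. split; [assumption|]. intros k.
  rewrite E3, E2, E1, factored_coef_repeat, hcoef_split. fold N.
  assert (E : (- b) ^ k * falling N k * pochhammer (x + N) k * pochhammer (y + N) k
              * pochhammer (z + N) k = (-1 / 64) ^ k * corrections (S n) k).
  { clear E1 E2 E3. induction k as [|k IH]; [simpl; ring|].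
    cbn [pow falling pochhammer corrections].
    transitivity ((-1 / 64 * correction (S n) k) * ((-1 / 64) ^ k * corrections (S n) k));
      [rewrite <- IH|ring].
    replace (-1 / 64 * correction (S n) k)
      with (- b * (N - INR k) * (x + N + INR k) * (y + N + INR k) * (z + N + INR k)); [ring|].
    unfold correction, b. fold N. field. repeat split; lra. }
  assert (Hf := INR_fact_neq_0 k).
  assert (Px := pochhammer_pos x k Hx). assert (Py := pochhammer_pos y k Hy).
  assert (Pz := pochhammer_pos z k Hz).
  transitivity (((-1 / 64) ^ k * corrections (S n) k)
     / (INR (fact k) * pochhammer x k * pochhammer y k * pochhammer z k));
    [field; repeat split; lra|].
  rewrite <- E. field; repeat split; lra.
Qed.

Lemma one_plus_ratio_bounds (c : R) (n i : nat) : 0 < c -> (i <= S n)%nat ->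
  1 <= 1 + INR i / (c + INR (S n)) <= 2.
Proof.
  intros Hc Hi. assert (H := pos_INR i). assert (Hin := le_INR i (S n) Hi).
  assert (0 <= INR i / (c + INR (S n)) <= 1); [|lra]. split.
  - apply Rdiv_le_0_compat; lra.
  - apply Rmult_le_reg_r with (c + INR (S n)); [lra|].
    unfold Rdiv. rewrite Rmult_assoc, Rinv_l; lra.
Qed.

(** Up to [i = n] the four factors are at most [1, 2, 2, 2]; beyond, the product is zero. *)
Lemma corrections_bound (n k : nat) : Rabs (corrections (S n) k) <= 8 ^ k.
Proof.
  assert (H : corrections (S n) k = 0
    \/ ((k <= S n)%nat /\ Rabs (corrections (S n) k) <= 8 ^ k)).
  { assert (HN : 0 < INR (S n)) by (apply (lt_INR 0); lia).
    induction k as [|k [IH|[Hk IH]]]; cbn [corrections pow].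
    - right. rewrite Rabs_R1. split; [lia|lra].
    - left. rewrite IH; ring.
    - destruct (Nat.eq_dec k (S n)) as [->|Hne].
      { left. unfold correction. field. assert (Hx : 0 < x) by (unfold x; lra).
        assert (Hy : 0 < y) by (unfold y; lra). assert (Hz : 0 < z) by (unfold z; lra).
        repeat split; lra. }
      right. split; [lia|]. rewrite Rabs_mult, (Rmult_comm 8).
      apply Rmult_le_compat; try apply Rabs_pos; [assumption|].
      assert (Bx := one_plus_ratio_bounds x n k ltac:(unfold x; lra) Hk).
      assert (By := one_plus_ratio_bounds y n k ltac:(unfold y; lra) Hk).
      assert (Bz := one_plus_ratio_bounds z n k ltac:(unfold z; lra) Hk).
      assert (Bn : 0 <= 1 - INR k / INR (S n) <= 1).
      { assert (Hin := le_INR k (S n) Hk). assert (H := pos_INR k).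
        assert (0 <= INR k / INR (S n) <= 1); [|lra]. split.
        - apply Rdiv_le_0_compat; lra.
        - apply Rmult_le_reg_r with (INR (S n)); [lra|].
          unfold Rdiv. rewrite Rmult_assoc, Rinv_l; lra. }
      unfold correction. rewrite !Rabs_mult, !Rabs_pos_eq by lra.
      replace 8 with (1 * 2 * 2 * 2) by ring.
      repeat (apply Rmult_le_compat; try lra; repeat apply Rmult_le_pos; try lra). }
  destruct H as [H|[_ H]]; [|assumption]. rewrite H, Rabs_R0. apply pow_le; lra.
Qed.

Lemma ratio_lim (c i : R) : is_lim_seq (fun n => i / (c + INR (S n))) 0.
Proof.
  assert (H : is_lim_seq (fun n => c + INR (S n)) p_infty).
  { apply is_lim_seq_plus with c p_infty; [apply is_lim_seq_const| |reflexivity].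
    apply (is_lim_seq_incr_1 INR), is_lim_seq_INR. }
  replace (Finite 0) with (Rbar_mult i (Rbar_inv p_infty)) by (simpl; f_equal; ring).
  apply is_lim_seq_scal_l. apply is_lim_seq_inv; [exact H|discriminate].
Qed.

Lemma corrections_lim (k : nat) : is_lim_seq (fun n => corrections (S n) k) 1.
Proof.
  induction k as [|k IH]; [apply is_lim_seq_const|]. cbn [corrections].
  replace (Finite 1) with (Finite (1 * ((1 - 0) * (1 + 0) * (1 + 0) * (1 + 0))))
    by (f_equal; ring).
  apply is_lim_seq_mult'; [exact IH|]. unfold correction.
  repeat apply is_lim_seq_mult'.
  - apply is_lim_seq_minus'; [apply is_lim_seq_const|].
    apply (is_lim_seq_ext (fun n => INR k / (0 + INR (S n)))).
    + intros n; now rewrite Rplus_0_l.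
    + apply ratio_lim.
  - apply is_lim_seq_plus'; [apply is_lim_seq_const|apply ratio_lim].
  - apply is_lim_seq_plus'; [apply is_lim_seq_const|apply ratio_lim].
  - apply is_lim_seq_plus'; [apply is_lim_seq_const|apply ratio_lim].
Qed.

Lemma entire_inv_fact : entire (fun k => / INR (fact k)).
Proof.
  intros r Hr. exists (exp r).
  apply (is_series_ext (fun k => / INR (fact k) * r ^ k)).
  - intros k. rewrite Rabs_pos_eq; [reflexivity|].
    left; apply Rinv_0_lt_compat, INR_fact_lt_0.
  - apply is_pseries_R, is_exp_Reals.
Qed.

Lemma hcoef_dominated (k : nat) : Rabs (hcoef nu k) * 8 ^ k
  <= (1 + / x) * (1 + / y) * (1 + / z) * / INR (fact k).
Proof.
  assert (Hx : 0 < x) by (unfold x; lra).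
  assert (Hy : 0 < y) by (unfold y; lra).
  assert (Hz : 0 < z) by (unfold z; lra).
  assert (Px := pochhammer_pos x k Hx). assert (Py := pochhammer_pos y k Hy).
  assert (Pz := pochhammer_pos z k Hz). assert (Pf := INR_fact_lt_0 k).
  assert (Bx := inv_pochhammer_le x k Hx). assert (By := inv_pochhammer_le y k Hy).
  assert (Bz := inv_pochhammer_le z k Hz).
  assert (Ix := Rinv_0_lt_compat _ Px). assert (Iy := Rinv_0_lt_compat _ Py).
  assert (Iz := Rinv_0_lt_compat _ Pz). assert (If := Rinv_0_lt_compat _ Pf).
  rewrite hcoef_split. unfold Rdiv at 1. rewrite Rabs_mult, <- RPow_abs.
  replace (Rabs (-1 / 64)) with (/ 64)
    by (replace (-1 / 64) with (- / 64) by field; rewrite Rabs_Ropp, Rabs_pos_eq; lra).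
  rewrite Rabs_pos_eq.
  2:{ left. apply Rinv_0_lt_compat. repeat apply Rmult_lt_0_compat; assumption. }
  rewrite !Rinv_mult.
  apply Rle_trans with (/ pochhammer x k * / pochhammer y k * / pochhammer z k * / INR (fact k)).
  - replace ((/ 64) ^ k * (/ INR (fact k) * / pochhammer x k * / pochhammer y k * / pochhammer z k) * 8 ^ k)
      with ((/ 64 * 8) ^ k * (/ pochhammer x k * / pochhammer y k * / pochhammer z k * / INR (fact k)))
      by (rewrite Rpow_mult_distr; ring).
    rewrite <- (Rmult_1_l (/ pochhammer x k * / pochhammer y k * / pochhammer z k * / INR (fact k))) at 2.
    apply Rmult_le_compat_r; [repeat apply Rmult_le_pos; lra|].
    rewrite <- (pow1 k). apply pow_incr. lra.
  - apply Rmult_le_compat_r; [lra|].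
    repeat (apply Rmult_le_compat; try (repeat apply Rmult_le_pos; lra)); assumption.
Qed.

Lemma hcoef_laguerre_polya : laguerre_polya (hcoef nu).
Proof.
  exists (fun n k => hcoef nu k * corrections (S n) k), (fun k => Rabs (hcoef nu k) * 8 ^ k).
  split; [|exact approximation_real_rooted]. split; [|split].
  - apply entire_le with (m := fun k => (1 + / x) * (1 + / y) * (1 + / z) * / INR (fact k)).
    + intros k. rewrite Rabs_pos_eq; [apply hcoef_dominated|].
      apply Rmult_le_pos; [apply Rabs_pos|apply pow_le; lra].
    + apply entire_scal, entire_inv_fact.
  - intros n k. rewrite Rabs_mult. apply Rmult_le_compat_l; [apply Rabs_pos|].
    apply corrections_bound.
  - intros k. replace (Finite (hcoef nu k)) with (Finite (hcoef nu k * 1)) by (f_equal; ring).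
    apply is_lim_seq_mult'; [apply is_lim_seq_const|apply corrections_lim].
Qed.
End Approximation.

(** * Derivatives along horizontal lines *)

(** [C_derive] is a limit along real increments, so differentiability on horizontal lines
    is all it sees; for the principal powers this only takes real calculus. *)
Definition horizontal_derive (f : C -> C) (z l : C) : Prop :=
  is_derive (fun t : R => Re (f (t, Im z))) (Re z) (Re l) /\
  is_derive (fun t : R => Im (f (t, Im z))) (Re z) (Im l).

Lemma Lim_quotient (f : R -> R) (x l : R) : is_derive f x l ->
  Lim (fun t => (f t - f x) / (t - x)) x = l.
Proof.
  intros H. apply is_lim_unique, is_lim_spec. intros eps.
  apply is_derive_Reals in H. destruct (H eps (cond_pos eps)) as [d Hd].
  exists d. intros t Ht Hne.
  change (Rabs (t - x) < d) in Ht.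
  specialize (Hd (t - x) ltac:(lra) Ht).
  rewrite (Rplus_minus x t) in Hd. exact Hd.
Qed.

Lemma C_derive_horizontal (f : C -> C) (z l : C) :
  horizontal_derive f z l -> C_derive f z = l.
Proof.
  intros [H1 H2]. destruct z as [x y], l as [l1 l2]. unfold C_derive, C_lim.
  assert (Q : forall (w : C) (t : R), t <> x ->
    (w / ((t, y) - (x, y)))%C = (Re w / (t - x), Im w / (t - x))).
  { intros [u v] t Ht. unfold Cdiv, Cmult, Cinv, Cminus, Cplus, Copp; simpl.
    assert (t + - x <> 0) by lra. f_equal; field; simpl; repeat split; nra. }
  apply f_equal2.
  - transitivity (real (Lim (fun t => (Re (f (t, y)) - Re (f (x, y))) / (t - x)) x)).
    2: exact (f_equal real (Lim_quotient _ x l1 H1)).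
    apply (f_equal real), Lim_ext_loc.
    exists (mkposreal 1 Rlt_0_1). intros t _ Ht.
    exact (eq_sym (f_equal fst (Q (f (t, y) - f (x, y))%C t Ht))).
  - transitivity (real (Lim (fun t => (Im (f (t, y)) - Im (f (x, y))) / (t - x)) x)).
    2: exact (f_equal real (Lim_quotient _ x l2 H2)).
    apply (f_equal real), Lim_ext_loc.
    exists (mkposreal 1 Rlt_0_1). intros t _ Ht.
    exact (eq_sym (f_equal snd (Q (f (t, y) - f (x, y))%C t Ht))).
Qed.

Lemma pow_expansion (z t : C) (n : nat) : Cmod t <= 1 ->
  Cmod ((z + t) ^ n - z ^ n - RtoC (INR n) * t * z ^ pred n)
    <= Cmod t ^ 2 * (INR n * (INR n * (Cmod z + 1) ^ n)).
Proof.
  intros Ht. set (r := Cmod z + 1).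
  assert (Hz := Cmod_ge_0 z). assert (Hr : 1 <= r) by (unfold r; lra).
  induction n as [|n IH].
  - replace ((z + t) ^ 0 - z ^ 0 - RtoC (INR 0) * t * z ^ pred 0)%C with (RtoC 0)
      by (simpl; ring).
    rewrite Cmod_0. simpl; rewrite Rmult_0_l, Rmult_0_r; lra.
  - set (Rn := ((z + t) ^ n - z ^ n - RtoC (INR n) * t * z ^ pred n)%C) in *.
    assert (E : ((z + t) ^ S n - z ^ S n - RtoC (INR (S n)) * t * z ^ pred (S n))%C
      = ((z + t) * Rn + t ^ 2 * RtoC (INR n) * z ^ pred n)%C).
    { unfold Rn. destruct n as [|n].
      - simpl. ring.
      - cbn [pred Cpow]. rewrite (S_INR (S n)), RtoC_plus. ring. }
    rewrite E.
    assert (B1 : Cmod (z + t) <= r).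
    { eapply Rle_trans; [apply Cmod_triangle|]. unfold r; lra. }
    assert (Hrn : forall m, 1 <= r ^ m) by (intros; now apply pow_R1_Rle).
    assert (B2 : Cmod (z ^ pred n) <= r ^ n).
    { rewrite Cmod_pow. apply Rle_trans with (r ^ pred n).
      - apply pow_incr. unfold r; lra.
      - apply Rle_pow; [assumption|lia]. }
    assert (Hn := pos_INR n). assert (Ht2 := pow2_ge_0 (Cmod t)).
    eapply Rle_trans; [apply Cmod_triangle|]. rewrite !Cmod_mult, Cmod_R, Cmod_pow.
    rewrite (Rabs_pos_eq (INR n)) by assumption. set (m := Cmod t) in *.
    apply Rle_trans with (r * (m ^ 2 * (INR n * (INR n * r ^ n))) + m ^ 2 * INR n * r ^ n).
    + apply Rplus_le_compat.
      * apply Rmult_le_compat; try apply Cmod_ge_0; assumption.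
      * apply Rmult_le_compat_l; [now apply Rmult_le_pos|assumption].
    + rewrite S_INR, <- (tech_pow_Rmult r n).
      replace (r * (m ^ 2 * (INR n * (INR n * r ^ n))) + m ^ 2 * INR n * r ^ n)
        with (m ^ 2 * r ^ n * (r * INR n ^ 2 + INR n)) by ring.
      replace (m ^ 2 * ((INR n + 1) * ((INR n + 1) * (r * r ^ n))))
        with (m ^ 2 * r ^ n * (r * (INR n + 1) ^ 2)) by ring.
      apply Rmult_le_compat_l; [apply Rmult_le_pos; [assumption|]; specialize (Hrn n); lra|].
      nra.
Qed.

Definition deriv (a : nat -> R) (n : nat) : R := INR (S n) * a (S n).

Lemma entire_deriv (a : nat -> R) : entire a -> entire (deriv a).
Proof.
  intros Ha r Hr. assert (H := entire_euler a Ha (r + 1) ltac:(lra)).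
  apply ex_series_incr_1 in H.
  apply (ex_series_le_R _ _) with (2 := H). intros n.
  change (euler a (S n)) with (deriv a n).
  split; [apply Rmult_le_pos; [apply Rabs_pos|now apply pow_le]|].
  apply Rmult_le_compat_l; [apply Rabs_pos|].
  apply Rle_trans with ((r + 1) ^ n); [apply pow_incr; lra|].
  apply Rle_pow; [lra|lia].
Qed.

(** The remainder is summed termwise, at radius [|z| + 1]. *)
Lemma CPSeries_expansion (a : nat -> R) (z t : C) : entire a -> Cmod t <= 1 ->
  Cmod (CPSeries a (z + t) - CPSeries a z - t * CPSeries (deriv a) z)
    <= Cmod t ^ 2 * Series (fun n => Rabs (euler (euler a) n) * (Cmod z + 1) ^ n).
Proof.
  intros Ha Ht. assert (Hz := Cmod_ge_0 z).
  assert (He : entire (euler (euler a))) by now apply entire_euler, entire_euler.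
  specialize (He (Cmod z + 1) ltac:(lra)).
  rewrite <- Series_scal_l.
  set (v := fun n => (RtoC (a n) * (RtoC (INR n) * z ^ pred n))%C).
  assert (Hd := entire_deriv a Ha).
  assert (Hv : is_cseries v (CPSeries (deriv a) z)).
  { apply is_cseries_decr_1. unfold v at 2. simpl.
    replace (CPSeries (deriv a) z - RtoC (a O) * (RtoC 0 * 1))%C with (CPSeries (deriv a) z) by ring.
    eapply is_cseries_ext; [|apply CPSeries_correct, Hd].
    intros n. unfold v, deriv. cbn [pred]. rewrite RtoC_mult. ring. }
  apply is_cseries_Cmod_le with (u := fun n =>
    ((RtoC (a n) * (z + t) ^ n + RtoC (-1) * (RtoC (a n) * z ^ n)) + - t * v n)%C).
  - replace (CPSeries a (z + t) - CPSeries a z - t * CPSeries (deriv a) z)%C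
      with (CPSeries a (z + t) + RtoC (-1) * CPSeries a z + - t * CPSeries (deriv a) z)%C
      by (replace (-1) with (- (1)) by ring; rewrite !RtoC_opp; ring).
    repeat apply is_cseries_plus.
    + now apply CPSeries_correct.
    + now apply is_cseries_scal, CPSeries_correct.
    + now apply is_cseries_scal.
  - intros n.
    replace ((RtoC (a n) * (z + t) ^ n + RtoC (-1) * (RtoC (a n) * z ^ n))
        + - t * v n)%C
      with (RtoC (a n) * ((z + t) ^ n - z ^ n - RtoC (INR n) * t * z ^ pred n))%C
      by (unfold v; replace (-1) with (- (1)) by ring; rewrite !RtoC_opp; ring).
    rewrite (Cmod_mult (RtoC (a n))), Cmod_R. unfold euler.
    rewrite !Rabs_mult, !(Rabs_pos_eq (INR n)) by apply pos_INR.
    apply Rle_trans with (Rabs (a n) * (Cmod t ^ 2 * (INR n * (INR n * (Cmod z + 1) ^ n)))).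
    + apply Rmult_le_compat_l; [apply Rabs_pos|now apply pow_expansion].
    + apply Req_le; ring.
  - now apply ex_series_scal_R.
Qed.

Lemma is_derive_quadratic (f : R -> R) (x l K r : R) : 0 < r ->
  (forall t, Rabs t <= r -> Rabs (f (x + t) - f x - t * l) <= t ^ 2 * K) -> is_derive f x l.
Proof.
  intros Hr H. apply is_derive_Reals. intros eps He.
  set (B := Rabs K + 1). assert (HB : 0 < B) by (assert (P := Rabs_pos K); unfold B; lra).
  assert (Hd : 0 < Rmin r (eps / B)) by (apply Rmin_pos; [assumption|now apply Rdiv_lt_0_compat]).
  exists (mkposreal _ Hd). intros t Ht0 Ht. simpl in Ht.
  assert (H1 : Rabs t <= r) by (assert (P := Rmin_l r (eps / B)); lra).
  assert (H2 : Rabs t < eps / B) by (assert (P := Rmin_r r (eps / B)); lra).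
  assert (Hp : 0 < Rabs t) by now apply Rabs_pos_lt.
  replace ((f (x + t) - f x) / t - l) with ((f (x + t) - f x - t * l) / t) by (field; assumption).
  unfold Rdiv. rewrite Rabs_mult, Rabs_inv.
  apply Rmult_lt_reg_r with (Rabs t); [assumption|].
  rewrite Rmult_assoc, Rinv_l, Rmult_1_r by lra.
  apply Rle_lt_trans with (t ^ 2 * K); [now apply H|].
  apply Rle_lt_trans with (Rabs t * (Rabs t * B)).
  - replace (t ^ 2 * K) with (Rabs t * Rabs t * K)
      by (rewrite <- Rabs_mult, Rabs_pos_eq by nra; ring).
    rewrite <- Rmult_assoc. apply Rmult_le_compat_l; [nra|].
    assert (P := Rle_abs K). unfold B; lra.
  - rewrite Rmult_comm. apply Rmult_lt_compat_r; [assumption|].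
    apply Rmult_lt_reg_r with (/ B); [now apply Rinv_0_lt_compat|].
    rewrite Rmult_assoc, Rinv_r, Rmult_1_r by lra. exact H2.
Qed.

Lemma horizontal_derive_CPSeries (a : nat -> R) (z : C) :
  entire a -> horizontal_derive (CPSeries a) z (CPSeries (deriv a) z).
Proof.
  intros Ha. destruct z as [x y].
  set (K := Series (fun n => Rabs (euler (euler a) n) * (Cmod (x, y) + 1) ^ n)).
  assert (E : forall t : R, ((x, y) + RtoC t)%C = (x + t, y)).
  { intros t. unfold Cplus, RtoC; simpl. now rewrite Rplus_0_r. }
  split; cbn [Re Im fst snd]; apply is_derive_quadratic with K 1; try lra; intros t Ht;
    rewrite <- !E, <- (pow2_abs t), <- (Cmod_R t);
    rewrite <- Cmod_R in Ht;
    (eapply Rle_trans; [|apply (CPSeries_expansion a (x, y) (RtoC t) Ha Ht)]).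
  - eapply Rle_trans; [|apply re_le_Cmod]. apply Req_le. f_equal. simpl. unfold Re; ring.
  - eapply Rle_trans; [|apply im_le_Cmod]. apply Req_le. f_equal. simpl. unfold Im; ring.
Qed.

(** * The radius of starlikeness as a zero of the derivative *)

(** The coefficients of the derivative of [z g (z)]. *)
Definition zderiv (a : nat -> R) (n : nat) : R := (1 + INR n) * a n.

Lemma zderiv_euler (a : nat -> R) (n : nat) : zderiv a n = a n + euler a n.
Proof. unfold zderiv, euler; ring. Qed.

Lemma deriv_shift (a : nat -> R) (n : nat) : deriv (shift a) n = zderiv a n.
Proof. unfold deriv, zderiv. rewrite S_INR. simpl. ring. Qed.

Lemma zderiv_laguerre_polya (a : nat -> R) : laguerre_polya a -> laguerre_polya (zderiv a).
Proof.
  intros Ha. destruct (laguerre_polya_multiplier a 1 Ha Rlt_0_1) as (p & M & (HM & Hb & Hl) & Hs).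
  exists p, M. split; [split; [assumption|split; [assumption|]]|assumption].
  intros k. replace (zderiv a k) with ((1 + INR k / 1) * a k) by (unfold zderiv; field).
  apply Hl.
Qed.

Lemma CPSeries_zderiv (a : nat -> R) (z : C) : entire a ->
  CPSeries (zderiv a) z = (CPSeries a z + CPSeries (euler a) z)%C.
Proof.
  intros Ha. rewrite (CPSeries_ext _ _ z (zderiv_euler a)).
  apply CPSeries_plus; [assumption|now apply entire_euler].
Qed.

Lemma PSeries_zderiv (a : nat -> R) (x : R) : entire a ->
  PSeries (zderiv a) x = PSeries a x + PSeries (euler a) x.
Proof.
  intros Ha. apply RtoC_inj. rewrite RtoC_plus, <- !CPSeries_real. now apply CPSeries_zderiv.
Qed.

Section Starlike.
Context (a : nat -> R) (f : C -> C) (x0 : R).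
Context (Ha : laguerre_polya a) (Hf : forall z, f z = (z * CPSeries a z)%C).
Context (Hx0 : 0 < x0) (Hpos : forall x, 0 <= x < x0 -> 0 < PSeries (zderiv a) x).
Context (Hzero : PSeries (zderiv a) x0 = 0).

Lemma C_derive_entire (z : C) : C_derive f z = CPSeries (zderiv a) z.
Proof.
  assert (He := laguerre_polya_entire a Ha).
  rewrite <- (CPSeries_ext _ _ z (deriv_shift a)).
  apply C_derive_horizontal.
  assert (E : forall w, CPSeries (shift a) w = f w) by (intros w; now rewrite Hf, CPSeries_shift).
  destruct (horizontal_derive_CPSeries (shift a) z (entire_shift a He)) as [H1 H2].
  split.
  - apply (is_derive_ext _ _ _ _ (fun t => f_equal Re (E (t, Im z))) H1).
  - apply (is_derive_ext _ _ _ _ (fun t => f_equal Im (E (t, Im z))) H2).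
Qed.

Lemma positive_before (x : R) : 0 <= x < x0 -> 0 < PSeries a x.
Proof.
  intros [[H0|<-] Hx].
  2:{ assert (H := Hpos 0 ltac:(lra)). rewrite PSeries_0 in *.
      unfold zderiv in H. simpl in H. lra. }
  assert (He := laguerre_polya_entire a Ha).
  assert (Hs : forall t, PSeries (shift a) t = t * PSeries a t).
  { intros t. apply RtoC_inj. rewrite RtoC_mult, <- !CPSeries_real. now apply CPSeries_shift. }
  destruct (MVT_cor2 (PSeries (shift a)) (PSeries (zderiv a)) 0 x H0) as (c & Ec & Hc).
  { intros t _. apply is_derive_Reals.
    rewrite <- (PSeries_ext _ _ t (deriv_shift a)).
    apply is_derive_PSeries, entire_radius, entire_shift, He. }
  rewrite !Hs, Rmult_0_l, !Rminus_0_r in Ec.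
  assert (P : 0 < x * PSeries a x).
  { rewrite Ec. apply Rmult_lt_0_compat; [apply Hpos|]; lra. }
  apply Rmult_lt_reg_l with x; [assumption|]. now rewrite Rmult_0_r.
Qed.

(** The real part of [z f'/f = 1 + z g'/g] is at least its value at [|z|], which is
    positive before [x0]. *)
Lemma starlike_inside (z : C) : z <> RtoC 0 -> Cmod z < x0 ->
  f z <> RtoC 0 /\ 0 < Re (z * C_derive f z / f z)%C.
Proof.
  intros Hz0 Hz. assert (He := laguerre_polya_entire a Ha).
  assert (Hp : positive_upto a (Cmod z)).
  { intros x Hx. apply positive_before. lra. }
  assert (Hr : 0 <= Cmod z) by apply Cmod_ge_0.
  destruct (complex_bounds a z Ha Hp) as [H1 H2].
  assert (G := Hp (Cmod z) ltac:(lra)).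
  assert (F := Hpos (Cmod z) ltac:(lra)). rewrite PSeries_zderiv in F by assumption.
  rewrite Hf, C_derive_entire, CPSeries_zderiv by assumption.
  set (g := CPSeries a z) in *. set (e := CPSeries (euler a) z) in *.
  assert (Hg : g <> RtoC 0) by (apply Cmod_gt_0; lra).
  split; [now apply Cmult_neq_0|].
  replace (z * (g + e) / (z * g))%C with (1 + e / g)%C by (field; split; assumption).
  set (w := (e / g)%C).
  assert (Ew : (e * Cconj g)%C = (RtoC (Cmod g ^ 2) * w)%C).
  { rewrite Cmod2_conj. unfold w. field. assumption. }
  rewrite Ew in H2.
  replace (Re (RtoC (Cmod g ^ 2) * w)) with (Cmod g ^ 2 * Re w) in H2
    by (generalize (Cmod g ^ 2) w; intros t [u v]; simpl; ring).
  assert (Hq : 0 < Cmod g ^ 2) by (apply pow_lt; lra).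
  assert (H3 : PSeries (euler a) (Cmod z) <= Re w * PSeries a (Cmod z)).
  { apply Rmult_le_reg_l with (Cmod g ^ 2); [assumption|]. lra. }
  change (0 < 1 + Re w).
  apply Rmult_lt_reg_r with (PSeries a (Cmod z)); [assumption|]. lra.
Qed.

Lemma starlike_radius_eq : starlike_radius f = Finite x0.
Proof.
  unfold starlike_radius. apply is_lub_Rbar_unique. split.
  - intros r [Hr H]. simpl. apply Rnot_lt_le. intros Hlt.
    assert (Hc : Cmod (RtoC x0) = x0) by (rewrite Cmod_R; apply Rabs_pos_eq; lra).
    destruct (H (RtoC x0)) as [_ H1]; [intros E; apply RtoC_inj in E; lra|lra|].
    rewrite C_derive_entire, CPSeries_real, Hzero in H1.
    replace (RtoC x0 * RtoC 0 / f (RtoC x0))%C with (RtoC 0) in H1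
      by (unfold Cdiv; ring).
    simpl in H1. lra.
  - intros b Hb. apply Hb. split; [assumption|]. exact starlike_inside.
Qed.
End Starlike.

(** Positivity up to [X] forces [X <= s_1 / s_2], by [newton_mono], so there is a zero. *)
Lemma first_zero (A : nat -> R) : laguerre_polya A -> 0 < A O -> 0 < newton 2 A ->
  exists x0, 0 < x0 /\ (forall x, 0 <= x < x0 -> 0 < PSeries A x) /\ PSeries A x0 = 0.
Proof.
  intros HA HA0 Hn2. assert (He := laguerre_polya_entire A HA).
  set (E := fun X => 0 <= X /\ positive_upto A X).
  assert (Hb : bound E).
  { exists (newton 1 A / newton 2 A). intros X [HX HP].
    assert (H := newton_mono A X 1 HA HX HP ltac:(lia)).
    apply Rmult_le_reg_r with (newton 2 A); [assumption|].
    unfold Rdiv. rewrite Rmult_assoc, Rinv_l; lra. }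
  assert (H1 := newton_nonneg A 1 HA ltac:(lia)).
  set (e := / (2 * (newton 1 A + 1))).
  assert (Hep : 0 < e) by (apply Rinv_0_lt_compat; lra).
  assert (HEe : E e).
  { split; [lra|]. intros x Hx. apply (positive_below_newton A x 1 HA ltac:(lia)); [lra|].
    rewrite pow_1. apply Rle_lt_trans with (e * newton 1 A).
    - apply Rmult_le_compat_r; lra.
    - unfold e. apply Rmult_lt_reg_l with (2 * (newton 1 A + 1)); [lra|].
      rewrite <- Rmult_assoc, Rinv_r; lra. }
  destruct (completeness E Hb (ex_intro _ e HEe)) as [x0 [Hub Hleast]].
  assert (Hx0 : 0 < x0) by (specialize (Hub e HEe); lra).
  assert (Hpos : forall x, 0 <= x < x0 -> 0 < PSeries A x).
  { intros x Hx. apply Rnot_le_lt. intros Hn.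
    assert (x0 <= x); [|lra]. apply Hleast. intros X [HX HP].
    apply Rnot_lt_le. intros HxX. specialize (HP x ltac:(lra)). lra. }
  exists x0. split; [assumption|split; [assumption|]].
  assert (Hc := continuity_PSeries A x0 He).
  destruct (Rtotal_order (PSeries A x0) 0) as [Hn|[Hz|Hp]]; [|assumption|]; exfalso.
  - destruct (Hc (- PSeries A x0) ltac:(lra)) as [d [Hd Hcd]].
    set (x := x0 - Rmin (d / 2) (x0 / 2)).
    assert (Hm : 0 < Rmin (d / 2) (x0 / 2)) by (apply Rmin_pos; lra).
    assert (M1 := Rmin_l (d / 2) (x0 / 2)). assert (M2 := Rmin_r (d / 2) (x0 / 2)).
    assert (HP := Hpos x ltac:(unfold x; lra)).
    specialize (Hcd x). simpl in Hcd. unfold R_dist in Hcd.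
    assert (Rabs (PSeries A x - PSeries A x0) < - PSeries A x0).
    { apply Hcd. split; [split; [exact I|unfold x; lra]|].
      unfold x. replace (x0 - Rmin (d / 2) (x0 / 2) - x0) with (- Rmin (d / 2) (x0 / 2)) by ring.
      rewrite Rabs_Ropp, Rabs_pos_eq; lra. }
    assert (Q := Rle_abs (PSeries A x - PSeries A x0)). lra.
  - destruct (Hc (PSeries A x0) Hp) as [d [Hd Hcd]].
    assert (x0 + d / 2 <= x0); [|lra]. apply Hub. split; [lra|].
    intros x Hx. destruct (Rlt_le_dec x x0) as [Hl|Hg]; [apply Hpos; lra|].
    destruct (Req_dec x x0) as [->|Hne]; [assumption|].
    specialize (Hcd x). simpl in Hcd. unfold R_dist in Hcd.
    assert (Rabs (PSeries A x - PSeries A x0) < PSeries A x0).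
    { apply Hcd. split; [split; [exact I|intros E1; apply Hne; now symmetry]|].
      rewrite Rabs_pos_eq; lra. }
    apply Rabs_def2 in H. lra.
Qed.

(** * Euler-Rayleigh inequalities *)

Lemma linear_limit (x0 al be : R) : 0 < x0 ->
  (forall X, 0 <= X < x0 -> 0 <= al - X * be) -> 0 <= al - x0 * be.
Proof.
  intros Hx H. apply Rnot_lt_le. intros Hn.
  assert (Hbe : 0 < be).
  { apply Rnot_le_lt. intros Hb. specialize (H 0 ltac:(lra)). nra. }
  assert (Hal : 0 <= al) by (specialize (H 0 ltac:(lra)); lra).
  set (X := (al / be + x0) / 2).
  assert (Hq : al / be < x0).
  { apply Rmult_lt_reg_r with be; [assumption|].
    unfold Rdiv; rewrite Rmult_assoc, Rinv_l; lra. }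
  assert (Hq0 : 0 <= al / be) by (apply Rdiv_le_0_compat; lra).
  specialize (H X ltac:(unfold X; lra)).
  assert (E : al = al / be * be) by (field; lra).
  assert (P : al / be < X) by (unfold X; lra). nra.
Qed.

(** With [A_k = s_k - x s_(k+1)] the quadratic form gives [A_2^2 <= A_1 A_3].  If [A_2 = 0] then
    [A_3 >= 0] contradicts log-convexity; if [A_3 = 0] or [A_1 = 0] the quadratic form forces
    [A_2 <= 0]. *)
Lemma strict_euler_rayleigh (x s1 s2 s3 s4 : R) :
  0 < x -> 0 < s2 -> 0 < s3 -> 0 < s4 ->
  0 <= s1 - x * s2 -> 0 <= s2 - x * s3 -> 0 <= s3 - x * s4 ->
  (forall t, 0 <= (s1 - x * s2) - 2 * t * (s2 - x * s3) + t ^ 2 * (s3 - x * s4)) ->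
  s3 ^ 2 < s2 * s4 ->
  x * s2 < s1 /\ x * s3 < s2 /\ x * s4 < s3.
Proof.
  intros Hx H2 H3 H4 A1 A2 A3 Hq Hs.
  assert (B2 : 0 < s2 - x * s3).
  { apply Rnot_le_lt. intros Hn. assert (E : s2 = x * s3) by lra. subst s2. nra. }
  assert (B3 : 0 < s3 - x * s4).
  { apply Rnot_le_lt. intros Hn. assert (E : s3 - x * s4 = 0) by lra.
    (* at this [t] the form equals [- (A_1 + 2)] *)
    specialize (Hq ((s1 - x * s2 + 1) / (s2 - x * s3))). rewrite E in Hq.
    replace (2 * ((s1 - x * s2 + 1) / (s2 - x * s3)) * (s2 - x * s3))
      with (2 * (s1 - x * s2 + 1)) in Hq by (field; lra). lra. }
  assert (B1 : 0 < s1 - x * s2).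
  { apply Rnot_le_lt. intros Hn. assert (E : s1 - x * s2 = 0) by lra.
    (* the minimum of the quadratic polynomial in [t] *)
    specialize (Hq ((s2 - x * s3) / (s3 - x * s4))). rewrite E in Hq.
    replace (0 - 2 * ((s2 - x * s3) / (s3 - x * s4)) * (s2 - x * s3)
       + ((s2 - x * s3) / (s3 - x * s4)) ^ 2 * (s3 - x * s4))
      with (- ((s2 - x * s3) ^ 2 * / (s3 - x * s4))) in Hq by (field; lra).
    assert (0 < (s2 - x * s3) ^ 2 * / (s3 - x * s4)); [|lra].
    apply Rmult_lt_0_compat; [now apply pow_lt|now apply Rinv_0_lt_compat]. }
  lra.
Qed.

(** The weak lower bound for [k + 1] and the strict [x0 s_(k+1) < s_k] give the strict lower
    bound for [k]. *)
Lemma starlike_bounds (a : nat -> R) (f : C -> C) :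
  laguerre_polya a -> (forall z, f z = (z * CPSeries a z)%C) -> 0 < a O ->
  0 < newton 2 a -> 0 < newton 2 (zderiv a) -> 0 < newton 3 (zderiv a) ->
  0 < newton 4 (zderiv a) ->
  newton 3 (zderiv a) ^ 2 < newton 2 (zderiv a) * newton 4 (zderiv a) ->
  exists x0, starlike_radius f = Finite x0 /\ 0 < x0 /\
    x0 * newton 1 a < 1 /\
    (1 < x0 * newton 1 (zderiv a) /\ x0 * newton 2 (zderiv a) < newton 1 (zderiv a)) /\
    (1 < x0 ^ 2 * newton 2 (zderiv a) /\ x0 * newton 3 (zderiv a) < newton 2 (zderiv a)) /\
    (1 < x0 ^ 3 * newton 3 (zderiv a) /\ x0 * newton 4 (zderiv a) < newton 3 (zderiv a)).
Proof.
  intros Ha Hf Ha0 Hn2 S2 S3 S4 Hs.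
  assert (He := laguerre_polya_entire a Ha).
  assert (HA := zderiv_laguerre_polya a Ha).
  assert (HA0 : 0 < zderiv a 0) by (unfold zderiv; simpl; lra).
  destruct (first_zero _ HA HA0 S2) as (x0 & Hx0 & Hpos & Hzero).
  exists x0. split; [now apply (starlike_radius_eq a)|]. split; [assumption|].
  assert (HP : forall X, 0 <= X < x0 -> positive_upto (zderiv a) X).
  { intros X HX x Hx. apply Hpos. lra. }
  assert (Hm : forall k, (1 <= k <= 3)%nat ->
    0 <= newton k (zderiv a) - x0 * newton (S k) (zderiv a)).
  { intros k Hk. apply linear_limit; [assumption|]. intros X HX.
    apply newton_mono; [assumption|lra|now apply HP|assumption]. }
  assert (Hl : forall k, (1 <= k <= 4)%nat -> 1 <= x0 ^ k * newton k (zderiv a)).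
  { intros k Hk. apply Rnot_lt_le. intros Hlt.
    assert (H := positive_below_newton _ x0 k HA Hk ltac:(lra) Hlt). lra. }
  assert (M1 := Hm 1%nat ltac:(lia)). assert (M2 := Hm 2%nat ltac:(lia)).
  assert (M3 := Hm 3%nat ltac:(lia)).
  assert (L2 := Hl 2%nat ltac:(lia)). assert (L3 := Hl 3%nat ltac:(lia)).
  assert (L4 := Hl 4%nat ltac:(lia)).
  assert (Hq : forall t, 0 <= (newton 1 (zderiv a) - x0 * newton 2 (zderiv a))
    - 2 * t * (newton 2 (zderiv a) - x0 * newton 3 (zderiv a))
    + t ^ 2 * (newton 3 (zderiv a) - x0 * newton 4 (zderiv a))).
  { intros t.
    assert (H := linear_limit x0
      (newton 1 (zderiv a) - 2 * t * newton 2 (zderiv a) + t ^ 2 * newton 3 (zderiv a))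
      (newton 2 (zderiv a) - 2 * t * newton 3 (zderiv a) + t ^ 2 * newton 4 (zderiv a)) Hx0).
    match type of H with ?P -> _ => assert (HH : P) end.
    { intros X HX. assert (Q := newton_quadratic _ X t HA ltac:(lra) (HP X HX)). lra. }
    specialize (H HH). lra. }
  revert S2 S3 S4 Hs M1 M2 M3 L2 L3 L4 Hq.
  generalize (newton 1 (zderiv a)) (newton 2 (zderiv a)) (newton 3 (zderiv a))
    (newton 4 (zderiv a)).
  intros s1 s2 s3 s4 S2 S3 S4 Hs M1 M2 M3 L2 L3 L4 Hq.
  destruct (strict_euler_rayleigh x0 s1 s2 s3 s4 Hx0 S2 S3 S4 M1 M2 M3 Hq Hs) as (U1 & U2 & U3).
  split.
  - assert (Hlog : forall X, 0 < X < x0 -> X * newton 1 a + X ^ 2 * newton 2 a < 1).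
    { intros X HX.
      assert (HPa : positive_upto a X).
      { intros x Hx. apply (positive_before a x0 Ha Hx0 Hpos). lra. }
      assert (B := log_derivative_bound a X Ha ltac:(lra) HPa).
      assert (G := HPa X ltac:(lra)). assert (F := Hpos X ltac:(lra)).
      rewrite PSeries_zderiv in F by assumption.
      apply Rmult_lt_reg_r with (PSeries a X); [assumption|]. lra. }
    assert (N1 := newton_nonneg a 1 Ha ltac:(lia)).
    apply Rnot_le_lt. intros Hge.
    set (c := x0 ^ 2 * newton 2 a).
    assert (Hc : 0 < c) by (apply Rmult_lt_0_compat; [now apply pow_lt|assumption]).
    (* [e (1 + 2 c) = c] makes [(1 - e) + (1 - e)^2 c >= 1] at the point [x0 (1 - e)] *)
    set (e := c / (1 + 2 * c)).
    assert (Hee : e * (1 + 2 * c) = c) by (unfold e; field; lra).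
    assert (He0 : 0 < e) by (apply Rdiv_lt_0_compat; lra).
    assert (He1 : e < 1) by nra.
    specialize (Hlog (x0 * (1 - e))).
    assert (Hr : 0 < x0 * (1 - e) < x0) by (split; nra).
    specialize (Hlog Hr).
    replace ((x0 * (1 - e)) ^ 2 * newton 2 a) with ((1 - e) ^ 2 * c) in Hlog by (unfold c; ring).
    replace (x0 * (1 - e) * newton 1 a) with ((1 - e) * (x0 * newton 1 a)) in Hlog by ring.
    assert ((1 - e) * 1 <= (1 - e) * (x0 * newton 1 a)) by (apply Rmult_le_compat_l; lra).
    assert (0 <= e ^ 2 * c) by (apply Rmult_le_pos; [apply pow2_ge_0|lra]).
    nra.
  - assert (P2 : 0 < x0 ^ 2) by now apply pow_lt. assert (P3 : 0 < x0 ^ 3) by now apply pow_lt.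
    split; [split; [|exact U1]|split; split; [|exact U2| |exact U3]].
    + apply Rle_lt_trans with (1 := L2). replace (x0 ^ 2 * s2) with (x0 * (x0 * s2)) by ring.
      now apply Rmult_lt_compat_l.
    + apply Rle_lt_trans with (1 := L3). replace (x0 ^ 3 * s3) with (x0 ^ 2 * (x0 * s3)) by ring.
      now apply Rmult_lt_compat_l.
    + apply Rle_lt_trans with (1 := L4). replace (x0 ^ 4 * s4) with (x0 ^ 3 * (x0 * s4)) by ring.
      now apply Rmult_lt_compat_l.
Qed.

(** * The power sums of the reciprocal zeros in closed form *)

Section ClosedForms.
Context (nu : R) (Hnu : -1 < nu).

Definition nu2 : R := nu ^ 2 + 24 * nu + 71.

Lemma hcoef_1 : hcoef nu 1 = - / (16 * pochhammer (nu + 1) 3).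
Proof. unfold hcoef; simpl. field. repeat split; lra. Qed.

Lemma hcoef_2 : hcoef nu 2
  = / (512 * (pochhammer (nu + 1) 2 * pochhammer (nu + 2) 4)).
Proof. unfold hcoef; simpl. field. repeat split; lra. Qed.

Lemma hcoef_3 : hcoef nu 3
  = - / (24576 * (pochhammer (nu + 1) 3 * pochhammer (nu + 2) 6)).
Proof. unfold hcoef; simpl. field. repeat split; lra. Qed.

Lemma hcoef_4 : hcoef nu 4
  = / (1572864 * (pochhammer (nu + 1) 4 * pochhammer (nu + 2) 8)).
Proof. unfold hcoef; simpl. field. repeat split; lra. Qed.

Lemma newton_2_hcoef : 0 < newton 2 (hcoef nu).
Proof.
  replace (newton 2 (hcoef nu)) with
    ((5 * nu + 17) / (256 * ((nu + 1) ^ 2 * (nu + 2) ^ 2 * (nu + 3) ^ 2 * (nu + 4) * (nu + 5)))).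
  - apply Rdiv_lt_0_compat; [lra|]. repeat apply Rmult_lt_0_compat; lra.
  - unfold newton. rewrite hcoef_1, hcoef_2. cbn [pochhammer INR]. field. repeat split; lra.
Qed.

Lemma sigma_1 : newton 1 (zderiv (hcoef nu)) = / (8 * pochhammer (nu + 1) 3).
Proof.
  unfold newton, zderiv. rewrite hcoef_1. cbn [pochhammer INR]. field. repeat split; lra.
Qed.

Lemma sigma_2 : newton 2 (zderiv (hcoef nu))
  = nu2 / (256 * (pochhammer (nu + 1) 3 * pochhammer (nu + 1) 5)).
Proof.
  unfold newton, zderiv, nu2. rewrite hcoef_1, hcoef_2. cbn [pochhammer INR].
  field. repeat split; lra.
Qed.

Lemma sigma_3 : newton 3 (zderiv (hcoef nu))
  = nu5 nu / (4096 * (pochhammer (nu + 1) 3 ^ 2 * pochhammer (nu + 1) 7)).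
Proof.
  unfold newton, zderiv, nu5. rewrite hcoef_1, hcoef_2, hcoef_3. cbn [pochhammer INR].
  field. repeat split; lra.
Qed.

Lemma sigma_4 : newton 4 (zderiv (hcoef nu))
  = nu6 nu / (65536 * (pochhammer (nu + 1) 3 ^ 2 * pochhammer (nu + 1) 5
                       * pochhammer (nu + 1) 9)).
Proof.
  unfold newton, zderiv, nu6. rewrite hcoef_1, hcoef_2, hcoef_3, hcoef_4.
  cbn [pochhammer INR]. field. repeat split; lra.
Qed.

(* Each of the following polynomials has nonnegative coefficients in
   [x = nu + 1], which is positive. *)

Lemma nu2_pos : 0 < nu2.
Proof. unfold nu2. nra. Qed.

Lemma nu5_pos : 0 < nu5 nu.
Proof.
  set (x := nu + 1). assert (Hx : 0 < x) by (unfold x; lra).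
  replace (nu5 nu) with (2880 + 2196 * x + 488 * x ^ 2 + 33 * x ^ 3 + x ^ 4)
    by (unfold nu5, x; ring).
  assert (P := fun n => pow_lt x n Hx).
  assert (P2 := P 2%nat). assert (P3 := P 3%nat). assert (P4 := P 4%nat). lra.
Qed.

Lemma nu6_pos : 0 < nu6 nu.
Proof.
  set (x := nu + 1). assert (Hx : 0 < x) by (unfold x; lra).
  replace (nu6 nu) with (3870720 + 6004224 * x + 3781024 * x ^ 2 + 1249628 * x ^ 3
     + 234652 * x ^ 4 + 25519 * x ^ 5 + 1614 * x ^ 6 + 60 * x ^ 7 + x ^ 8)
    by (unfold nu6, x; ring).
  assert (P := fun n => pow_lt x n Hx).
  assert (P2 := P 2%nat). assert (P3 := P 3%nat). assert (P4 := P 4%nat).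
  assert (P5 := P 5%nat). assert (P6 := P 6%nat). assert (P7 := P 7%nat).
  assert (P8 := P 8%nat). lra.
Qed.

Lemma sigma_log_convex : (nu5 nu) ^ 2 * ((nu + 4) * (nu + 5) * (nu + 8) * (nu + 9))
  < nu2 * nu6 nu * ((nu + 6) * (nu + 7)).
Proof.
  set (x := nu + 1). assert (Hx : 0 < x) by (unfold x; lra).
  assert (E : nu2 * nu6 nu * ((nu + 6) * (nu + 7))
     - (nu5 nu) ^ 2 * ((nu + 4) * (nu + 5) * (nu + 8) * (nu + 9))
     = 16611840 * x ^ 2 + 35385408 * x ^ 3 + 31271456 * x ^ 4 + 14905712 * x ^ 5
       + 4188352 * x ^ 6 + 717868 * x ^ 7 + 76270 * x ^ 8 + 5149 * x ^ 9
       + 224 * x ^ 10 + 5 * x ^ 11) by (unfold nu2, nu5, nu6, x; ring).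
  assert (P := fun n => pow_lt x n Hx).
  assert (P2 := P 2%nat). assert (P3 := P 3%nat). assert (P4 := P 4%nat).
  assert (P5 := P 5%nat). assert (P6 := P 6%nat). assert (P7 := P 7%nat).
  assert (P8 := P 8%nat). assert (P9 := P 9%nat). assert (P10 := P 10%nat).
  assert (P11 := P 11%nat). lra.
Qed.

Lemma sigma_strict : newton 3 (zderiv (hcoef nu)) ^ 2
  < newton 2 (zderiv (hcoef nu)) * newton 4 (zderiv (hcoef nu)).
Proof.
  rewrite sigma_2, sigma_3, sigma_4.
  set (D := 16777216 * (pochhammer (nu + 1) 3 ^ 3 * pochhammer (nu + 1) 5 ^ 2
              * pochhammer (nu + 1) 9) * ((nu + 6) * (nu + 7))).
  assert (HD : 0 < D).
  { unfold D. cbn [pochhammer INR]. repeat apply Rmult_lt_0_compat; try apply pow_lt;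
      repeat apply Rmult_lt_0_compat; lra. }
  replace ((nu5 nu / (4096 * (pochhammer (nu + 1) 3 ^ 2 * pochhammer (nu + 1) 7))) ^ 2)
    with ((nu5 nu) ^ 2 * ((nu + 4) * (nu + 5) * (nu + 8) * (nu + 9)) / D)
    by (unfold D; cbn [pochhammer INR]; field; repeat split; lra).
  replace (nu2 / (256 * (pochhammer (nu + 1) 3 * pochhammer (nu + 1) 5))
    * (nu6 nu / (65536 * (pochhammer (nu + 1) 3 ^ 2 * pochhammer (nu + 1) 5
                       * pochhammer (nu + 1) 9))))
    with (nu2 * nu6 nu * ((nu + 6) * (nu + 7)) / D)
    by (unfold D; cbn [pochhammer INR]; field; repeat split; lra).
  apply Rmult_lt_compat_r; [now apply Rinv_0_lt_compat|exact sigma_log_convex].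
Qed.
End ClosedForms.

(** * The Gamma function *)

Lemma ex_RInt_halfline (f : R -> R) (a b : R) :
  (forall t, 0 < t -> continuous f t) -> 0 < a <= b -> ex_RInt f a b.
Proof.
  intros Hc Hab. apply (ex_RInt_continuous (V := R_CompleteNormedModule)).
  intros t Ht. rewrite Rmin_left in Ht by lra. apply Hc. lra.
Qed.

(** The integrals over compact intervals increase to their supremum. *)
Lemma is_RInt_gen_nonneg (f : R -> R) (B : R) :
  (forall t, 0 < t -> continuous f t) -> (forall t, 0 < t -> 0 <= f t) ->
  (forall a b, 0 < a <= b -> RInt f a b <= B) ->
  exists l, is_RInt_gen f (at_right 0) (Rbar_locally p_infty) l /\
    forall a b, 0 < a <= b -> RInt f a b <= l.
Proof.
  intros Hc Hp HB.
  set (E := fun y => exists a b, 0 < a <= b /\ y = RInt f a b).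
  destruct (completeness E) as [l [Hub Hl]].
  { exists B. intros y (a & b & Hab & ->). now apply HB. }
  { exists (RInt f 1 1), 1, 1. split; [lra|reflexivity]. }
  assert (Hle : forall a b, 0 < a <= b -> RInt f a b <= l).
  { intros a b Hab. apply Hub. now exists a, b. }
  exists l. split; [|exact Hle].
  intros P [eps HP].
  assert (Hs : exists a b, 0 < a <= b /\ l - eps < RInt f a b).
  { apply NNPP. intros Hn. assert (l <= l - eps); [|assert (Q := cond_pos eps); lra].
    apply Hl. intros y (a & b & Hab & ->). apply Rnot_lt_le. intros Hlt.
    apply Hn. now exists a, b. }
  destruct Hs as (a0 & b0 & Hab0 & H0).
  apply (Filter_prod _ _ _ (fun a => 0 < a < a0) (fun b => b0 < b)).
  - exists (mkposreal a0 (proj1 Hab0)). intros a Ha Ha0. split; [assumption|].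
    apply Rabs_def2 in Ha. unfold minus, plus, opp in Ha; simpl in Ha. lra.
  - now exists b0.
  - intros a b Ha Hb. exists (RInt f a b). simpl. split.
    + apply (RInt_correct (V := R_CompleteNormedModule)).
      apply ex_RInt_halfline; [assumption|lra].
    + apply HP. apply Rabs_def1; unfold minus, plus, opp; simpl.
      * assert (H := Hle a b ltac:(lra)). assert (Q := cond_pos eps). lra.
      * assert (X1 : ex_RInt f a a0) by (apply ex_RInt_halfline; [assumption|lra]).
        assert (X2 : ex_RInt f a0 b0) by (apply ex_RInt_halfline; [assumption|lra]).
        assert (X3 : ex_RInt f b0 b) by (apply ex_RInt_halfline; [assumption|lra]).
        assert (X4 : ex_RInt f a0 b) by (apply ex_RInt_halfline; [assumption|lra]).
        assert (C1 := RInt_Chasles (V := R_CompleteNormedModule) f a a0 b X1 X4).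
        assert (C2 := RInt_Chasles (V := R_CompleteNormedModule) f a0 b0 b X2 X3).
        unfold plus in C1, C2; simpl in C1, C2.
        assert (G1 : 0 <= RInt f a a0).
        { apply RInt_ge_0; [lra|assumption|]. intros t Ht; apply Hp; lra. }
        assert (G2 : 0 <= RInt f b0 b).
        { apply RInt_ge_0; [lra|assumption|]. intros t Ht; apply Hp; lra. }
        lra.
Qed.

Definition gamma_integrand (x t : R) : R := Rpower t (x - 1) * exp (- t).

Lemma gamma_integrand_pos (x t : R) : 0 < gamma_integrand x t.
Proof. apply Rmult_lt_0_compat; apply exp_pos. Qed.

Lemma gamma_integrand_continuous (x t : R) : 0 < t -> continuous (gamma_integrand x) t.
Proof.
  intros Ht. apply (ex_derive_continuous (gamma_integrand x)).
  unfold gamma_integrand, Rpower. auto_derive. lra.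
Qed.

(** The maximum of [t^y e^(-t)] is at [t = y]. *)
Lemma Rpower_exp_le (t y : R) : 0 < t -> 0 < y ->
  Rpower t y * exp (- t) <= exp (y * ln y).
Proof.
  intros Ht Hy. unfold Rpower. rewrite <- exp_plus.
  assert (H : y * ln t + - t <= y * ln y).
  { assert (Hq : 0 < t / y) by now apply Rdiv_lt_0_compat.
    assert (Hl : ln (t / y) <= t / y - 1).
    { replace (t / y) with (1 + (t / y - 1)) at 1 by ring.
      apply Rnot_lt_le. intros Hn. assert (Hx := exp_increasing _ _ Hn).
      rewrite exp_ln in Hx by lra. assert (Hi := exp_ineq1_le (t / y - 1)). lra. }
    rewrite ln_div in Hl by assumption.
    apply Rmult_le_compat_l with (r := y) in Hl; [|lra].
    replace (y * (t / y - 1)) with (t - y) in Hl by (field; lra). lra. }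
  destruct H as [H| ->]; [left; now apply exp_increasing|apply Rle_refl].
Qed.

(** [t^(x-1) e^(-t)] is at most a constant times the derivative of the bounded
    function [t^x / (1 + t^x)]; this one comparison covers both ends. *)
Lemma gamma_integrand_bound (x : R) : 0 < x ->
  exists B, forall a b, 0 < a <= b -> RInt (gamma_integrand x) a b <= B.
Proof.
  intros Hx.
  set (C := 1 + 2 * exp (x * ln x) + exp (2 * x * ln (2 * x))).
  assert (HC : 0 < C).
  { unfold C. assert (H1 := exp_pos (x * ln x)).
    assert (H2 := exp_pos (2 * x * ln (2 * x))). lra. }
  exists (C / x). intros a b Hab.
  set (G := fun t => C / x * (Rpower t x / (1 + Rpower t x))).
  set (dG := fun t => C * (Rpower t x / t) / (1 + Rpower t x) ^ 2).
  assert (HG : forall t, 0 < t -> is_derive G t (dG t)).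
  { intros t Ht. unfold G, dG, Rpower. assert (Q := exp_pos (x * ln t)).
    auto_derive; [split; lra|]. field. split; [lra|split; lra]. }
  assert (Hd : forall t, 0 < t -> continuous dG t).
  { intros t Ht. apply (ex_derive_continuous dG). unfold dG, Rpower.
    assert (Q := exp_pos (x * ln t)). auto_derive. repeat split; try lra.
    apply Rgt_not_eq. nra. }
  assert (HI : is_RInt dG a b (G b - G a)).
  { apply (is_RInt_derive (V := R_CompleteNormedModule) G dG);
      intros t Ht; rewrite Rmin_left in Ht by lra; [apply HG|apply Hd]; lra. }
  assert (HGb : forall t, 0 <= G t <= C / x).
  { intros t. unfold G. assert (Q := exp_pos (x * ln t)). fold (Rpower t x) in Q.
    assert (0 < C / x) by now apply Rdiv_lt_0_compat.
    assert (0 <= Rpower t x / (1 + Rpower t x) <= 1).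
    { split; [apply Rdiv_le_0_compat; lra|].
      apply Rmult_le_reg_r with (1 + Rpower t x); [lra|].
      unfold Rdiv; rewrite Rmult_assoc, Rinv_l; lra. }
    nra. }
  apply Rle_trans with (RInt dG a b).
  - apply RInt_le; [lra| | |].
    + apply ex_RInt_halfline; [apply gamma_integrand_continuous|assumption].
    + now exists (G b - G a).
    + intros t Ht. unfold gamma_integrand, dG.
      assert (Ht0 : 0 < t) by lra.
      assert (Ep : Rpower t (x - 1) = Rpower t x / t).
      { unfold Rminus. rewrite Rpower_plus, Rpower_Ropp, Rpower_1 by assumption. reflexivity. }
      rewrite Ep. assert (Q := exp_pos (x * ln t)). fold (Rpower t x) in Q.
      set (u := Rpower t x) in *.
      assert (B1 : u * exp (- t) <= exp (x * ln x)) by now apply Rpower_exp_le.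
      assert (B2 : u ^ 2 * exp (- t) <= exp (2 * x * ln (2 * x))).
      { replace (u ^ 2) with (Rpower t (2 * x)).
        - apply Rpower_exp_le; lra.
        - replace (2 * x) with (x + x) by ring. rewrite Rpower_plus. unfold u; ring. }
      assert (B0 : exp (- t) <= 1) by (rewrite <- exp_0; left; apply exp_increasing; lra).
      assert (D : 0 < (1 + u) ^ 2) by (apply pow_lt; lra).
      apply Rmult_le_reg_r with ((1 + u) ^ 2); [assumption|].
      replace (C * (u / t) / (1 + u) ^ 2 * (1 + u) ^ 2) with (u / t * C) by (field; lra).
      rewrite Rmult_assoc. apply Rmult_le_compat_l; [apply Rdiv_le_0_compat; lra|].
      unfold C. lra.
  - rewrite (is_RInt_unique (V := R_CompleteNormedModule) _ _ _ _ HI).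
    assert (H1 := HGb a). assert (H2 := HGb b). lra.
Qed.

Lemma Gamma_correct (x : R) : 0 < x ->
  is_RInt_gen (gamma_integrand x) (at_right 0) (Rbar_locally p_infty) (Gamma x) /\
  0 < Gamma x.
Proof.
  intros Hx. destruct (gamma_integrand_bound x Hx) as [B HB].
  destruct (is_RInt_gen_nonneg (gamma_integrand x) B) as (l & Hl & Hle).
  - apply gamma_integrand_continuous.
  - intros t _. left; apply gamma_integrand_pos.
  - exact HB.
  - assert (E : Gamma x = l).
    { exact (is_RInt_gen_unique (gamma_integrand x) l Hl). }
    rewrite E. split; [exact Hl|].
    apply Rlt_le_trans with (RInt (gamma_integrand x) 1 2); [|apply Hle; lra].
    apply RInt_gt_0; [lra| |].
    + intros t _; apply gamma_integrand_pos.
    + intros t Ht; apply gamma_integrand_continuous; lra.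
Qed.

Lemma Gamma_pos (x : R) : 0 < x -> 0 < Gamma x.
Proof. apply Gamma_correct. Qed.

(** The derivative of [t^x e^(-t)] is [x t^(x-1) e^(-t) - t^x e^(-t)], and its integral is
    zero because [t^x e^(-t)] vanishes at both ends. *)
Lemma Gamma_succ (x : R) : 0 < x -> Gamma (x + 1) = x * Gamma x.
Proof.
  intros Hx.
  destruct (Gamma_correct x Hx) as [H1 _].
  destruct (Gamma_correct (x + 1) ltac:(lra)) as [H2 _].
  set (H := fun t => Rpower t x * exp (- t)).
  assert (Hd : forall t, 0 < t ->
    is_derive H t (x * gamma_integrand x t - gamma_integrand (x + 1) t)).
  { intros t Ht.
    replace (x * gamma_integrand x t - gamma_integrand (x + 1) t)
      with (x * (/ t) * Rpower t x * exp (- t) - Rpower t x * exp (- t)).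
    - unfold H, Rpower. auto_derive; [lra|]. ring.
    - unfold gamma_integrand. replace (x + 1 - 1) with x by ring.
      unfold Rminus at 3. rewrite Rpower_plus, Rpower_Ropp, Rpower_1 by assumption. ring. }
  assert (Hint : filter_prod (at_right 0) (Rbar_locally p_infty)
     (fun ab : R * R => forall t, Rmin (fst ab) (snd ab) <= t <= Rmax (fst ab) (snd ab) -> 0 < t)).
  { apply (Filter_prod _ _ _ (fun a => 0 < a) (fun b => 0 < b)).
    - exists (mkposreal 1 Rlt_0_1). intros a _ Ha. exact Ha.
    - now exists 0.
    - intros a b Ha Hb t [Ht _]. simpl in Ht.
      assert (Q := Rmin_pos a b Ha Hb). lra. }
  assert (HD : is_RInt_gen (Derive H) (at_right 0) (Rbar_locally p_infty) (0 - 0)).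
  { apply is_RInt_gen_Derive.
    - revert Hint. apply filter_imp. intros ab Hab t Ht.
      eexists. apply Hd. now apply Hab.
    - revert Hint. apply filter_imp. intros ab Hab t Ht. assert (Ht0 := Hab t Ht).
      apply (continuous_ext_loc _ (fun u => x * gamma_integrand x u - gamma_integrand (x + 1) u)).
      + exists (mkposreal t Ht0). intros u Hu. symmetry. apply is_derive_unique, Hd.
        apply Rabs_def2 in Hu. unfold minus, plus, opp in Hu; simpl in Hu. lra.
      + apply (ex_derive_continuous
          (fun u => x * gamma_integrand x u - gamma_integrand (x + 1) u)).
        unfold gamma_integrand, Rpower. auto_derive. lra.
    - intros P [eps HP].
      exists (mkposreal (Rpower eps (/ x)) (exp_pos _)). intros t Ht Ht0. apply HP.
      apply Rabs_def2 in Ht. unfold minus, plus, opp in Ht; simpl in Ht.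
      assert (Hp : 0 < H t) by (apply Rmult_lt_0_compat; apply exp_pos).
      assert (Hlt : H t < eps).
      { apply Rlt_le_trans with (Rpower t x).
        - rewrite <- Rmult_1_r. apply Rmult_lt_compat_l; [apply exp_pos|].
          rewrite <- exp_0. apply exp_increasing. lra.
        - left. replace (pos eps) with (Rpower (Rpower eps (/ x)) x).
          + apply Rlt_Rpower_l; lra.
          + rewrite Rpower_mult, Rinv_l, Rpower_1; [reflexivity|apply cond_pos|lra]. }
      apply Rabs_def1; unfold minus, plus, opp; simpl; assert (Q := cond_pos eps); lra.
    - intros P [eps HP].
      set (K := exp ((x + 1) * ln (x + 1))).
      assert (HK : 0 < K) by apply exp_pos. assert (Q := cond_pos eps).
      exists (K / eps). intros t Ht. apply HP.
      assert (Hq : 0 < K / eps) by now apply Rdiv_lt_0_compat.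
      assert (Hp : 0 < H t) by (apply Rmult_lt_0_compat; apply exp_pos).
      assert (Hlt : H t < eps).
      { assert (B := Rpower_exp_le t (x + 1) ltac:(lra) ltac:(lra)). fold K in B.
        rewrite Rpower_plus, Rpower_1 in B by lra.
        apply Rmult_lt_reg_r with t; [lra|].
        apply Rle_lt_trans with K; [unfold H; lra|].
        apply Rmult_lt_compat_l with (r := eps) in Ht; [|assumption].
        replace (eps * (K / eps)) with K in Ht by (field; lra). lra. }
      apply Rabs_def1; unfold minus, plus, opp; simpl; lra. }
  assert (HS := is_RInt_gen_minus _ _ _ _
     (is_RInt_gen_scal (V := R_NormedModule) _ x _ H1) HD).
  assert (HE : is_RInt_gen (gamma_integrand (x + 1)) (at_right 0) (Rbar_locally p_infty)
     (x * Gamma x - (0 - 0))).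
  { revert HS. apply is_RInt_gen_ext. revert Hint. apply filter_imp.
    intros ab Hab t Ht. assert (Ht0 : 0 < t) by (apply Hab; lra).
    rewrite (is_derive_unique _ _ _ (Hd t Ht0)).
    unfold minus, plus, opp, scal; simpl. unfold mult; simpl. ring. }
  rewrite Rminus_diag, Rminus_0_r in HE.
  exact (is_RInt_gen_unique (gamma_integrand (x + 1)) _ HE).
Qed.

Lemma Gamma_add_nat (x : R) (n : nat) : 0 < x ->
  Gamma (x + INR n) = pochhammer x n * Gamma x.
Proof.
  intros Hx. induction n as [|n IH].
  - simpl. rewrite Rplus_0_r; ring.
  - assert (Hn := pos_INR n). rewrite S_INR.
    replace (x + (INR n + 1)) with (x + INR n + 1) by ring.
    rewrite Gamma_succ, IH by lra. simpl. ring.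
Qed.

(** * Polar coordinates and the principal power *)

Definition polar (r phi : R) : C := (r * cos phi, r * sin phi).

Lemma Cmod_polar (r phi : R) : 0 <= r -> Cmod (polar r phi) = r.
Proof.
  intros Hr. unfold Cmod, polar; cbn [fst snd].
  replace ((r * cos phi) ^ 2 + (r * sin phi) ^ 2) with (r ^ 2).
  - now apply sqrt_pow2.
  - assert (H := sin2_cos2 phi). unfold Rsqr in H.
    transitivity (r ^ 2 * (sin phi * sin phi + cos phi * cos phi)); [rewrite H|]; ring.
Qed.

Lemma Carg_polar (r phi : R) : 0 < r -> - PI < phi <= PI -> Carg (polar r phi) = phi.
Proof.
  intros Hr Hphi. unfold Carg. rewrite Cmod_polar by lra.
  replace (Re (polar r phi) / r) with (cos phi) by (unfold polar, Re; simpl; field; lra).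
  destruct (Rle_dec 0 (Im (polar r phi))) as [Hi|Hi]; unfold polar, Im in Hi; simpl in Hi.
  - destruct (Rle_lt_dec 0 phi) as [Hp|Hn]; [apply acos_cos; lra|exfalso].
    assert (Hs := sin_gt_0 (- phi) ltac:(lra) ltac:(lra)). rewrite sin_neg in Hs. nra.
  - assert (Hn : phi < 0).
    { apply Rnot_le_lt. intros Hp. apply Hi.
      apply Rmult_le_pos; [lra|]. apply sin_ge_0; lra. }
    rewrite <- cos_neg, acos_cos by lra. ring.
Qed.

Lemma polar_Carg (z : C) : z <> RtoC 0 ->
  z = polar (Cmod z) (Carg z) /\ - PI < Carg z <= PI.
Proof.
  intros Hz. assert (Hr : 0 < Cmod z) by now apply Cmod_gt_0.
  set (c := Re z / Cmod z).
  assert (Hre : Re z = Cmod z * c) by (unfold c; field; lra).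
  assert (Him : Im z ^ 2 = Cmod z ^ 2 * (1 - c ^ 2)).
  { assert (H := Cmod2_alt z). rewrite Hre in H. lra. }
  assert (Hc : -1 <= c <= 1).
  { assert (H : 0 <= Cmod z ^ 2 * (1 - c ^ 2)) by (rewrite <- Him; apply pow2_ge_0).
    assert (Hr2 : 0 < Cmod z ^ 2) by now apply pow_lt.
    assert (0 <= 1 - c ^ 2).
    { apply Rmult_le_reg_l with (Cmod z ^ 2); [assumption|]. lra. }
    split; nra. }
  assert (Hs : Cmod z * sin (acos c) = Rabs (Im z)).
  { rewrite sin_acos by assumption.
    rewrite <- (sqrt_pow2 (Cmod z)) at 1 by lra.
    rewrite <- sqrt_mult_alt by apply pow2_ge_0.
    replace (1 - c²) with (1 - c ^ 2) by (unfold Rsqr; ring).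
    rewrite <- Him. rewrite <- (pow2_abs (Im z)). apply sqrt_pow2, Rabs_pos. }
  assert (Hb := acos_bound c). assert (Hpi := PI_RGT_0). unfold Carg. fold c.
  destruct (Rle_dec 0 (Im z)) as [Hi|Hi].
  - split; [|lra]. unfold polar. rewrite cos_acos by assumption.
    rewrite Hs, Rabs_pos_eq, <- Hre by assumption. now destruct z.
  - apply Rnot_le_lt in Hi. split.
    + unfold polar. rewrite cos_neg, sin_neg, cos_acos by assumption.
      replace (Cmod z * - sin (acos c)) with (- (Cmod z * sin (acos c))) by ring.
      rewrite Hs, Rabs_left, Ropp_involutive, <- Hre by assumption. now destruct z.
    + split; [|lra]. destruct (Rle_lt_or_eq_dec _ _ (proj2 Hb)) as [Hl|He]; [lra|].
      rewrite He, sin_PI, Rmult_0_r, Rabs_left in Hs by assumption. lra.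
Qed.

Lemma polar_mult (r s phi psi : R) :
  (polar r phi * polar s psi)%C = polar (r * s) (phi + psi).
Proof.
  unfold polar, Cmult; cbn [fst snd]. rewrite cos_plus, sin_plus. f_equal; ring.
Qed.

Lemma polar_scal (c r phi : R) : (RtoC c * polar r phi)%C = polar (c * r) phi.
Proof. unfold polar, Cmult, RtoC; cbn [fst snd]. f_equal; ring. Qed.

Lemma polar_pow (r phi : R) (n : nat) : (polar r phi ^ n)%C = polar (r ^ n) (INR n * phi).
Proof.
  induction n as [|n IH].
  - unfold polar; simpl. rewrite Rmult_0_l, cos_0, sin_0. unfold RtoC. f_equal; ring.
  - rewrite Cpow_S, IH, polar_mult, S_INR. f_equal; simpl; ring.
Qed.

Lemma Cpower_polar (r phi a : R) : 0 < r -> - PI < phi <= PI ->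
  Cpower (polar r phi) a = polar (Rpower r a) (a * phi).
Proof.
  intros Hr Hphi. unfold Cpower. rewrite Cmod_polar, Carg_polar by lra.
  unfold polar, RtoC, Cmult; cbn [fst snd]. f_equal; ring.
Qed.

(** All powers are taken with the same argument, so exponents add without branch
    corrections. *)
Lemma Cpower_add_even (v : C) (nu : R) (n : nat) : v <> RtoC 0 ->
  Cpower v (2 * INR n + nu) = (Cpower v nu * (v ^ 2) ^ n)%C.
Proof.
  intros Hv. destruct (polar_Carg v Hv) as [E Hb].
  assert (Hr : 0 < Cmod v) by now apply Cmod_gt_0.
  rewrite E, !Cpower_polar, <- Cpow_mult_r, polar_pow, polar_mult by assumption.
  f_equal.
  - rewrite <- (Rpower_pow (2 * n)), <- Rpower_plus, mult_INR by assumption.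
    f_equal. simpl (INR 2). ring.
  - rewrite mult_INR. simpl (INR 2). ring.
Qed.

Lemma polar_right (t y : R) : 0 < t ->
  (t, y) = polar (Cmod (t, y)) (atan (y / t)) /\ - PI < atan (y / t) <= PI.
Proof.
  intros Ht. assert (B := atan_bound (y / t)). assert (P := PI_RGT_0).
  split; [|lra].
  assert (H1 : 0 < 1 + (y / t)²) by (assert (Q := Rle_0_sqr (y / t)); lra).
  assert (Hs : Cmod (t, y) = t * sqrt (1 + (y / t)²)).
  { unfold Cmod; cbn [fst snd]. rewrite <- (sqrt_pow2 t) at 2 by lra.
    rewrite <- sqrt_mult_alt by apply pow2_ge_0. f_equal. unfold Rsqr. field. lra. }
  assert (Hq := sqrt_lt_R0 _ H1).
  unfold polar. rewrite cos_atan, sin_atan, Hs. f_equal; field; lra.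
Qed.

Lemma Cpower_right (t y nu : R) : 0 < t ->
  Cpower (t, y) nu
  = polar (Rpower (sqrt (t ^ 2 + y ^ 2)) nu) (nu * atan (y / t)).
Proof.
  intros Ht. destruct (polar_right t y Ht) as [E B].
  assert (Hr : 0 < Cmod (t, y)).
  { apply Cmod_gt_0. intros H. injection H. lra. }
  rewrite E, Cpower_polar by assumption. reflexivity.
Qed.

(** * Calculus along horizontal lines *)

Lemma horizontal_derive_ext (f g : C -> C) (z l : C) : 0 < Re z ->
  (forall t, 0 < t -> f (t, Im z) = g (t, Im z)) ->
  horizontal_derive f z l -> horizontal_derive g z l.
Proof.
  intros Hz E [H1 H2].
  assert (L : forall F : C -> R,
    locally (Re z) (fun t => F (f (t, Im z)) = F (g (t, Im z)))).
  { intros F. exists (mkposreal _ Hz). intros t Ht. rewrite E; [reflexivity|].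
    apply Rabs_def2 in Ht. unfold minus, plus, opp in Ht; simpl in Ht. lra. }
  split; [apply (is_derive_ext_loc _ _ _ _ (L Re) H1)|apply (is_derive_ext_loc _ _ _ _ (L Im) H2)].
Qed.

Lemma is_derive_mult_R (f g : R -> R) (x df dg : R) :
  is_derive f x df -> is_derive g x dg ->
  is_derive (fun t => f t * g t) x (df * g x + f x * dg).
Proof.
  intros Hf Hg. apply is_derive_Reals. apply is_derive_Reals in Hf, Hg.
  exact (derivable_pt_lim_mult f g x df dg Hf Hg).
Qed.

Lemma horizontal_derive_mult (f g : C -> C) (z df dg : C) :
  horizontal_derive f z df -> horizontal_derive g z dg ->
  horizontal_derive (fun w => f w * g w)%C z (df * g z + f z * dg)%C.
Proof.
  intros [F1 F2] [G1 G2]. destruct z as [x y]. cbn [Re Im fst snd] in *. split.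
  - assert (H := is_derive_minus _ _ _ _ _ (is_derive_mult_R _ _ _ _ _ F1 G1)
      (is_derive_mult_R _ _ _ _ _ F2 G2)).
    replace (Re (df * g (x, y) + f (x, y) * dg)%C)
      with ((Re df * Re (g (x, y)) + Re (f (x, y)) * Re dg)
        - (Im df * Im (g (x, y)) + Im (f (x, y)) * Im dg)); [exact H|].
    destruct df, dg, (f (x, y)), (g (x, y)); simpl; ring.
  - assert (H := is_derive_plus _ _ _ _ _ (is_derive_mult_R _ _ _ _ _ F1 G2)
      (is_derive_mult_R _ _ _ _ _ F2 G1)).
    replace (Im (df * g (x, y) + f (x, y) * dg)%C)
      with ((Re df * Im (g (x, y)) + Re (f (x, y)) * Im dg)
        + (Im df * Re (g (x, y)) + Im (f (x, y)) * Re dg)); [exact H|].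
    destruct df, dg, (f (x, y)), (g (x, y)); simpl; ring.
Qed.

(** In the right half-plane the argument is the smooth function [atan (y / t)]; on the
    branch cut this would fail, but the fourth root never lies there. *)
Lemma ex_horizontal_derive_Cpower (nu : R) (z : C) : 0 < Re z ->
  exists l, horizontal_derive (fun w => Cpower (w / RtoC 2) nu) z l.
Proof.
  intros Hz. destruct z as [x y]. cbn [Re fst] in Hz.
  set (m := fun t : R => Rpower (sqrt ((t / 2) ^ 2 + (y / 2) ^ 2)) nu).
  set (th := fun t : R => nu * atan ((y / 2) / (t / 2))).
  assert (Hp : 0 < (x / 2) ^ 2 + (y / 2) ^ 2).
  { assert (Q := pow2_ge_0 (y / 2)). assert (0 < (x / 2) ^ 2) by (apply pow_lt; lra). lra. }
  assert (Dm : ex_derive m x).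
  { unfold m, Rpower. auto_derive. repeat split; [|apply sqrt_lt_R0]; simpl in *; lra. }
  assert (Dt : ex_derive th x).
  { unfold th. apply (ex_derive_scal (fun t => atan (y / 2 / (t / 2)))).
    apply (ex_derive_comp atan (fun t => y / 2 / (t / 2))).
    - apply ex_derive_Reals_1. apply derivable_pt_atan.
    - auto_derive. lra. }
  assert (D1 : ex_derive (fun t => m t * cos (th t)) x).
  { apply ex_derive_mult; [exact Dm|]. apply (ex_derive_comp cos th); [|exact Dt].
    apply ex_derive_Reals_1, derivable_pt_cos. }
  assert (D2 : ex_derive (fun t => m t * sin (th t)) x).
  { apply ex_derive_mult; [exact Dm|]. apply (ex_derive_comp sin th); [|exact Dt].
    apply ex_derive_Reals_1, derivable_pt_sin. }
  exists (Derive (fun t => m t * cos (th t)) x, Derive (fun t => m t * sin (th t)) x).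
  apply (horizontal_derive_ext (fun w => polar (m (Re w)) (th (Re w)))); [exact Hz| |].
  - intros t Ht. cbn [Im Re fst snd].
    replace ((t, y) / RtoC 2)%C with ((t / 2, y / 2) : C).
    + rewrite Cpower_right by lra. reflexivity.
    + unfold Cdiv, Cmult, Cinv, RtoC; simpl. f_equal; field.
  - split; apply Derive_correct; assumption.
Qed.

Lemma Re_combination (p q r : C) (t : R) : Re (p - q - RtoC t * r)%C = Re p - Re q - t * Re r.
Proof. destruct p, q, r; simpl; ring. Qed.

Lemma Im_combination (p q r : C) (t : R) : Im (p - q - RtoC t * r)%C = Im p - Im q - t * Im r.
Proof. destruct p, q, r; simpl; ring. Qed.

(** The expansion of [CPSeries a] is used at [(z/2)^2] with the increment
    [z t / 2 + t^2 / 4]. *)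
Lemma horizontal_derive_CPSeries_sqr (a : nat -> R) (z : C) : entire a ->
  horizontal_derive (fun w => CPSeries a ((w / RtoC 2) ^ 2)%C) z
    (z / RtoC 2 * CPSeries (deriv a) ((z / RtoC 2) ^ 2))%C.
Proof.
  intros Ha. destruct z as [x y]. set (z := (x, y) : C).
  set (u := ((z / RtoC 2) ^ 2)%C). set (d := CPSeries (deriv a) u).
  set (K := Series (fun n => Rabs (euler (euler a) n) * (Cmod u + 1) ^ n)).
  assert (Hz := Cmod_ge_0 z). set (A := Cmod z / 2 + 1).
  assert (HA : 1 <= A) by (unfold A; lra).
  assert (HK : 0 <= K).
  { assert (P := Cmod_ge_0 (CPSeries a (u + 0) - CPSeries a u - 0 * CPSeries (deriv a) u)).
    apply Series_nonneg.
    - apply entire_euler; [now apply entire_euler|]. assert (Q := Cmod_ge_0 u). lra.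
    - intros n. apply Rmult_le_pos; [apply Rabs_pos|]. apply pow_le.
      assert (Q := Cmod_ge_0 u). lra. }
  assert (Hr : 0 < / A) by (apply Rinv_0_lt_compat; lra).
  assert (Hr1 : / A <= 1) by (rewrite <- Rinv_1; apply Rinv_le_contravar; lra).
  assert (key : forall t : R, Rabs t <= / A ->
    Cmod (CPSeries a (((x + t, y) / RtoC 2) ^ 2) - CPSeries a u - RtoC t * (z / RtoC 2 * d))
    <= t ^ 2 * (A ^ 2 * K + Cmod d)).
  { intros t Ht.
    assert (E : ((x + t, y) : C) = (z + RtoC t)%C).
    { unfold z, Cplus, RtoC; simpl. now rewrite Rplus_0_r. }
    rewrite E. set (s := (RtoC t * (z / RtoC 2 + RtoC (t / 4)))%C).
    assert (E4 : RtoC (t / 4) = (RtoC t / (RtoC 2 * RtoC 2))%C).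
    { rewrite <- RtoC_mult. unfold Rdiv, Cdiv. rewrite RtoC_mult, RtoC_inv by lra.
      do 3 f_equal; ring. }
    assert (N2 : RtoC 2 <> RtoC 0) by (intros H; apply RtoC_inj in H; lra).
    replace (((z + RtoC t) / RtoC 2) ^ 2)%C with (u + s)%C
      by (unfold u, s; rewrite E4; field; exact N2).
    assert (Hs : Cmod s <= Rabs t * A).
    { unfold s. rewrite Cmod_mult, Cmod_R. apply Rmult_le_compat_l; [apply Rabs_pos|].
      eapply Rle_trans; [apply Cmod_triangle|]. rewrite Cmod_div, !Cmod_R by exact N2.
      rewrite (Rabs_pos_eq 2) by lra.
      replace (t / 4) with (t * / 4) by reflexivity.
      rewrite Rabs_mult, (Rabs_pos_eq (/ 4)) by lra.
      unfold A. assert (Q := Rabs_pos t). lra. }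
    assert (Hs1 : Cmod s <= 1).
    { eapply Rle_trans; [exact Hs|].
      apply Rle_trans with (/ A * A); [apply Rmult_le_compat_r; lra|].
      rewrite Rinv_l; lra. }
    replace (CPSeries a (u + s) - CPSeries a u - RtoC t * (z / RtoC 2 * d))%C
      with ((CPSeries a (u + s) - CPSeries a u - s * d) + RtoC t * RtoC (t / 4) * d)%C
      by (unfold s; ring).
    eapply Rle_trans; [apply Cmod_triangle|].
    rewrite Rmult_plus_distr_l. apply Rplus_le_compat.
    - eapply Rle_trans; [apply (CPSeries_expansion a u s Ha Hs1)|]. fold K.
      rewrite <- Rmult_assoc. apply Rmult_le_compat_r; [assumption|].
      rewrite <- (pow2_abs t), <- Rpow_mult_distr. apply pow_incr.
      split; [apply Cmod_ge_0|exact Hs].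
    - rewrite !Cmod_mult, !Cmod_R. apply Rmult_le_compat_r; [apply Cmod_ge_0|].
      rewrite <- Rabs_mult, Rabs_pos_eq by nra. nra. }
  split; apply is_derive_quadratic with (A ^ 2 * K + Cmod d) (/ A); try assumption; intros t Ht.
  - eapply Rle_trans; [|exact (key t Ht)]. eapply Rle_trans; [|apply re_le_Cmod].
    apply Req_le, f_equal. symmetry. apply (Re_combination _ (CPSeries a u)).
  - eapply Rle_trans; [|exact (key t Ht)]. eapply Rle_trans; [|apply im_le_Cmod].
    apply Req_le, f_equal. symmetry. apply (Im_combination _ (CPSeries a u)).
Qed.

(** * Cauchy products *)

(** Sums over [k + l = n].  Keeping both indices as arguments turns index shifts into
    [antidiag_sum_shift_l] and [antidiag_sum_shift_r]. *)
Definition antidiag_sum (F : nat -> nat -> R) (n : nat) : R :=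
  sum_f_R0 (fun k => F k (n - k)%nat) n.

Lemma antidiag_sum_ext (F G : nat -> nat -> R) (n : nat) :
  (forall k l, (k + l)%nat = n -> F k l = G k l) -> antidiag_sum F n = antidiag_sum G n.
Proof. intros H. apply sum_eq. intros k Hk. apply H. lia. Qed.

Lemma antidiag_sum_plus (F G : nat -> nat -> R) (n : nat) :
  antidiag_sum (fun k l => F k l + G k l) n = antidiag_sum F n + antidiag_sum G n.
Proof. apply sum_plus. Qed.

Lemma antidiag_sum_scal (c : R) (F : nat -> nat -> R) (n : nat) :
  antidiag_sum (fun k l => c * F k l) n = c * antidiag_sum F n.
Proof.
  unfold antidiag_sum. rewrite scal_sum. apply sum_eq. intros; ring.
Qed.

Lemma antidiag_sum_shift_l (F : nat -> nat -> R) (n : nat) : (forall l, F O l = 0) ->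
  antidiag_sum F (S n) = antidiag_sum (fun k l => F (S k) l) n.
Proof.
  intros H. unfold antidiag_sum. rewrite decomp_sum by lia. rewrite H, Rplus_0_l. reflexivity.
Qed.

Lemma antidiag_sum_shift_r (F : nat -> nat -> R) (n : nat) : (forall k, F k O = 0) ->
  antidiag_sum F (S n) = antidiag_sum (fun k l => F k (S l)) n.
Proof.
  intros H. unfold antidiag_sum. rewrite tech5, Nat.sub_diag, H, Rplus_0_r.
  apply sum_eq. intros k Hk. now replace (S n - k)%nat with (S (n - k)) by lia.
Qed.

Lemma is_series_antidiag_sum (a b : nat -> R) (la lb : R) :
  is_series a la -> is_series b lb ->
  ex_series (fun n => Rabs (a n)) -> ex_series (fun n => Rabs (b n)) ->
  is_series (antidiag_sum (fun k l => a k * b l)) (la * lb).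
Proof. apply is_series_mult. Qed.

Lemma Re_mult (u v : C) : Re (u * v)%C = Re u * Re v - Im u * Im v.
Proof. reflexivity. Qed.

Lemma Im_mult (u v : C) : Im (u * v)%C = Re u * Im v + Im u * Re v.
Proof. reflexivity. Qed.

Lemma is_cseries_cauchy (a b : nat -> R) (z : C) : entire a -> entire b ->
  is_cseries (fun n => RtoC (antidiag_sum (fun k l => a k * b l)%R n) * z ^ n)%C (CPSeries a z * CPSeries b z)%C.
Proof.
  intros Ha Hb.
  assert (Hab : forall c, entire c ->
     ex_series (fun n => Rabs (Re (RtoC (c n) * z ^ n)%C)) /\
     ex_series (fun n => Rabs (Im (RtoC (c n) * z ^ n)%C))).
  { intros c Hc. assert (Hs := Hc (Cmod z) (Cmod_ge_0 z)).
    split; apply (ex_series_le_R _ _) with (2 := Hs); intros n;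
      (split; [apply Rabs_pos|]); rewrite <- Cmod_term;
      [apply re_le_Cmod|apply im_le_Cmod]. }
  destruct (Hab a Ha) as [A1 A2]. destruct (Hab b Hb) as [B1 B2].
  destruct (CPSeries_correct a z Ha) as [SA1 SA2]. destruct (CPSeries_correct b z Hb) as [SB1 SB2].
  assert (RR := is_series_antidiag_sum _ _ _ _ SA1 SB1 A1 B1).
  assert (II := is_series_antidiag_sum _ _ _ _ SA2 SB2 A2 B2).
  assert (RI := is_series_antidiag_sum _ _ _ _ SA1 SB2 A1 B2).
  assert (IR := is_series_antidiag_sum _ _ _ _ SA2 SB1 A2 B1).
  assert (E : forall k l, (RtoC (a k) * z ^ k * (RtoC (b l) * z ^ l))%C
                          = (RtoC (a k * b l) * z ^ (k + l))%C).
  { intros k l. rewrite Cpow_add_r, RtoC_mult. ring. }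
  assert (ER : forall (c : R) (w : C), Re (RtoC c * w)%C = Re w * c).
  { intros c [u v]; simpl; ring. }
  assert (EI : forall (c : R) (w : C), Im (RtoC c * w)%C = Im w * c).
  { intros c [u v]; simpl; ring. }
  split.
  - eapply is_series_ext; [|exact (is_series_plus _ _ _ _ RR (is_series_opp _ _ II))].
    intros n. cbv beta. match goal with |- plus ?x (opp ?y) = ?r => change (x + - y = r) end.
    transitivity (antidiag_sum (fun k l => Re (RtoC (a k) * z ^ k)%C * Re (RtoC (b l) * z ^ l)%C
       + -1 * (Im (RtoC (a k) * z ^ k)%C * Im (RtoC (b l) * z ^ l)%C)) n).
    { rewrite antidiag_sum_plus, antidiag_sum_scal. ring. }
    rewrite ER, <- antidiag_sum_scal. apply antidiag_sum_ext. intros k l <-.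
    rewrite <- (ER (a k * b l)), <- E.
    generalize (RtoC (a k) * z ^ k)%C (RtoC (b l) * z ^ l)%C. intros u v. rewrite Re_mult. ring.
  - eapply is_series_ext; [|exact (is_series_plus _ _ _ _ RI IR)].
    intros n. cbv beta. match goal with |- plus ?x ?y = ?r => change (x + y = r) end.
    rewrite <- antidiag_sum_plus.
    rewrite EI, <- antidiag_sum_scal. apply antidiag_sum_ext. intros k l <-.
    rewrite <- (EI (a k * b l)), <- E.
    generalize (RtoC (a k) * z ^ k)%C (RtoC (b l) * z ^ l)%C. intros u v. rewrite Im_mult. ring.
Qed.

(** * The cross product of the Bessel series *)

(** The series in [u = (w/2)^2] of [Gamma (nu + 1) (w/2)^(-nu)] times [J_nu] for
    [eps = -1] and [I_nu] for [eps = 1]. *)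
Definition bessel_coef (eps nu : R) (n : nat) : R :=
  eps ^ n / (INR (fact n) * pochhammer (nu + 1) n).

Lemma is_series_odd (w : nat -> R) (l : R) : (forall n, w (2 * n)%nat = 0) ->
  is_series w l -> is_series (fun n => w (2 * n + 1)%nat) l.
Proof.
  intros H0 H.
  assert (E : forall N, sum_n (fun n => w (2 * n + 1)%nat) N = sum_n w (2 * N + 1)).
  { induction N as [|N IH].
    - change (2 * 0 + 1)%nat with 1%nat. rewrite sum_Sn, !sum_O.
      rewrite (H0 O : w O = 0). unfold plus; simpl; ring.
    - rewrite sum_Sn, IH. replace (2 * S N + 1)%nat with (S (S (2 * N + 1))) by lia.
      rewrite !sum_Sn.
      replace (w (S (2 * N + 1))) with 0 by (rewrite <- (H0 (S N)); f_equal; lia).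
      unfold plus; simpl; ring. }
  assert (L : is_lim_seq (sum_n w) l) by exact H.
  change (is_lim_seq (sum_n (fun n => w (2 * n + 1)%nat)) l).
  apply (is_lim_seq_ext (fun N => sum_n w (2 * N + 1))); [intros n; symmetry; apply E|].
  apply (is_lim_seq_subseq (sum_n w) l (fun N => (2 * N + 1)%nat)); [|exact L].
  apply eventually_subseq. intros n; lia.
Qed.

Section Bessel.
Context (nu : R) (Hnu : -1 < nu).
Let a := bessel_coef (-1) nu.
Let b := bessel_coef 1 nu.

Lemma bessel_coef_entire (eps : R) : Rabs eps = 1 -> entire (bessel_coef eps nu).
Proof.
  intros He. assert (Hx : 0 < nu + 1) by lra.
  apply entire_le with (m := fun k => (1 + / (nu + 1)) * / INR (fact k)).
  2: apply entire_scal, entire_inv_fact.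
  intros k. unfold bessel_coef, Rdiv. rewrite Rabs_mult, <- RPow_abs, He, pow1, Rmult_1_l.
  assert (Hf := INR_fact_lt_0 k). assert (Hp := pochhammer_pos (nu + 1) k Hx).
  rewrite Rabs_pos_eq.
  - rewrite Rinv_mult, Rmult_comm. apply Rmult_le_compat_r.
    + left; now apply Rinv_0_lt_compat.
    + now apply inv_pochhammer_le.
  - left. apply Rinv_0_lt_compat. now apply Rmult_lt_0_compat.
Qed.

(** Bessel's equation [theta (theta + nu) f = eps u f]. *)
Lemma bessel_coef_recurrence (eps : R) (n : nat) :
  INR n * (INR n + nu) * bessel_coef eps nu n = eps * shift (bessel_coef eps nu) n.
Proof.
  destruct n as [|n]; [simpl; ring|]. simpl shift.
  unfold bessel_coef. rewrite fact_simpl, mult_INR. cbn [pochhammer pow].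
  assert (Hf := INR_fact_neq_0 n).
  assert (Hp := pochhammer_pos (nu + 1) n ltac:(lra)).
  assert (Hn := pos_INR n). rewrite S_INR. field. repeat split; lra.
Qed.

Definition bessel_prod_coef (n : nat) : R := antidiag_sum (fun k l => a k * b l) n.

Definition bessel_cross_coef (n : nat) : R :=
  antidiag_sum (fun k l => (INR l - INR k) * (a k * b l)) n.

(** Coefficient form of [(theta + nu) W = 2 u j i], where [theta = u d/du],
    [theta (theta + nu) j = - u j], [theta (theta + nu) i = u i] and
    [W = j theta i - i theta j]. *)
Lemma bessel_cross_coef_succ (n : nat) :
  (INR (S n) + nu) * bessel_cross_coef (S n) = 2 * bessel_prod_coef n.
Proof.
  unfold bessel_cross_coef, bessel_prod_coef. rewrite <- antidiag_sum_scal.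
  transitivity (antidiag_sum (fun k l => a k * shift b l + shift a k * b l) (S n)).
  - apply antidiag_sum_ext. intros k l Hkl.
    assert (Ra := bessel_coef_recurrence (-1) k). fold a in Ra.
    assert (Rb := bessel_coef_recurrence 1 l). fold b in Rb.
    rewrite <- Hkl, plus_INR.
    replace (shift b l) with (INR l * (INR l + nu) * b l) by lra.
    replace (shift a k) with (- (INR k * (INR k + nu) * a k)) by lra. ring.
  - rewrite antidiag_sum_plus.
    rewrite (antidiag_sum_shift_r (fun k l => a k * shift b l)) by (intros; simpl; ring).
    rewrite (antidiag_sum_shift_l (fun k l => shift a k * b l)) by (intros; simpl; ring).
    simpl shift. ring.
Qed.

(** Coefficient form of [theta (theta + nu) (theta + 2 nu) (j i) = - 2 u W]. *)
Lemma bessel_prod_coef_succ (n : nat) :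
  INR (S n) * (INR (S n) + nu) * (INR (S n) + 2 * nu) * bessel_prod_coef (S n)
  = - 2 * bessel_cross_coef n.
Proof.
  unfold bessel_cross_coef, bessel_prod_coef. rewrite <- !antidiag_sum_scal.
  transitivity (antidiag_sum (fun k l =>
      - (INR k + INR l + 2 * nu + 2 * INR l) * (shift a k * b l)
      + (INR k + INR l + 2 * nu + 2 * INR k) * (a k * shift b l)) (S n)).
  - apply antidiag_sum_ext. intros k l Hkl.
    assert (Ra := bessel_coef_recurrence (-1) k). fold a in Ra.
    assert (Rb := bessel_coef_recurrence 1 l). fold b in Rb.
    rewrite <- Hkl, plus_INR.
    replace (shift b l) with (INR l * (INR l + nu) * b l) by lra.
    replace (shift a k) with (- (INR k * (INR k + nu) * a k)) by lra. ring.
  - rewrite antidiag_sum_plus.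
    rewrite (antidiag_sum_shift_l (fun k l => - (INR k + INR l + 2 * nu + 2 * INR l) * (shift a k * b l)))
      by (intros; simpl; ring).
    rewrite (antidiag_sum_shift_r (fun k l => (INR k + INR l + 2 * nu + 2 * INR k) * (a k * shift b l)))
      by (intros; simpl; ring).
    rewrite <- antidiag_sum_plus. apply antidiag_sum_ext. intros k l _. simpl shift.
    rewrite !S_INR. ring.
Qed.

(** The chain starts at the odd product coefficient of index [1], which vanishes because
    the two series differ by [u |-> - u]; from index [3] on all factors of
    [bessel_prod_coef_succ] are positive. *)
Lemma bessel_cross_coef_even (n : nat) : bessel_cross_coef (2 * n) = 0 /\ bessel_prod_coef (2 * n + 1) = 0.
Proof.
  induction n as [|n [IHc IHp]].
  - split.
    + unfold bessel_cross_coef, antidiag_sum; simpl. ring.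
    + unfold bessel_prod_coef, antidiag_sum, a, b, bessel_coef; simpl. field. lra.
  - assert (Hn := pos_INR n).
    assert (Hc : bessel_cross_coef (2 * S n) = 0).
    { replace (2 * S n)%nat with (S (2 * n + 1)) by lia.
      assert (H := bessel_cross_coef_succ (2 * n + 1)). rewrite IHp, Rmult_0_r in H.
      apply Rmult_integral in H. destruct H as [H|H]; [|exact H].
      rewrite S_INR, plus_INR, mult_INR in H. simpl in H. lra. }
    split; [exact Hc|].
    replace (2 * S n + 1)%nat with (S (2 * S n)) by lia.
    assert (H := bessel_prod_coef_succ (2 * S n)). rewrite Hc, Rmult_0_r in H.
    apply Rmult_integral in H. destruct H as [H|H]; [exfalso|exact H].
    assert (E : INR (S (2 * S n)) = 2 * (INR n + 1) + 1).
    { rewrite S_INR, mult_INR, (S_INR n). simpl. ring. }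
    rewrite E in H.
    assert (D : 0 < (2 * (INR n + 1) + 1) * (2 * (INR n + 1) + 1 + nu)
                    * (2 * (INR n + 1) + 1 + 2 * nu)).
    { repeat apply Rmult_lt_0_compat; lra. }
    lra.
Qed.

Lemma bessel_cross_coef_odd (n : nat) :
  bessel_cross_coef (2 * n + 1) = 2 / (nu + 1) * (hcoef nu n * 16 ^ n).
Proof.
  induction n as [|n IH].
  - assert (H := bessel_cross_coef_succ 0). simpl Nat.mul. simpl Nat.add.
    unfold bessel_prod_coef, antidiag_sum, a, b, bessel_coef in H. unfold hcoef. simpl in *.
    apply Rmult_eq_reg_l with (1 + nu); [|lra]. rewrite H. field. lra.
  - assert (Hn := pos_INR n).
    assert (H1 := bessel_prod_coef_succ (2 * n + 1)). assert (H2 := bessel_cross_coef_succ (S (2 * n + 1))).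
    replace (2 * S n + 1)%nat with (S (S (2 * n + 1))) by lia.
    rewrite IH in H1.
    assert (E1 : INR (S (2 * n + 1)) = 2 * INR n + 2).
    { rewrite S_INR, plus_INR, mult_INR. simpl. ring. }
    rewrite (S_INR (S (2 * n + 1))), E1 in H2. rewrite E1 in H1.
    set (c := bessel_cross_coef (S (S (2 * n + 1)))) in *.
    set (p := bessel_prod_coef (S (2 * n + 1))) in *.
    assert (Ep : p = - 2 * (2 / (nu + 1) * (hcoef nu n * 16 ^ n))
      / ((2 * INR n + 2) * (2 * INR n + 2 + nu) * (2 * INR n + 2 + 2 * nu))).
    { rewrite <- H1. field. repeat split; lra. }
    assert (Ec : c = 2 * p / (2 * INR n + 2 + 1 + nu)) by (rewrite <- H2; field; lra).
    rewrite Ec, Ep. unfold hcoef.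
    replace (2 * S n)%nat with (S (S (2 * n))) by lia.
    rewrite fact_simpl, (mult_INR (S n)). cbn [pochhammer pow].
    rewrite !S_INR, mult_INR. simpl (INR 2).
    assert (Hf := INR_fact_neq_0 n).
    assert (P1 := pochhammer_pos (nu + 1) n ltac:(lra)).
    assert (P2 := pochhammer_pos (nu + 2) (2 * n) ltac:(lra)).
    assert (H16 : 16 ^ n <> 0) by (apply pow_nonzero; lra).
    field. repeat split; try lra.
Qed.

Lemma cross_product (u : C) :
  (CPSeries a u * CPSeries (euler b) u - CPSeries (euler a) u * CPSeries b u)%C
  = (RtoC (2 / (nu + 1)) * (u * CPSeries (hcoef nu) (RtoC 16 * u ^ 2)))%C.
Proof.
  assert (Ha : entire a) by (apply bessel_coef_entire; rewrite Rabs_left; lra).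
  assert (Hb : entire b) by (apply bessel_coef_entire; rewrite Rabs_pos_eq; lra).
  assert (H : is_cseries (fun n => RtoC (bessel_cross_coef n) * u ^ n)%C
     (CPSeries a u * CPSeries (euler b) u - CPSeries (euler a) u * CPSeries b u)%C).
  { replace (CPSeries a u * CPSeries (euler b) u - CPSeries (euler a) u * CPSeries b u)%C
      with (CPSeries a u * CPSeries (euler b) u + RtoC (- (1)) * (CPSeries (euler a) u * CPSeries b u))%C
      by (rewrite RtoC_opp; ring).
    eapply is_cseries_ext.
    2:{ apply is_cseries_plus; [|apply is_cseries_scal];
        apply is_cseries_cauchy; auto using entire_euler. }
    intros n. cbv beta. rewrite Cmult_assoc, <- RtoC_mult, <- Cmult_plus_distr_r, <- RtoC_plus.
    rewrite <- antidiag_sum_scal, <- antidiag_sum_plus. f_equal. f_equal.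
    apply antidiag_sum_ext. intros k l _. unfold euler. ring. }
  destruct H as [H1 H2].
  assert (Ho : is_cseries (fun n => RtoC (bessel_cross_coef (2 * n + 1)) * u ^ (2 * n + 1))%C
     (CPSeries a u * CPSeries (euler b) u - CPSeries (euler a) u * CPSeries b u)%C).
  { split.
    - apply (is_series_odd (fun n => Re (RtoC (bessel_cross_coef n) * u ^ n)%C)); [|exact H1].
      intros n. rewrite (proj1 (bessel_cross_coef_even n)). simpl. ring.
    - apply (is_series_odd (fun n => Im (RtoC (bessel_cross_coef n) * u ^ n)%C)); [|exact H2].
      intros n. rewrite (proj1 (bessel_cross_coef_even n)). simpl. ring. }
  rewrite <- (is_cseries_unique _ _ Ho). apply is_cseries_unique.
  eapply is_cseries_ext.
  2: apply is_cseries_scal, is_cseries_scal, CPSeries_correct, laguerre_polya_entire,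
       hcoef_laguerre_polya; exact Hnu.
  intros n. cbv beta.
  rewrite bessel_cross_coef_odd, Cpow_add_r, Cpow_mult_r, Cpow_mult_l, Cpow_1_r.
  rewrite !RtoC_mult, RtoC_pow. ring.
Qed.

(** * The normalised cross product [h] as a power series *)

Lemma Bessel_series (eps : R) (v : C) (u : nat -> C) : Rabs eps = 1 -> v <> RtoC 0 ->
  (forall n, u n = (RtoC (eps ^ n / (INR (fact n) * Gamma (nu + INR n + 1)))
     * Cpower v (2 * INR n + nu))%C) ->
  CSeries u
  = (RtoC (/ Gamma (nu + 1)) * Cpower v nu * CPSeries (bessel_coef eps nu) (v ^ 2))%C.
Proof.
  intros He Hv Hu. apply is_cseries_unique.
  eapply is_cseries_ext; [|apply is_cseries_scal, CPSeries_correct, bessel_coef_entire, He].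
  intros n. cbv beta. rewrite Hu, Cpower_add_even by assumption.
  replace (nu + INR n + 1) with (nu + 1 + INR n) by ring.
  rewrite Gamma_add_nat by lra.
  assert (HG := Gamma_pos (nu + 1) ltac:(lra)).
  assert (Hf := INR_fact_neq_0 n). assert (Hp := pochhammer_pos (nu + 1) n ltac:(lra)).
  replace (eps ^ n / (INR (fact n) * (pochhammer (nu + 1) n * Gamma (nu + 1))))
    with (/ Gamma (nu + 1) * bessel_coef eps nu n)
    by (unfold bessel_coef; field; repeat split; lra).
  rewrite RtoC_mult. ring.
Qed.

Let prefactor (w : C) : C := (RtoC (/ Gamma (nu + 1)) * Cpower (w / RtoC 2) nu)%C.

Lemma half_ne_0 (w : C) : w <> RtoC 0 -> (w / RtoC 2)%C <> RtoC 0.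
Proof.
  intros Hw. assert (N2 : RtoC 2 <> RtoC 0) by (intros H; apply RtoC_inj in H; lra).
  intros H. apply Hw. replace w with (w / RtoC 2 * RtoC 2)%C by (field; exact N2).
  rewrite H. ring.
Qed.

Lemma BesselJ_factor (w : C) : w <> RtoC 0 ->
  BesselJ nu w = (prefactor w * CPSeries a ((w / RtoC 2) ^ 2))%C.
Proof.
  intros Hw. apply (Bessel_series (-1)); [rewrite Rabs_left; lra|now apply half_ne_0|reflexivity].
Qed.

Lemma BesselI_factor (w : C) : w <> RtoC 0 ->
  BesselI nu w = (prefactor w * CPSeries b ((w / RtoC 2) ^ 2))%C.
Proof.
  intros Hw. apply (Bessel_series 1); [rewrite Rabs_pos_eq; lra|now apply half_ne_0|].
  intros n. now rewrite pow1.
Qed.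

Lemma CPSeries_euler_deriv (c : nat -> R) (u : C) : entire c ->
  (u * CPSeries (deriv c) u)%C = CPSeries (euler c) u.
Proof.
  intros Hc.
  assert (Hd := entire_deriv c Hc).
  rewrite <- CPSeries_shift by assumption. apply CPSeries_ext.
  intros [|n]; [unfold euler; simpl; ring|reflexivity].
Qed.

Lemma C_derive_factored (f : C -> C) (c : nat -> R) (w l : C) : entire c -> 0 < Re w ->
  (forall v, v <> RtoC 0 -> f v = (prefactor v * CPSeries c ((v / RtoC 2) ^ 2))%C) ->
  horizontal_derive prefactor w l ->
  C_derive f w = (l * CPSeries c ((w / RtoC 2) ^ 2)
    + prefactor w * (w / RtoC 2 * CPSeries (deriv c) ((w / RtoC 2) ^ 2)))%C.
Proof.
  intros Hc Hw Hf Hl. apply C_derive_horizontal.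
  apply (horizontal_derive_ext (fun v => prefactor v * CPSeries c ((v / RtoC 2) ^ 2))%C).
  - exact Hw.
  - intros t Ht. symmetry. apply Hf. intros E. injection E. lra.
  - apply (horizontal_derive_mult prefactor (fun v => CPSeries c ((v / RtoC 2) ^ 2)%C)).
    + exact Hl.
    + now apply horizontal_derive_CPSeries_sqr.
Qed.

(** In the Wronskian of [P j] and [P i] the derivative of the common factor [P]
    cancels. *)
Lemma Phi_factor (w : C) : 0 < Re w ->
  Phi nu w = (prefactor w ^ 2 * (w / RtoC (nu + 1)) * CPSeries (hcoef nu) (w ^ 4))%C.
Proof.
  intros Hw.
  assert (Hw0 : w <> RtoC 0) by (intros E; rewrite E in Hw; simpl in Hw; lra).
  assert (Ha : entire a) by (apply bessel_coef_entire; rewrite Rabs_left; lra).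
  assert (Hb : entire b) by (apply bessel_coef_entire; rewrite Rabs_pos_eq; lra).
  assert (Hl : exists l, horizontal_derive prefactor w l).
  { destruct (ex_horizontal_derive_Cpower nu w Hw) as [l Hl].
    exists (RtoC 0 * Cpower (w / RtoC 2) nu + RtoC (/ Gamma (nu + 1)) * l)%C.
    apply (horizontal_derive_mult (fun _ => RtoC (/ Gamma (nu + 1)))
             (fun v => Cpower (v / RtoC 2) nu)); [|exact Hl].
    split; apply (is_derive_const (K := R_AbsRing) (V := R_NormedModule)). }
  destruct Hl as [l Hl]. unfold Phi.
  rewrite (C_derive_factored (BesselJ nu) a w l Ha Hw BesselJ_factor Hl).
  rewrite (C_derive_factored (BesselI nu) b w l Hb Hw BesselI_factor Hl).
  rewrite BesselJ_factor, BesselI_factor by assumption.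
  assert (N2 : RtoC 2 <> RtoC 0) by (intros E; apply RtoC_inj in E; lra).
  assert (Nx : RtoC (nu + 1) <> RtoC 0) by (intros E; apply RtoC_inj in E; lra).
  assert (X := cross_product ((w / RtoC 2) ^ 2)).
  replace (RtoC 16 * ((w / RtoC 2) ^ 2) ^ 2)%C with (w ^ 4)%C in X.
  2:{ replace (RtoC 16) with (RtoC 2 * RtoC 2 * RtoC 2 * RtoC 2)%C
        by (rewrite <- !RtoC_mult; f_equal; ring). field. }
  assert (Hu : ((w / RtoC 2) ^ 2)%C <> RtoC 0) by now apply Cpow_nz, half_ne_0.
  set (u := ((w / RtoC 2) ^ 2)%C) in *.
  rewrite <- !CPSeries_euler_deriv in X by assumption.
  assert (Y : (CPSeries a u * CPSeries (deriv b) u - CPSeries (deriv a) u * CPSeries b u)%C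
              = (RtoC (2 / (nu + 1)) * CPSeries (hcoef nu) (w ^ 4))%C).
  { assert (Z : (u * (CPSeries a u * CPSeries (deriv b) u - CPSeries (deriv a) u * CPSeries b u))%C
               = (u * (RtoC (2 / (nu + 1)) * CPSeries (hcoef nu) (w ^ 4)))%C).
    { transitivity (RtoC (2 / (nu + 1)) * (u * CPSeries (hcoef nu) (w ^ 4)))%C; [|ring].
      rewrite <- X. ring. }
    rewrite <- (Cmult_1_l (_ - _)), <- (Cmult_1_l (RtoC (2 / (nu + 1)) * _)).
    rewrite <- (Cinv_l u Hu), <- !Cmult_assoc. now rewrite Z. }
  transitivity (prefactor w ^ 2 * (w / RtoC 2)
    * (CPSeries a u * CPSeries (deriv b) u - CPSeries (deriv a) u * CPSeries b u))%C; [ring|].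
  rewrite Y. unfold Rdiv. rewrite RtoC_mult, RtoC_inv by lra. field. exact Nx.
Qed.

(** In polar form every power has an argument that is a multiple of [Carg z], and the
    multiples [- nu/2 + 3/4], [2 nu/4] and [1/4] add up to [1]. *)
Lemma h_eq_CPSeries (z : C) : h nu z = (z * CPSeries (hcoef nu) z)%C.
Proof.
  unfold h. destruct (Req_EM_T (Cmod z) 0) as [H0|H0].
  { rewrite (Cmod_eq_0 z H0). ring. }
  assert (Hz : z <> RtoC 0) by (intros E; apply H0; now rewrite E, Cmod_0).
  destruct (polar_Carg z Hz) as [Ez Hth].
  set (r := Cmod z) in *. set (th := Carg z) in *.
  assert (Hr : 0 < r) by now apply Cmod_gt_0.
  assert (Hpi := PI_RGT_0).
  set (q := Rpower r (1 / 4)). assert (Hq : 0 < q) by apply exp_pos.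
  assert (Ew : Cpower z (1 / 4) = polar q (1 / 4 * th)) by (rewrite Ez; now apply Cpower_polar).
  assert (Hq4 : q ^ 4 = r).
  { unfold q. rewrite <- Rpower_pow, Rpower_mult by apply exp_pos.
    replace (1 / 4 * INR 4) with 1 by (simpl; field). now apply Rpower_1. }
  assert (Ew4 : (Cpower z (1 / 4) ^ 4)%C = z).
  { rewrite Ew, polar_pow, Hq4, Ez. f_equal. simpl. field. }
  rewrite Phi_factor, Ew4.
  2:{ rewrite Ew. unfold polar, Re; cbn [fst]. apply Rmult_lt_0_compat; [assumption|].
      apply cos_gt_0; lra. }
  assert (HG := Gamma_pos (nu + 1) ltac:(lra)).
  assert (EG : Gamma (nu + 2) = (nu + 1) * Gamma (nu + 1)).
  { rewrite <- Gamma_succ by lra. f_equal. ring. }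
  assert (Eh : (Cpower z (1 / 4) / RtoC 2)%C = polar (q / 2) (1 / 4 * th)).
  { rewrite Ew. unfold Cdiv. rewrite <- RtoC_inv by lra.
    rewrite Cmult_comm, polar_scal. f_equal. field. }
  assert (Ep : prefactor (Cpower z (1 / 4))
    = (RtoC (/ Gamma (nu + 1)) * polar (Rpower (q / 2) nu) (nu * (1 / 4 * th)))%C).
  { unfold prefactor. rewrite Eh, Cpower_polar by lra. reflexivity. }
  rewrite Ep, Ew, EG.
  assert (Em : Cpower z (- nu / 2 + 3 / 4)
     = polar (Rpower r (- nu / 2 + 3 / 4)) ((- nu / 2 + 3 / 4) * th)).
  { rewrite Ez. now apply Cpower_polar. }
  rewrite Em.
  assert (Nx : RtoC (nu + 1) <> RtoC 0) by (intros E; apply RtoC_inj in E; lra).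
  assert (NG : RtoC (Gamma (nu + 1)) <> RtoC 0) by (intros E; apply RtoC_inj in E; lra).
  rewrite !RtoC_mult, RtoC_inv by lra.
  transitivity (RtoC (Rpower 2 (2 * nu))
    * (polar (Rpower r (- nu / 2 + 3 / 4)) ((- nu / 2 + 3 / 4) * th)
       * (polar (Rpower (q / 2) nu) (nu * (1 / 4 * th)) ^ 2 * polar q (1 / 4 * th)))
    * CPSeries (hcoef nu) z)%C; [field; split; assumption|].
  rewrite polar_pow, !polar_mult, polar_scal. f_equal.
  rewrite Ez at 1. f_equal.
  - rewrite <- Rpower_pow, Rpower_mult by apply exp_pos.
    unfold q, Rpower, Rdiv. rewrite ln_mult, ln_Rinv, ln_exp by (try apply exp_pos; lra).
    rewrite <- !exp_plus. transitivity (exp (ln r)); [|now apply exp_ln].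
    f_equal. simpl. field.
  - simpl. field.
Qed.
End Bessel.

Theorem theorem8 (nu : R) (hnu : -1 < nu) :
  Rbar_lt (starlike_radius (h nu)) (Finite (16 * pochhammer (nu + 1) 3))
  /\
  (Rbar_lt (Finite (8 * pochhammer (nu + 1) 3)) (starlike_radius (h nu)) /\
   Rbar_lt (starlike_radius (h nu))
     (Finite (32 * pochhammer (nu + 1) 5 / (nu ^ 2 + 24 * nu + 71))))
  /\
  (Rbar_lt
     (Finite (16 * sqrt (pochhammer (nu + 1) 3 * pochhammer (nu + 1) 5
                         / (nu ^ 2 + 24 * nu + 71))))
     (starlike_radius (h nu)) /\
   Rbar_lt (starlike_radius (h nu))
     (Finite (16 * pochhammer (nu + 1) 3 * (nu + 6) * (nu + 7)
              * (nu ^ 2 + 24 * nu + 71) / nu5 nu)))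
  /\
  (Rbar_lt
     (Finite (16 * Rpower (pochhammer (nu + 1) 3 ^ 2 * pochhammer (nu + 1) 7
                           / nu5 nu) (1 / 3)))
     (starlike_radius (h nu)) /\
   Rbar_lt (starlike_radius (h nu))
     (Finite (16 * pochhammer (nu + 1) 5 * (nu + 8) * (nu + 9) * nu5 nu
              / nu6 nu))).
Proof.
  assert (Q2 : 0 < nu2 nu) by now apply nu2_pos.
  assert (Q5 := nu5_pos nu hnu). assert (Q6 := nu6_pos nu hnu).
  assert (P3 := pochhammer_pos (nu + 1) 3 ltac:(lra)).
  assert (P5 := pochhammer_pos (nu + 1) 5 ltac:(lra)).
  assert (P7 := pochhammer_pos (nu + 1) 7 ltac:(lra)).
  assert (P9 := pochhammer_pos (nu + 1) 9 ltac:(lra)).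
  assert (E7 : pochhammer (nu + 1) 7 = pochhammer (nu + 1) 5 * ((nu + 6) * (nu + 7)))
    by (cbn [pochhammer INR]; ring).
  assert (E9 : pochhammer (nu + 1) 9 = pochhammer (nu + 1) 7 * ((nu + 8) * (nu + 9)))
    by (cbn [pochhammer INR]; ring).
  destruct (starlike_bounds (hcoef nu) (h nu)) as
    (x & -> & Hx & B0 & (L1 & U1) & (L2 & U2) & (L3 & U3)).
  - now apply hcoef_laguerre_polya.
  - intros z. now apply h_eq_CPSeries.
  - unfold hcoef; simpl. lra.
  - now apply newton_2_hcoef.
  - rewrite sigma_2 by assumption. apply Rdiv_lt_0_compat; nra.
  - rewrite sigma_3 by assumption.
    apply Rdiv_lt_0_compat; [assumption|].
    apply Rmult_lt_0_compat; [lra|]. apply Rmult_lt_0_compat; [now apply pow_lt|assumption].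
  - rewrite sigma_4 by assumption.
    apply Rdiv_lt_0_compat; [assumption|].
    apply Rmult_lt_0_compat; [lra|].
    repeat (apply Rmult_lt_0_compat; [|assumption]). now apply pow_lt.
  - now apply sigma_strict.
  - rewrite sigma_1 in L1, U1 by assumption. rewrite sigma_2 in U1, L2, U2 by assumption.
    rewrite sigma_3 in U2, L3, U3 by assumption. rewrite sigma_4 in U3 by assumption.
    replace (newton 1 (hcoef nu)) with (/ (16 * pochhammer (nu + 1) 3)) in B0
      by (unfold newton; rewrite hcoef_1 by assumption; ring).
    change (nu ^ 2 + 24 * nu + 71) with (nu2 nu).
    set (p3 := pochhammer (nu + 1) 3) in *. set (p5 := pochhammer (nu + 1) 5) in *.
    set (p7 := pochhammer (nu + 1) 7) in *. set (p9 := pochhammer (nu + 1) 9) in *.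
    set (q2 := nu2 nu) in *. set (q5 := nu5 nu) in *. set (q6 := nu6 nu) in *.
    assert (Hlt : forall u v c : R, 0 < c -> u * c < v * c -> u < v).
    { intros u v c Hc H. now apply Rmult_lt_reg_r with c. }
    assert (I : forall c, 0 < c -> 0 < / c) by exact Rinv_0_lt_compat.
    assert (P3s : 0 < p3 ^ 2) by now apply pow_lt.
    cbn [Rbar_lt]. repeat split.
    + apply (Hlt _ _ (/ (16 * p3))); [apply I; lra|]. rewrite Rinv_r; lra.
    + apply (Hlt _ _ (/ (8 * p3))); [apply I; lra|]. rewrite Rinv_r; lra.
    + apply (Hlt _ _ (q2 / (256 * (p3 * p5)))).
      { apply Rdiv_lt_0_compat; nra. }
      replace (32 * p5 / q2 * (q2 / (256 * (p3 * p5)))) with (/ (8 * p3)) by (field; lra).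
      exact U1.
    + assert (Hs : p3 * p5 / q2 < (x / 16) ^ 2).
      { apply (Hlt _ _ (256 * (q2 / (256 * (p3 * p5))))).
        { apply Rmult_lt_0_compat; [lra|]. apply Rdiv_lt_0_compat; nra. }
        replace (p3 * p5 / q2 * (256 * (q2 / (256 * (p3 * p5))))) with 1 by (field; lra).
        replace ((x / 16) ^ 2 * (256 * (q2 / (256 * (p3 * p5)))))
          with (x ^ 2 * (q2 / (256 * (p3 * p5)))) by (field; lra).
        exact L2. }
      apply sqrt_lt_1 in Hs; [|apply Rdiv_le_0_compat; nra|apply pow2_ge_0].
      rewrite sqrt_pow2 in Hs by lra. lra.
    + apply (Hlt _ _ (q5 / (4096 * (p3 ^ 2 * p7)))).
      { apply Rdiv_lt_0_compat; [assumption|]. nra. }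
      replace (16 * p3 * (nu + 6) * (nu + 7) * q2 / q5 * (q5 / (4096 * (p3 ^ 2 * p7))))
        with (q2 / (256 * (p3 * p5))); [exact U2|].
      rewrite E7. field. repeat split; lra.
    + assert (Hs : p3 ^ 2 * p7 / q5 < (x / 16) ^ 3).
      { assert (D : 0 < p3 ^ 2 * p7) by nra.
        apply (Hlt _ _ (4096 * (q5 / (4096 * (p3 ^ 2 * p7))))).
        { apply Rmult_lt_0_compat; [lra|]. apply Rdiv_lt_0_compat; nra. }
        replace (p3 ^ 2 * p7 / q5 * (4096 * (q5 / (4096 * (p3 ^ 2 * p7))))) with 1
          by (field; lra).
        replace ((x / 16) ^ 3 * (4096 * (q5 / (4096 * (p3 ^ 2 * p7)))))
          with (x ^ 3 * (q5 / (4096 * (p3 ^ 2 * p7)))) by (field; lra).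
        exact L3. }
      assert (Hp : Rpower (p3 ^ 2 * p7 / q5) (1 / 3) < Rpower ((x / 16) ^ 3) (1 / 3)).
      { apply Rlt_Rpower_l; [lra|]. split; [|exact Hs]. apply Rdiv_lt_0_compat; nra. }
      rewrite <- (Rpower_pow 3 (x / 16)), Rpower_mult in Hp by lra.
      replace (INR 3 * (1 / 3)) with 1 in Hp by (simpl; field).
      rewrite Rpower_1 in Hp by lra. lra.
    + apply (Hlt _ _ (q6 / (65536 * (p3 ^ 2 * p5 * p9)))).
      { apply Rdiv_lt_0_compat; [assumption|].
        apply Rmult_lt_0_compat; [lra|].
        repeat (apply Rmult_lt_0_compat; [|assumption]). assumption. }
      replace (16 * p5 * (nu + 8) * (nu + 9) * q5 / q6 * (q6 / (65536 * (p3 ^ 2 * p5 * p9))))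
        with (q5 / (4096 * (p3 ^ 2 * p7))); [exact U3|].
      rewrite E9. field. repeat split; lra.
Qed.
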